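(* Let $\mathcal{C}$ be a class of piecewise expanding maps of $[0,1]$ such that: (1) $\mathcal{C}$ satisfies $(D_r)$ for some $r\ge 1$ and satisfies (Dec); (2) there exist $\lambda>1$ and $M\ge 1$ such that $\inf|T'|\ge\lambda$ and $\sup|T''|\le M$ for all $T\in\mathcal{C}$; (3) there exists $N\ge 1$ such that $\sharp\mathcal{A}_T\le N$ for all $T\in\mathcal{C}$. Let $(T_n)_{n\ge 1}$ be a sequence in $\mathcal{C}$ verifying (Min). Let $f:[0,1]\to\mathbb{R}$ be Lipschitz and let $$S_n=\sum_{k=0}^{n-1}\left[f\circ T_1^k-\int f\circ T_1^k\,dm\right].$$ Assume that there is $C>0$ such that $\|S_n\|_2\ge Cn^{1/2}$ for all $n\ge 1$. Then $S_n$ satisfies the almost sure central limit theorem: for $m$-almost every $x\in[0,1]$, the probability measures $$\frac{1}{H_n}\sum_{k=1}^n\frac1k\,\delta_{S_k(x)/\|S_k\|_2}$$ converge weakly, as $n\to\infty$, to the standard normal law $\mathcal{N}(0,1)$.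
   Context: $m$ is Lebesgue measure on $[0,1]$ with its Borel $\sigma$-algebra; $\|\cdot\|_2$ is the norm of $L^2(m)$; $H_n=\sum_{k=1}^n\frac1k$. A piecewise expanding map is a map $T:[0,1]\to[0,1]$ with $\inf_x|T'(x)|>1$ for which there is a finite partition $\mathcal{A}_T$ of $[0,1]$ into intervals with disjoint interiors such that $T$ can be extended to a $C^2$ map on a neighborhood of each element of $\mathcal{A}_T$. Its transfer operator $P_T:L^1(m)\to L^1(m)$ is characterized by $\int P_Tf\cdot g\,dm=\int f\cdot g\circ T\,dm$ for $f\in L^1(m)$, $g\in L^\infty(m)$. For $f\in L^1(m)$, $\mathrm{V}f$ is the infimum of the total variations on $[0,1]$ of the functions $\bar f$ with $\bar f=f$ $m$-a.e.; $\mathrm{BV}=\{f\in L^1(m):\mathrm{V}f<\infty\}$ with norm $\|f\|_{\mathrm{BV}}=\mathrm{V}f+\|f\|_{L^1_m}$. $(D_r)$: a class $\mathcal{C}$ of piecewise expanding maps satisfies $(D_r)$, $r\ge1$ an integer, if there are constants $0<\rho_r<1$, $M_0>0$, $C_r>0$ such that $\|P_Tf\|_{\mathrm{BV}}\le M_0\|f\|_{\mathrm{BV}}$ for all $T\in\mathcal{C}$, $f\in\mathrm{BV}$, and $\|P_{T_r}\cdots P_{T_1}f\|_{\mathrm{BV}}\le\rho_r\|f\|_{\mathrm{BV}}+C_r\|f\|_{L^1_m}$ for all $T_1,\ldots,T_r\in\mathcal{C}$, $f\in\mathrm{BV}$. (Dec): $\mathcal{C}$ satisfies (Dec) if there exist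 $0<\theta<1$ and $K_0>0$ such that for all $l\ge1$, all $T_1,\ldots,T_l\in\mathcal{C}$ and all $f\in\mathrm{BV}$ with $\int f\,dm=0$, $\|P_{T_l}\cdots P_{T_1}f\|_{\mathrm{BV}}\le K_0\theta^l\|f\|_{\mathrm{BV}}$. For a sequence $(T_n)_{n\ge1}$ and $n\le k$: $T_n^k=T_k\circ\cdots\circ T_n$, $P_n^k=P_{T_k}\cdots P_{T_n}$, and $T_1^0=\mathrm{Id}$. (Min): the sequence $(T_n)$ satisfies (Min) if there is $\delta>0$ with $P_1^n\mathbf{1}\ge\delta$ ($m$-a.e.) for all $n\ge1$. *)

(* Defs.v *)
From mathcomp Require Import all_boot all_order all_algebra.
From mathcomp Require Import all_classical all_reals all_analysis.

Set Implicit Arguments.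
Unset Strict Implicit.
Unset Printing Implicit Defensive.

Import Order.TTheory GRing.Theory Num.Theory.
Import numFieldNormedType.Exports.

Local Open Scope classical_set_scope.
Local Open Scope ring_scope.

(* Functions on [0,1] are total functions R -> R of which only the values on I01
   matter; m is Lebesgue measure on the Borel sets, with I01 as the domain of
   integration and of a.e. statements. *)
Notation I01 := (`[0, 1]%classic).

Section SpacesOnI01.
Context {R : realType}.
Implicit Types (f g : R -> R) (p : R).
Local Notation m := (@lebesgue_measure R).

Definition ae01 (P : R -> Prop) := {ae m, forall x, I01 x -> P x}.

Definition in_L1 f := m.-integrable I01 (EFin \o f).

Definition in_Linfty f :=
  measurable_fun (I01 : set R) f /\ exists B : R, ae01 (fun x => `|f x| <= B).

(* The norm of L^p(m): the library's norm, after extension by 0 outside I01. *)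
Definition Lnorm01 p f : \bar R := 'N[m]_p%:E[(EFin \o f) \_ I01]%E.

Definition essvar f : \bar R :=
  ereal_inf [set total_variation 0 1 g | g in [set g | ae01 (fun x => g x = f x)]].

Definition in_BV f := in_L1 f /\ (essvar f < +oo)%E.

Definition normBV f : \bar R := (essvar f + Lnorm01 1 f)%E.

Definition C2_at f x :=
  [/\ derivable f x 1, derivable (f^`()%classic) x 1 & {for x, continuous (f^`(2)%classic)}].

End SpacesOnI01.

(* The elements of the partition may share
   endpoints, where T need not agree with the C^2 extensions of its branches:
   the extension is thus required to agree with T on the interior of the
   element and to be C^2 around its closure. *)
Definition pexp_partition {R : realType} (T : R -> R) (A : set (set R)) :=
  [/\ finite_set A,
      forall J, A J -> J !=set0 /\ is_interval J,
      \bigcup_(J in A) J = I01,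
      trivIset A interior &
      forall J, A J -> exists (U : set R) (g : R -> R),
        [/\ open U, closure J `<=` U, forall x, U x -> C2_at g x &
            forall x, interior J x -> T x = g x]].

(* The points where T' and T'' are considered. *)
Definition smooth_part {R : realType} (A : set (set R)) : set R :=
  \bigcup_(J in A) interior J.

Record pexp_map (R : realType) := PExpMap {
  pexp_fun :> R -> R ;
  pexp_part : set (set R) ;
  pexp_stable : forall x, I01 x -> I01 (pexp_fun x) ;
  pexp_partP : pexp_partition pexp_fun pexp_part ;
  pexp_expanding :
    (1 < ereal_inf [set `|pexp_fun^`()%classic x|%:E | x in smooth_part pexp_part])%E
}.

Definition inf_abs_deriv {R : realType} (T : pexp_map R) : \bar R :=
  ereal_inf [set `|T^`()%classic x|%:E | x in smooth_part (pexp_part T)].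

Definition sup_abs_deriv2 {R : realType} (T : pexp_map R) : \bar R :=
  ereal_sup [set `|T^`(2)%classic x|%:E | x in smooth_part (pexp_part T)].

Section Transfer.
Context {R : realType}.
Implicit Types (T : pexp_map R) (f g h : R -> R).
Local Notation m := (@lebesgue_measure R).

Definition is_transfer T f g :=
  in_L1 g /\ forall h, in_Linfty h ->
    \int[m]_(x in I01) (g x * h x) = \int[m]_(x in I01) (f x * h (T x)).

(* A representative of the class P_T f, which exists for f in L^1(m) because T
   is nonsingular, and is unique up to m-null sets. *)
Definition transfer T f : R -> R := xget (cst 0) [set g | is_transfer T f g].

(* Sequences of maps are indexed from 1; their term of index 0 is never used. *)
Fixpoint iter_maps (T : nat -> pexp_map R) (k : nat) (x : R) : R :=
  if k is k'.+1 then T k (iter_maps T k' x) else x.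

Fixpoint iter_transfer (T : nat -> pexp_map R) (k : nat) (f : R -> R) : R -> R :=
  if k is k'.+1 then transfer (T k) (iter_transfer T k' f) else f.

End Transfer.

Section Conditions.
Context {R : realType}.
Implicit Types (C : set (pexp_map R)) (T : nat -> pexp_map R) (f : R -> R).
Local Notation m := (@lebesgue_measure R).

Definition cond_D C (r : nat) :=
  exists rho M0 Cr : R, [/\ 0 < rho < 1, 0 < M0, 0 < Cr,
    forall (S : pexp_map R) f, C S -> in_BV f ->
      (normBV (transfer S f) <= M0%:E * normBV f)%E &
    forall T f, (forall i, (0 < i <= r)%N -> C (T i)) -> in_BV f ->
      (normBV (iter_transfer T r f)
         <= rho%:E * normBV f + Cr%:E * Lnorm01 1 f)%E].

Definition cond_Dec C :=
  exists theta K0 : R, [/\ 0 < theta < 1, 0 < K0 &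
    forall (l : nat) T f, (1 <= l)%N ->
      (forall i, (0 < i <= l)%N -> C (T i)) ->
      in_BV f -> \int[m]_(x in I01) f x = 0 ->
      (normBV (iter_transfer T l f) <= (K0 * theta ^+ l)%:E * normBV f)%E].

Definition cond_Min T :=
  exists2 delta : R, 0 < delta &
    forall n, (1 <= n)%N -> ae01 (fun x => delta <= iter_transfer T n (cst 1) x).

Definition centered_birkhoff_sum f T (n : nat) (x : R) : R :=
  \sum_(0 <= k < n)
    (f (iter_maps T k x) - \int[m]_(y in I01) f (iter_maps T k y)).

(* Real-valued: 0 if the norm is infinite, which does not occur for bounded f. *)
Definition norm2 f : R := fine (Lnorm01 2 f).

End Conditions.

Section WeakConvergence.
Context {R : realType}.

Definition weak_cvg (nu_ : nat -> {measure set (measurableTypeR R) -> \bar R})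
    (nu : {measure set (measurableTypeR R) -> \bar R}) :=
  forall phi : R -> R, continuous phi ->
    (exists B : R, forall x, `|phi x| <= B) ->
    (\int[nu_ n]_x phi x) @[n --> \oo] --> \int[nu]_x phi x.

Definition Hsum (n : nat) : R := \sum_(1 <= k < n.+1) k%:R^-1.

Lemma Hsum_ge0 n : 0 <= Hsum n.
Proof. by rewrite sumr_ge0. Qed.

Lemma Hsum_inv_ge0 n : 0 <= (Hsum n)^-1.
Proof. by rewrite invr_ge0 Hsum_ge0. Qed.

(* H_n^-1 \sum_(1 <= k <= n) k^-1 \d_(y k); msum starts at 0, whence the shift.
   It is a probability measure for n >= 1. *)
Definition log_average (y : nat -> R) (n : nat) :
    {measure set (measurableTypeR R) -> \bar R} :=
  mscale (NngNum (Hsum_inv_ge0 n))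
    (msum (fun k => mscale (k.+1%:R^-1)%:nng
                      (dirac (y k.+1 : measurableTypeR R))) n).

End WeakConvergence.

(* Main.v *)
(* The centered observables X_k = f(T_1^k) - E f(T_1^k) satisfy two decorrelation
   estimates against bounded functions W of T_1^i: |E X_k W| and
   |E X_k X_j W - E X_k X_j E W|, k <= j <= i, are at most C theta^(i-k) sup |W|.
   Indeed E X_k W is the integral of P_{k+1}^i (rho_k f_k) against a function
   bounded by sup |W|, where rho_k = P_1^k 1 is bounded in BV by (D_r) and f_k is
   f minus its mean, so that (Dec) applies; the second estimate applies (Dec) again
   to P_{k+1}^j (rho_k f_k) f_j minus its multiple of rho_j of the same integral.

   For weights |c_j| <= d_j with d nonincreasing, put R_k = sum_{j >= k} c_j X_j and
   V_k = E R_k^2. Expanding cos to the second order, telescoping and decorrelating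
   gives E cos(R_k + a) = (1 - (V_k - V_{k+1}) / 2) E cos(R_{k+1} + a) + O(d_k^3),
   hence E cos(R_0 + a) = cos a exp(- V_0 / 2) + O(sum d_j^3). Applied to the sums
   and differences of two normalized Birkhoff sums Y_k, Y_l, k <= l, with standard
   deviations at least of order k^(1/2), this shows that
   u_k = cos(t Y_k + a) - cos a exp(- t^2 / 2) satisfies
   |E u_k u_l| <= C ((k/l)^(1/2) + k^(-1/2)). So the logarithmic averages of u_k
   have second moment O(1 / H_n) and tend to 0 almost surely along indices with
   H_n of order j^2, whence along all n. Averages over small frequencies give
   tightness, and trigonometric approximation concludes. *)
From HB Require Import structures.
From mathcomp Require Import all_boot all_order all_algebra.
From mathcomp Require Import ring lra.
From mathcomp Require Import all_classical all_reals all_analysis measurable_realfun.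
Require Import Defs.

Set Implicit Arguments.
Unset Strict Implicit.
Unset Printing Implicit Defensive.

Import Order.TTheory GRing.Theory Num.Theory.
Import numFieldNormedType.Exports.

Local Open Scope classical_set_scope.
Local Open Scope ring_scope.

(** * Taylor bounds for trigonometric functions *)

Section TaylorBounds.
Context {R : realType}.
Implicit Types a h x : R.

(** Regularity sits in the densities only: the law at time k has a BV density, whereas the future of
    time i enters as a merely bounded function. This forces the order of the expansion, in which the
    earliest variable is removed first and the rest is kept as one future observable. Decorrelating
    a bounded cosine directly would leave errors of order [dd k ^+ 2] at best, whose sum is not
    small. Each cosine is therefore first telescoped to a constant; the increments are themselves of
    order [dd k], and this gains the power that makes the error cubic.

    Nonincreasing weights are what combinations of two Birkhoff sums require: the coefficients are
    of order k^(-1/2) before time k and l^(-1/2) after it, so that their squares have a bounded sum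
    while their cubes sum to O(k^(-1/2)).

    Each frequency and phase has its own null set, so almost sure statements can be combined for
    countably many only. Hence the frequencies i/(q+1) and the phases 0 and pi/2. For tightness the
    frequencies vary with the index, which is possible because the second-moment bounds are uniform
    over bounded frequencies. *)

Lemma normr_le_of_derive (f f' g g' : R -> R) :
  (forall x, is_derive x (1:R) f (f' x)) -> (forall x, is_derive x (1:R) g (g' x)) ->
  f 0 = 0 -> g 0 = 0 -> (forall x, 0 <= x -> `|f' x| <= g' x) ->
  forall x, 0 <= x -> `|f x| <= g x.
Proof.
move=> df dg f0 g0 fg x x0.
have key (u u' : R -> R) : (forall x, is_derive x (1:R) u (u' x)) ->
    (forall x, 0 <= x -> 0 <= u' x) -> u 0 = 0 -> 0 <= u x.
  move=> du u'0 u0.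
  have cu : {within `[0, x], continuous u}.
    apply: derivable_within_continuous => y _.
    exact: (@ex_derive _ _ _ _ _ _ _ (du y)).
  have [c cx] := MVT_segment x0 (fun y _ => du y) cu.
  rewrite u0 subr0 => ->; rewrite subr0 mulr_ge0// u'0//.
  by move: cx; rewrite in_itv/= => /andP[].
rewrite ler_norml; apply/andP; split.
- rewrite -subr_ge0 opprK.
  apply: (key (fun x => f x + g x) (fun x => f' x + g' x)).
  + by move=> y y0; have := fg y y0; rewrite ler_norml -subr_ge0 opprK => /andP[].
  + by rewrite f0 g0 addr0.
- rewrite -subr_ge0.
  apply: (key (fun x => g x - f x) (fun x => g' x - f' x)).
  + by move=> y y0; have := fg y y0; rewrite ler_norml subr_ge0 => /andP[].
  + by rewrite f0 g0 subr0.
Qed.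

Lemma norm_sin_le h : `|sin h| <= `|h|.
Proof.
wlog h0 : h / 0 <= h => [H|].
  have [/H//|/ltW h0] := leP 0 h.
  by rewrite -normrN -sinN -(normrN h); apply: H; rewrite oppr_ge0.
rewrite (ger0_norm h0).
apply: (@normr_le_of_derive sin cos id (fun=> 1)) => //.
- exact: sin0.
- by move=> x _; exact: cos_max.
Qed.

Lemma cosB1_le h : `|cos h - 1| <= h ^+ 2 / 2.
Proof.
have -> : cos h - 1 = - (sin (h / 2) ^+ 2 *+ 2).
  have {1}-> : h = (h / 2) *+ 2 by rewrite mulr2n; lra.
  by rewrite cos_mulr2n cos2sin2; ring.
rewrite normrN normrMn normrX.
have := norm_sin_le (h / 2); set u : R := `|sin _| => hu.
have : u ^+ 2 <= `|h / 2| ^+ 2 by apply: lerXn2r; rewrite ?nnegrE /u //;exact: normr_ge0.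
by rewrite (real_normK (num_real (h / 2))); lra.
Qed.

Lemma cosB1_le2 h : `|cos h - 1| <= 2.
Proof. by rewrite ler_norml; have := cos_geN1 h; have := cos_le1 h; lra. Qed.

Lemma sinB_le h : `|sin h - h| <= `|h| ^+ 2.
Proof.
wlog h0 : h / 0 <= h => [H|].
  have [/H//|/ltW h0] := leP 0 h.
  rewrite -(normrN h) -(normrN (sin h - h)) (_ : - (sin h - h) = sin (- h) - (- h)).
    by apply: H; rewrite oppr_ge0.
  by rewrite sinN; ring.
rewrite (ger0_norm h0).
apply: (@normr_le_of_derive (fun x => sin x - x) (fun x => cos x - 1)
  (fun x => x ^+ 2) (fun x => 2 * x)) => //.
- by move=> x; apply: is_derive_eq; rewrite /GRing.scale/=; ring.
- by rewrite sin0 subr0.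
- by rewrite expr0n.
- move=> x x0; have := cosB1_le x; have := cosB1_le2 x.
  have [x1|x1] := leP x 4; last by lra.
  by nra.
Qed.

Lemma sinB_le3 h : `|sin h - h| <= `|h| ^+ 3.
Proof.
wlog h0 : h / 0 <= h => [H|].
  have [/H//|/ltW h0] := leP 0 h.
  rewrite -(normrN h) -(normrN (sin h - h)) (_ : - (sin h - h) = sin (- h) - (- h)).
    by apply: H; rewrite oppr_ge0.
  by rewrite sinN; ring.
rewrite (ger0_norm h0).
apply: (@normr_le_of_derive (fun x => sin x - x) (fun x => cos x - 1)
  (fun x => x ^+ 3) (fun x => 3 * x ^+ 2)) => //.
- by move=> x; apply: is_derive_eq; rewrite /GRing.scale/=; ring.
- by rewrite sin0 subr0.
- by rewrite expr0n.
- by move=> x x0; have := cosB1_le x; nra.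
Qed.

Lemma cosB1D_le h : `|cos h - 1 + h ^+ 2 / 2| <= `|h| ^+ 3.
Proof.
wlog h0 : h / 0 <= h => [H|].
  have [/H//|/ltW h0] := leP 0 h.
  by rewrite -(normrN h) -(cosN h) -(sqrrN h); apply: H; rewrite oppr_ge0.
rewrite (ger0_norm h0).
apply: (@normr_le_of_derive (fun x => cos x - 1 + x ^+ 2 / 2) (fun x => - sin x + x)
  (fun x => x ^+ 3) (fun x => 3 * x ^+ 2)) => //.
- move=> x; apply: is_derive_eq; rewrite /GRing.scale/=; lra.
- move=> x; apply: is_derive_eq; rewrite /GRing.scale/=; ring.
- by rewrite cos0 expr0n/=; lra.
- by rewrite expr0n.
- move=> x x0; rewrite -normrN (_ : - (- sin x + x) = sin x - x); last by ring.
  by have := sinB_le x; rewrite (ger0_norm x0); nra.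
Qed.

Lemma norm_comb (a b p q e e' : R) : `|a| <= 1 -> `|b| <= 1 -> `|p| <= e -> `|q| <= e' ->
  `|a| * `|p| + `|b| * `|q| <= e + e'.
Proof.
by move=> a1 b1 pe qe; apply: lerD; rewrite -[leRHS]mul1r ler_pM.
Qed.

Lemma cos_taylor3 x h :
  `|cos (x + h) - cos x + h * sin x + h ^+ 2 / 2 * cos x| <= 2 * `|h| ^+ 3.
Proof.
have -> : cos (x + h) - cos x + h * sin x + h ^+ 2 / 2 * cos x =
    cos x * (cos h - 1 + h ^+ 2 / 2) - sin x * (sin h - h).
  by rewrite cosD; ring.
apply: le_trans (ler_normB _ _) _; rewrite !normrM mulr_natl mulr2n.
by apply: norm_comb (cos_max _) (sin_max _) (cosB1D_le h) (sinB_le3 h).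
Qed.

Lemma sin_taylor2 x h : `|sin (x + h) - sin x - h * cos x| <= 2 * `|h| ^+ 2.
Proof.
have -> : sin (x + h) - sin x - h * cos x =
    sin x * (cos h - 1) + cos x * (sin h - h).
  by rewrite sinD; ring.
apply: le_trans (ler_normD _ _) _; rewrite !normrM.
apply: le_trans (norm_comb (sin_max _) (cos_max _) (cosB1_le h) (sinB_le h)) _.
by rewrite (real_normK (num_real h)); have := sqr_ge0 h; lra.
Qed.

Lemma cos_lip x y : `|cos x - cos y| <= 2 * `|x - y|.
Proof.
have -> : cos x = cos (y + (x - y)) by congr cos; ring.
set h := x - y.
have -> : cos (y + h) - cos y = cos y * (cos h - 1) - sin y * sin h.
  by rewrite cosD; ring.
apply: le_trans (ler_normB _ _) _; rewrite !normrM.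
have h1 : `|cos h - 1| <= `|h|.
  have := cosB1_le h; have := cosB1_le2 h; rewrite -real_normK ?num_real//.
  by have : 0 <= `|h| by []; set u : R := `|h|; nra.
rewrite mulr_natl mulr2n.
by apply: norm_comb (cos_max _) (sin_max _) h1 (norm_sin_le _).
Qed.

(** For [|s| <= 1/2] the bound is [2 * s ^+ 2], by comparison with the inverse of 1 + s; otherwise 4
    s^2 is at least 1 and absorbs the trivial bound [expR S + 1 + S]. *)
Lemma expRN_taylor2 (S s : R) : `|s| <= S ->
  `|expR (- s) - 1 + s| <= (4 * (expR S + 1 + S) + 2) * s ^+ 2.
Proof.
move=> sS.
have S0 : 0 <= S by apply: le_trans sS.
have eS : 0 <= expR S by exact: expR_ge0.
have [s12|s12] := leP `|s| (1/2).
  have h1 : 0 <= expR (- s) - 1 + s by have := expR_ge1Dx (- s); lra.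
  have s0 : 0 < 1 + s by move: s12; rewrite ler_norml; lra.
  have h2 : expR (- s) <= (1 + s)^-1.
    by rewrite expRN lef_pV2 ?posrE ?expR_gt0// expR_ge1Dx.
  have h3 : (1 + s)^-1 <= 1 - s + 2 * s ^+ 2.
    rewrite -[X in X <= _]mul1r ler_pdivrMr//.
    by move: s12; rewrite ler_norml => /andP[? ?]; nra.
  rewrite (ger0_norm h1).
  have : 0 <= s ^+ 2 by rewrite sqr_ge0.
  by nra.
have h1 : `|expR (- s) - 1 + s| <= expR S + 1 + S.
  have : expR (- s) <= expR S.
    by rewrite ler_expR; apply: le_trans sS; rewrite -normrN ler_norm.
  move: sS; rewrite !ler_norml; have := expR_ge0 (- s); lra.
apply: le_trans h1 _.
have s4 : 1 <= 4 * s ^+ 2.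
  by rewrite -real_normK ?num_real//; nra.
have : 0 <= expR S + 1 + S by lra.
by nra.
Qed.

End TaylorBounds.

(** * Expectations of bounded functions *)

Section BoundedExpectation.
Context d (Om : measurableType d) (R : realType) (mu : {measure set Om -> \bar R}).
Context (D : set Om) (mD : measurable D) (muD : mu D = 1%E).
Implicit Types (f g : Om -> R).

(** Boundedness on a set of mass 1 makes integrability automatic, so that linearity of expectations
    only asks for the closure properties below. *)
Definition bmf f := measurable_fun D f /\ exists B : R, forall x, D x -> `|f x| <= B.

Local Notation "'EE' f" := (\int[mu]_(x in D) f x) (at level 10, f at level 8).

Lemma bmf_integrable f : bmf f -> mu.-integrable D (EFin \o f).
Proof.
move=> [mf [B fB]]; apply: measurable_bounded_integrable => //.
  by rewrite muD ltry.
exists B; split; first exact: num_real.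
by move=> M BM x Dx; apply: le_trans (fB x Dx) (ltW BM).
Qed.

Lemma bmf_cst (r : R) : bmf (fun=> r).
Proof. by split; [exact: measurable_cst|exists `|r|]. Qed.

Lemma bmfD f g : bmf f -> bmf g -> bmf (fun x => f x + g x).
Proof.
move=> [mf [B fB]] [mg [C gC]]; split; first exact: measurable_funD.
by exists (B + C) => x Dx; apply: le_trans (ler_normD _ _) (lerD (fB x Dx) (gC x Dx)).
Qed.

Lemma bmfM f g : bmf f -> bmf g -> bmf (fun x => f x * g x).
Proof.
move=> [mf [B fB]] [mg [C gC]]; split; first exact: measurable_funM.
by exists (B * C) => x Dx; rewrite normrM ler_pM// ?fB ?gC.
Qed.

Lemma bmfN f : bmf f -> bmf (fun x => - f x).
Proof.
move=> [mf [B fB]]; split; first exact: measurableT_comp.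
by exists B => x Dx; rewrite normrN fB.
Qed.

Lemma bmfB f g : bmf f -> bmf g -> bmf (fun x => f x - g x).
Proof. by move=> bf bg; apply: bmfD => //; exact: bmfN. Qed.

Lemma bmfX f n : bmf f -> bmf (fun x => f x ^+ n).
Proof.
move=> [mf [B fB]]; split; first exact: measurable_funX.
by exists (B ^+ n) => x Dx; rewrite normrX lerXn2r// ?nnegrE ?fB// (le_trans _ (fB x Dx)).
Qed.

Lemma bmf_sum (I : Type) (r : seq I) (F : I -> Om -> R) :
  (forall i, bmf (F i)) -> bmf (fun x => \sum_(i <- r) F i x).
Proof.
move=> bF; elim: r => [|i r IH].
  by under eq_fun do rewrite big_nil; exact: bmf_cst.
by under eq_fun do rewrite big_cons; exact: bmfD.
Qed.

Lemma bmf_cos f : bmf f -> bmf (fun x => cos (f x)).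
Proof.
move=> [mf _]; split; last by exists 1 => x _; exact: cos_max.
by apply: measurableT_comp => //; apply: continuous_measurable_fun; exact: continuous_cos.
Qed.

Lemma bmf_norm f : bmf f -> bmf (fun x => `|f x|).
Proof.
move=> [mf [B fB]]; split; first exact: measurableT_comp.
by exists B => x Dx; rewrite normr_id fB.
Qed.

Lemma EE_cst (r : R) : EE (fun=> r) = r.
Proof. by rewrite Rintegral_cst// muD mulr1. Qed.

Lemma EED f g : bmf f -> bmf g -> EE (fun x => f x + g x) = EE f + EE g.
Proof. by move=> bf bg; rewrite RintegralD//; exact: bmf_integrable. Qed.

Lemma EEB f g : bmf f -> bmf g -> EE (fun x => f x - g x) = EE f - EE g.
Proof. by move=> bf bg; rewrite RintegralB//; exact: bmf_integrable. Qed.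

Lemma EEZ (r : R) f : bmf f -> EE (fun x => r * f x) = r * EE f.
Proof. by move=> bf; rewrite RintegralZl//; exact: bmf_integrable. Qed.

Lemma EE_ext f g : (forall x, D x -> f x = g x) -> EE f = EE g.
Proof. by move=> fg; apply: eq_Rintegral => x; rewrite inE; exact: fg. Qed.

Lemma EE_le f g : bmf f -> bmf g -> (forall x, D x -> f x <= g x) -> EE f <= EE g.
Proof. by move=> bf bg; apply: le_Rintegral => //; exact: bmf_integrable. Qed.

Lemma EE_norm f (B : R) : bmf f -> (forall x, D x -> `|f x| <= B) -> `|EE f| <= B.
Proof.
move=> bf fB; apply: le_trans (le_normr_Rintegral mD (bmf_integrable bf)) _.
by rewrite -[leRHS]EE_cst; apply: EE_le fB; [exact: bmf_norm|exact: bmf_cst].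
Qed.

Lemma EE_sum (I : Type) (r : seq I) (F : I -> Om -> R) :
  (forall i, bmf (F i)) -> EE (fun x => \sum_(i <- r) F i x) = \sum_(i <- r) EE (F i).
Proof.
move=> bF; elim: r => [|i r IH].
  by rewrite big_nil -[RHS]EE_cst; apply: EE_ext => x _; rewrite big_nil.
rewrite big_cons -IH -EED//; last exact: bmf_sum.
by apply: EE_ext => x _; rewrite big_cons.
Qed.

End BoundedExpectation.

Ltac bmf_auto := repeat first
  [ exact: bmf_cst | done | apply: bmfD | apply: bmfN | apply: bmfM | apply: bmfX
  | apply: bmf_cos | apply: bmf_norm | apply: bmf_sum => ? ].

(** * Characteristic functions of mixing sequences *)

Lemma sum_geo_le (R : realType) (t : R) n : 0 < t < 1 ->
  \sum_(0 <= i < n) t ^+ i <= (1 - t)^-1.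
Proof.
move=> /andP[t0 t1].
have t1' : 0 < 1 - t by rewrite subr_gt0.
rewrite -[leRHS]mul1r ler_pdivlMr// mulrC.
suff -> : (1 - t) * \sum_(0 <= i < n) t ^+ i = 1 - t ^+ n.
  by rewrite gerBl exprn_ge0// ltW.
elim: n => [|n IH]; first by rewrite big_nil expr0 mulr0 subrr.
by rewrite big_nat_recr//= mulrDr IH exprS; ring.
Qed.

Lemma sum_arith_geo_le (R : realType) (t : R) n : 0 < t < 1 ->
  \sum_(0 <= i < n) i.+1%:R * t ^+ i <= (1 - t)^-1 ^+ 2.
Proof.
move=> /andP[t0 t1].
have t1' : 0 < 1 - t by rewrite subr_gt0.
rewrite exprVn -[leRHS]mul1r ler_pdivlMr ?exprn_gt0// mulrC.
suff -> : (1 - t) ^+ 2 * \sum_(0 <= i < n) i.+1%:R * t ^+ i =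
    1 - (n%:R * (1 - t) + 1) * t ^+ n.
  by rewrite gerBl mulr_ge0 ?exprn_ge0 ?addr_ge0 ?mulr_ge0// ltW.
elim: n => [|n IH]; first by rewrite big_nil expr0; ring.
by rewrite big_nat_recr//= mulrDr IH [t ^+ n.+1]exprS -!natr1; ring.
Qed.

Lemma sum_shift_geo_le (R : realType) (t : R) k m n : 0 < t < 1 -> (k <= m)%N ->
  \sum_(m <= i < n) t ^+ (i - k) <= t ^+ (m - k) * (1 - t)^-1.
Proof.
move=> t01 km; have /andP[t0 t1] := t01.
rewrite -[X in \sum_(X <= _ < _) _]add0n big_addn.
under eq_bigr => i _ do rewrite -addnBA// exprD mulrC.
by rewrite -mulr_sumr ler_wpM2l ?exprn_ge0 ?sum_geo_le// ltW.
Qed.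

Lemma sum_shift_arith_geo_le (R : realType) (t : R) k n : 0 < t < 1 ->
  \sum_(k <= i < n) (i - k).+1%:R * t ^+ (i - k) <= (1 - t)^-1 ^+ 2.
Proof.
move=> t01.
rewrite -[X in \sum_(X <= _ < _) _]add0n big_addn.
under eq_bigr => i _ do rewrite addnK.
exact: sum_arith_geo_le.
Qed.

Section Mixing.
Context d (Om : measurableType d) (R : realType) (mu : {measure set Om -> \bar R}).
Context (D : set Om).

Local Notation "'EE' f" := (\int[mu]_(x in D) f x) (at level 10, f at level 8).

(* [Fut i] is the class of bounded observables of the process from time [i] on. *)
Record mixing_seq (X : nat -> Om -> R) (Fut : nat -> (Om -> R) -> Prop)
    (B K theta : R) : Prop := MixingSeq {
  mix_theta : 0 < theta < 1 ;
  mix_B : 0 <= B ;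
  mix_K : 0 <= K ;
  fut_bmf : forall i W, Fut i W -> bmf D W ;
  fut_cst : forall i r, Fut i (fun=> r) ;
  futD : forall i f g, Fut i f -> Fut i g -> Fut i (fun x => f x + g x) ;
  futM : forall i f g, Fut i f -> Fut i g -> Fut i (fun x => f x * g x) ;
  fut_cos : forall i f, Fut i f -> Fut i (fun x => cos (f x)) ;
  futS : forall i f, Fut i.+1 f -> Fut i f ;
  fut_X : forall i, Fut i (X i) ;
  mix_bound : forall i x, D x -> `|X i x| <= B ;
  mix_mean : forall i, EE (X i) = 0 ;
  mix_cov2 : forall k i W w, (k <= i)%N -> Fut i W -> (forall x, D x -> `|W x| <= w) ->
    `|EE (fun x => X k x * W x)| <= K * theta ^+ (i - k) * w ;
  mix_cov3 : forall k j i W w, (k <= j <= i)%N -> Fut i W -> (forall x, D x -> `|W x| <= w) ->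
    `|EE (fun x => X k x * X j x * W x) - EE (fun x => X k x * X j x) * EE W|
      <= K * theta ^+ (i - k) * w }.

End Mixing.

(** * Second-order expansion of E cos for weighted sums *)

Section CosineEstimate.
Context d (Om : measurableType d) (R : realType) (mu : {measure set Om -> \bar R}).
Context (D : set Om) (mD : measurable D) (muD : mu D = 1%E).
Context (X : nat -> Om -> R) (Fut : nat -> (Om -> R) -> Prop) (B K theta : R).
Context (mix : mixing_seq mu D X Fut B K theta).

Local Notation "'EE' f" := (\int[mu]_(x in D) f x) (at level 10, f at level 8).
Local Notation G := ((1 - theta)^-1).

Let th0 : 0 < theta. Proof. by have /andP[] := mix_theta mix. Qed.
Let th1 : theta < 1. Proof. by have /andP[] := mix_theta mix. Qed.
Let B0 : 0 <= B. Proof. exact: mix_B mix. Qed.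
Let K0 : 0 <= K. Proof. exact: mix_K mix. Qed.
Let G0 : 0 <= G. Proof. by rewrite invr_ge0 subr_ge0 ltW. Qed.

Lemma fut_le i j W : (i <= j)%N -> Fut j W -> Fut i W.
Proof.
move=> /subnKC <-; elim: (j - i)%N => [|m IH]; first by rewrite addn0.
by rewrite addnS => /(futS mix)/IH.
Qed.

Lemma futN i f : Fut i f -> Fut i (fun x => - f x).
Proof.
move=> Ff; have := futM mix (fut_cst mix i (-1)) Ff.
by congr (Fut i _); apply/funext => x; rewrite mulN1r.
Qed.

Lemma futB i f g : Fut i f -> Fut i g -> Fut i (fun x => f x - g x).
Proof. by move=> Ff Fg; apply: (futD mix) => //; exact: futN. Qed.

Lemma fut_sum i (I : Type) (r : seq I) (P : pred I) (F : I -> Om -> R) :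
  (forall j, P j -> Fut i (F j)) -> Fut i (fun x => \sum_(j <- r | P j) F j x).
Proof.
move=> FF; elim: r => [|j r IH].
  by under eq_fun do rewrite big_nil; exact: (fut_cst mix).
under eq_fun do rewrite big_cons.
case Pj : (P j); last exact: IH.
by apply: (futD mix) => //; exact: FF.
Qed.

Lemma bmf_X i : bmf D (X i).
Proof. exact: (fut_bmf mix (fut_X mix i)). Qed.

Variables (a : R) (n : nat) (c dd : nat -> R).
Hypothesis cdd : forall j, `|c j| <= dd j.
Hypothesis ddn : forall i j, (i <= j)%N -> dd j <= dd i.

(** A tail rather than a partial sum, so that it is an observable of the future of time [k]. *)
Let Rt k x := \sum_(k <= j < n) c j * X j x.
Let ph k x := cos (Rt k x + a).
(** This is minus the sine of [Rt k x + a], written as a cosine because [Fut] is assumed stable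
    under [cos]. *)
Let ps k x := cos (Rt k x + a + pi / 2).

Let dd0 j : 0 <= dd j.
Proof. by apply: le_trans (cdd j). Qed.

Lemma fut_Rt k : Fut k (Rt k).
Proof.
rewrite /Rt; under eq_fun do rewrite big_nat.
apply: fut_sum => j /andP[kj _]; apply: (futM mix); first exact: (fut_cst mix).
exact: fut_le kj (fut_X mix j).
Qed.

Lemma fut_ph k : Fut k (ph k).
Proof. by apply: (fut_cos mix); apply: (futD mix); [exact: fut_Rt|exact: (fut_cst mix)]. Qed.

Lemma fut_ps k : Fut k (ps k).
Proof.
apply: (fut_cos mix); apply: (futD mix); last exact: (fut_cst mix).
by apply: (futD mix); [exact: fut_Rt|exact: (fut_cst mix)].
Qed.

Let bRt k : bmf D (Rt k). Proof. exact: (fut_bmf mix (fut_Rt k)). Qed.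
Let bph k : bmf D (ph k). Proof. exact: (fut_bmf mix (fut_ph k)). Qed.
Let bps k : bmf D (ps k). Proof. exact: (fut_bmf mix (fut_ps k)). Qed.

Let psE k x : ps k x = - sin (Rt k x + a).
Proof. by rewrite /ps cosDpihalf. Qed.

Let RtS k x : (k < n)%N -> Rt k x = c k * X k x + Rt k.+1 x.
Proof. by move=> kn; rewrite /Rt big_ltn. Qed.

Let cX_le k j x : (k <= j)%N -> D x -> `|c j * X j x| <= dd k * B.
Proof.
move=> kj Dx; rewrite normrM ler_pM// ?(mix_bound mix)//.
by apply: le_trans (cdd j) (ddn kj).
Qed.

Lemma EE_XX_le k j : (k <= j)%N -> `|EE (fun x => X k x * X j x)| <= K * B * theta ^+ (j - k).
Proof.
move=> kj; rewrite mulrAC.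
by apply: (mix_cov2 mix kj (fut_X mix j)) => x; exact: (mix_bound mix).
Qed.

Lemma EE_ph_step k : (k < n)%N ->
  `|EE (ph k) - EE (ph k.+1) - c k * EE (fun x => X k x * ps k.+1 x)
    + c k ^+ 2 / 2 * EE (fun x => X k x * X k x * ph k.+1 x)| <= 2 * (dd k * B) ^+ 3.
Proof.
move=> kn; have bX := bmf_X.
rewrite -!EEZ//; [|by do ?apply: bmfM..].
rewrite -!EEB//; [|by do ?[apply: bmfB|apply: bmfM]; do ?exact: bmf_cst..].
rewrite -EED//; [|by do ?[apply: bmfB|apply: bmfM]; do ?exact: bmf_cst..].
apply: EE_norm => //.
  by bmf_auto.
move=> x Dx; have := cos_taylor3 (Rt k.+1 x + a) (c k * X k x).
have -> : Rt k.+1 x + a + c k * X k x = Rt k x + a by rewrite (RtS _ kn); ring.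
rewrite psE -/(ph k x) -/(ph k.+1 x) => h.
apply: le_trans (le_trans h _); last first.
  by rewrite ler_pM2l// lerXn2r// ?nnegrE ?mulr_ge0// cX_le.
by rewrite le_eqVlt; apply/orP; left; apply/eqP; congr `|_|; ring.
Qed.

Lemma ph_diff_le k i x : (k <= i < n)%N -> D x -> `|ph i x - ph i.+1 x| <= 2 * (dd k * B).
Proof.
move=> /andP[ki iN] Dx; apply: le_trans (cos_lip _ _) _.
rewrite ler_pM2l// RtS// (_ : _ - _ = c i * X i x); last by ring.
exact: cX_le.
Qed.

(** Applying [mix_cov3] to [ph j.+1] itself would lose the factor [dd k]. Instead [ph j.+1] is
    telescoped to the constant [ph n], which decouples exactly; each increment [ph i - ph i.+1]
    belongs to the future of time i and has size O([dd k]). *)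
Lemma EE_XXph_decouple k j : (k <= j < n)%N ->
  `|EE (fun x => X k x * X j x * ph j.+1 x) - EE (fun x => X k x * X j x) * EE (ph j.+1)|
    <= 2 * K * B * G * dd k * theta ^+ (j - k).
Proof.
move=> /andP[kj jn]; have bX := bmf_X.
have bXX : bmf D (fun x => X k x * X j x) by apply: bmfM.
pose W i x := ph i x - ph i.+1 x.
have bW i : bmf D (W i) by apply: bmfB.
have phE x : ph j.+1 x = ph n x + \sum_(j.+1 <= i < n) W i x.
  have -> : \sum_(j.+1 <= i < n) W i x = - \sum_(j.+1 <= i < n) (ph i.+1 x - ph i x).
    by rewrite -sumrN; apply: eq_bigr => i _; rewrite opprB.
  by rewrite (telescope_sumr (fun i => ph i x))// opprB addrC subrK.
have phn x : ph n x = cos a by rewrite /ph /Rt big_geq// add0r.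
have -> : EE (fun x => X k x * X j x * ph j.+1 x) =
    cos a * EE (fun x => X k x * X j x)
    + \sum_(j.+1 <= i < n) EE (fun x => X k x * X j x * W i x).
  rewrite -EE_sum//; last by move=> i; apply: bmfM.
  rewrite -EEZ// -EED//; [|by apply: bmfM => //; exact: bmf_cst|
    by apply: bmf_sum => i; apply: bmfM].
  by apply: EE_ext => x _; rewrite phE phn mulrDr mulr_sumr [cos a * _]mulrC.
have -> : EE (ph j.+1) = cos a + \sum_(j.+1 <= i < n) EE (W i).
  rewrite -EE_sum// -[X in X + _](EE_cst mD muD) -EED//; [|exact: bmf_cst|exact: bmf_sum].
  by apply: EE_ext => x _; rewrite phE phn.
rewrite mulrDr [_ * cos a]mulrC opprD addrACA subrr add0r mulr_sumr -sumrB.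
apply: le_trans (ler_norm_sum _ _ _) _.
apply: (@le_trans _ _ (\sum_(j.+1 <= i < n) 2 * K * B * dd k * theta ^+ (i - k))).
  rewrite big_nat [leRHS]big_nat; apply: ler_sum => i /andP[ji iN].
  have -> : 2 * K * B * dd k * theta ^+ (i - k) = K * theta ^+ (i - k) * (2 * (dd k * B)) by ring.
  apply: (mix_cov3 mix).
  - by rewrite kj ltnW.
  - by apply: futB; [exact: fut_ph|apply: (futS mix); exact: fut_ph].
  - by move=> x Dx; apply: ph_diff_le => //; rewrite iN (leq_trans kj)// ltnW.
rewrite -mulr_sumr.
apply: (@le_trans _ _ (2 * K * B * dd k * (theta ^+ (j - k) * G))); last first.
  by rewrite le_eqVlt; apply/orP; left; apply/eqP; ring.
apply: ler_wpM2l; first by rewrite !mulr_ge0.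
apply: le_trans (sum_shift_geo_le _ (mix_theta mix) _) _; first by rewrite (leq_trans kj).
rewrite ler_wpM2r// ler_wiXn2l ?ltW//.
by rewrite leq_sub2r.
Qed.

Lemma EE_ph_close k j : (k <= j < n)%N ->
  `|EE (ph j.+1) - EE (ph k.+1)| <= 2 * B * dd k * (j - k)%:R.
Proof.
move=> /andP[kj jn]; rewrite -EEB//; apply: EE_norm => //; first exact: bmfB.
move=> x Dx; rewrite distrC; apply: le_trans (cos_lip _ _) _.
rewrite -!mulrA ler_pM2l//.
have -> : Rt k.+1 x + a - (Rt j.+1 x + a) = \sum_(k.+1 <= i < j.+1) c i * X i x.
  by rewrite /Rt (@big_cat_nat _ _ _ j.+1)//=; ring.
apply: le_trans (ler_norm_sum _ _ _) _.
apply: (@le_trans _ _ (\sum_(k.+1 <= i < j.+1) dd k * B)).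
  rewrite big_nat [leRHS]big_nat; apply: ler_sum => i /andP[ki _].
  by apply: cX_le => //; exact: ltnW.
by rewrite sumr_const_nat subSS -mulr_natr; lra.
Qed.

Let C1 := 2 * K * B * G + 2 * K * B ^+ 2.

Let C10 : 0 <= C1.
Proof. by rewrite /C1 addr_ge0// !mulr_ge0// exprn_ge0. Qed.

(** The recursion must close on [ph k.+1] alone. Replacing [ph j.+1] by it costs [dd k] for each of
    the j - k removed terms; the covariance of [X k] and [X j] compensates, and the weights (j - k +
    1) theta^(j - k) remain summable. *)
Lemma EE_XXph_decouple_tail k j : (k <= j < n)%N ->
  `|EE (fun x => X k x * X j x * ph j.+1 x) - EE (fun x => X k x * X j x) * EE (ph k.+1)|
    <= C1 * dd k * ((j - k).+1%:R * theta ^+ (j - k)).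
Proof.
move=> kjn; have /andP[kj jn] := kjn.
have h1 := EE_XXph_decouple kjn; have h2 := EE_ph_close kjn; have h3 := EE_XX_le kj.
set u := EE (fun x => _ * _ * _) in h1 *; set v := EE (fun x => X k x * X j x) in h1 h3 *.
set p := EE (ph k.+1) in h2 *; set q := EE (ph j.+1) in h1 h2 *.
have -> : u - v * p = (u - v * q) + v * (q - p) by ring.
apply: le_trans (ler_normD _ _) _; rewrite normrM.
have h4 : `|v| * `|q - p| <= (K * B * theta ^+ (j - k)) * (2 * B * dd k * (j - k)%:R).
  exact: ler_pM.
apply: le_trans (lerD h1 h4) _.
have := dd0 k; have : 0 <= theta ^+ (j - k) by rewrite exprn_ge0// ltW.
set T := theta ^+ _; set m := (j - k)%N => T0 d0.
have m0 : (0 : R) <= m%:R by [].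
rewrite /C1 -natr1.
have : 0 <= 2 * K * B * G * dd k * T * m%:R by rewrite !mulr_ge0.
have : 0 <= 2 * K * B ^+ 2 * dd k * T by rewrite !mulr_ge0// exprn_ge0.
lra.
Qed.

(** Telescoping [ps k.+1] down to the constant [ps n], which [X k] annihilates by its zero mean,
    leaves the increments [ps j - ps j.+1]. Each equals [- c j * X j * ph j.+1] up to an error of
    second order, and [mix_cov2] makes these errors summable in j. *)
Lemma EE_Xps_expand k : (k < n)%N ->
  `|EE (fun x => X k x * ps k.+1 x)
    + \sum_(k.+1 <= j < n) c j * EE (fun x => X k x * X j x * ph j.+1 x)|
    <= 2 * K * B ^+ 2 * G * dd k ^+ 2.
Proof.
move=> kn; have bX := bmf_X.
(* The second-order Taylor remainder of the increment, an observable of the future of time j. *)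
pose e j x := ps j x - ps j.+1 x + c j * X j x * ph j.+1 x.
have be j : bmf D (e j).
  by bmf_auto.
have psn x : ps n x = cos (a + pi / 2) by rewrite /ps /Rt big_geq// add0r.
have psk x : ps k.+1 x = ps n x + \sum_(k.+1 <= j < n) (ps j x - ps j.+1 x).
  have -> : \sum_(k.+1 <= i < n) (ps i x - ps i.+1 x) = - \sum_(k.+1 <= i < n) (ps i.+1 x - ps i x).
    by rewrite -sumrN; apply: eq_bigr => i _; rewrite opprB.
  by rewrite (telescope_sumr (fun i => ps i x))// opprB addrC subrK.
have -> : EE (fun x => X k x * ps k.+1 x)
    + \sum_(k.+1 <= j < n) c j * EE (fun x => X k x * X j x * ph j.+1 x) =
    \sum_(k.+1 <= j < n) EE (fun x => X k x * e j x).
  have -> : \sum_(k.+1 <= j < n) c j * EE (fun x => X k x * X j x * ph j.+1 x) =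
      \sum_(k.+1 <= j < n) EE (fun x => c j * (X k x * X j x * ph j.+1 x)).
    by apply: eq_bigr => j _; rewrite EEZ//; do ?apply: bmfM.
  rewrite -!EE_sum//; [|by move=> j; do ?apply: bmfM; do ?exact: bmf_cst..].
  have Z : EE (fun x => cos (a + pi / 2) * X k x) = 0 by rewrite EEZ// (mix_mean mix) mulr0.
  rewrite -[LHS]subr0 -[X in _ - X = _]Z.
  rewrite -EED//; [|by apply: bmfM|by apply: bmf_sum => j; do ?apply: bmfM; do ?exact: bmf_cst].
  rewrite -EEB//; [|apply: bmfD; [by apply: bmfM|]|by apply: bmfM => //; exact: bmf_cst]; last first.
    by apply: bmf_sum => j; do ?apply: bmfM; do ?exact: bmf_cst.
  apply: EE_ext => x _; rewrite psk psn.
  have -> : \sum_(k.+1 <= j < n) X k x * e j x =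
      X k x * \sum_(k.+1 <= j < n) (ps j x - ps j.+1 x)
      + \sum_(k.+1 <= j < n) c j * (X k x * X j x * ph j.+1 x).
    by rewrite mulr_sumr -big_split/=; apply: eq_bigr => j _; rewrite /e; ring.
  by ring.
apply: le_trans (ler_norm_sum _ _ _) _.
apply: (@le_trans _ _ (\sum_(k.+1 <= j < n) 2 * K * B ^+ 2 * dd k ^+ 2 * theta ^+ (j - k))).
  rewrite big_nat [leRHS]big_nat; apply: ler_sum => j /andP[kj jn].
  have -> : 2 * K * B ^+ 2 * dd k ^+ 2 * theta ^+ (j - k) = K * theta ^+ (j - k) * (2 * (dd k * B) ^+ 2) by ring.
  apply: (mix_cov2 mix).
  - exact: ltnW.
  - rewrite /e; apply: (futD mix).
      by apply: futB; [exact: fut_ps|apply: (futS mix); exact: fut_ps].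
    apply: (futM mix); last by apply: (futS mix); exact: fut_ph.
    by apply: (futM mix); [exact: (fut_cst mix)|exact: (fut_X mix)].
  - move=> x Dx; rewrite /e !psE.
    have := sin_taylor2 (Rt j.+1 x + a) (c j * X j x).
    have -> : Rt j.+1 x + a + c j * X j x = Rt j x + a by rewrite (RtS _ jn); ring.
    rewrite -/(ph j.+1 x) => h.
    rewrite -normrN; apply: le_trans (le_trans h _).
      by rewrite le_eqVlt; apply/orP; left; apply/eqP; congr `|_|; ring.
    by rewrite ler_pM2l// lerXn2r// ?nnegrE ?mulr_ge0// cX_le// ltnW.
rewrite -mulr_sumr.
apply: (@le_trans _ _ (2 * K * B ^+ 2 * dd k ^+ 2 * G)); last first.
  by rewrite le_eqVlt; apply/orP; left; apply/eqP; ring.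
apply: ler_wpM2l; first by rewrite !mulr_ge0// exprn_ge0.
apply: le_trans (sum_shift_geo_le _ (mix_theta mix) (leqnSn k)) _.
by rewrite -[leRHS]mul1r ler_wpM2r// exprn_ile1// ltW.
Qed.

Let V k := EE (fun x => Rt k x ^+ 2).

Lemma V_diff k : (k < n)%N -> V k - V k.+1 = c k ^+ 2 * EE (fun x => X k x * X k x)
  + 2 * (c k * \sum_(k.+1 <= j < n) c j * EE (fun x => X k x * X j x)).
Proof.
move=> kn; have bX := bmf_X.
have -> : \sum_(k.+1 <= j < n) c j * EE (fun x => X k x * X j x) = EE (fun x => X k x * Rt k.+1 x).
  transitivity (\sum_(k.+1 <= j < n) EE (fun x => c j * (X k x * X j x))).
    by apply: eq_bigr => j _; rewrite EEZ//; apply: bmfM.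
  rewrite -EE_sum//; last by move=> j; do ?apply: bmfM; do ?exact: bmf_cst.
  apply: EE_ext => x _; rewrite /Rt mulr_sumr; apply: eq_bigr => j _; ring.
rewrite /V -EEB//; [|by under eq_fun do rewrite expr2; apply: bmfM..].
rewrite mulrA -!EEZ//; [|by apply: bmfM..].
rewrite -EED//; [|by do ?apply: bmfM => //; exact: bmf_cst..].
by apply: EE_ext => x _; rewrite (RtS _ kn); ring.
Qed.

Let C2 := K * B * (1 + 2 * G).

Let C20 : 0 <= C2. Proof. by rewrite /C2 !mulr_ge0// addr_ge0// mulr_ge0. Qed.

Lemma V_diff_le k : (k < n)%N -> `|V k - V k.+1| <= C2 * dd k ^+ 2.
Proof.
move=> kn; rewrite V_diff//.
have h1 := EE_XX_le (leqnn k); rewrite subnn expr0 mulr1 in h1.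
have h2 : `|\sum_(k.+1 <= j < n) c j * EE (fun x => X k x * X j x)| <= dd k * (K * B * G).
  apply: le_trans (ler_norm_sum _ _ _) _.
  apply: (@le_trans _ _ (\sum_(k.+1 <= j < n) dd k * (K * B) * theta ^+ (j - k))).
    rewrite big_nat [leRHS]big_nat; apply: ler_sum => j /andP[kj jn].
    rewrite normrM -mulrA ler_pM// ?EE_XX_le// ?(ltnW kj)//.
    by apply: le_trans (cdd j) (ddn (ltnW kj)).
  rewrite -mulr_sumr -!mulrA ler_wpM2l// !ler_wpM2l//.
  apply: le_trans (sum_shift_geo_le _ (mix_theta mix) (leqnSn k)) _.
  by rewrite -[leRHS]mul1r ler_wpM2r// exprn_ile1// ltW.
apply: le_trans (ler_normD _ _) _; rewrite !normrM.
have hc := cdd k.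
have h3 : `|c k| * `|c k| * `|EE (fun x => X k x * X k x)| <= dd k * dd k * (K * B).
  by rewrite !ler_pM// mulr_ge0.
have h4 : `|c k| * `|\sum_(k.+1 <= j < n) c j * EE (fun x => X k x * X j x)| <= dd k * (dd k * (K * B * G)).
  exact: ler_pM.
rewrite (ger0_norm (_ : 0 <= 2))//.
by apply: le_trans (lerD h3 (ler_wpM2l _ h4)) _ => //; rewrite /C2; lra.
Qed.

Let C3 := 2 * B ^+ 3 + 2 * K * B ^+ 2 * G + C1 * G ^+ 2 + C1.

(* Second-order expansion of [cos (Rt k + a)]: by decorrelation the quadratic
   terms only involve half the increment of the variance [V]. *)
Lemma EE_ph_recursion k : (k < n)%N ->
  `|EE (ph k) - EE (ph k.+1) * (1 - (V k - V k.+1) / 2)| <= C3 * dd k ^+ 3.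
Proof.
move=> kn.
have h1 := EE_ph_step kn; have h2 := EE_Xps_expand kn.
set A := EE (ph k) in h1 *; set p := EE (ph k.+1) in h1 *.
set U := EE (fun x => X k x * ps k.+1 x) in h1 h2.
set Z := EE (fun x => X k x * X k x * ph k.+1 x) in h1.
set S := \sum_(_ <= _ < _) _ in h2.
have h3 : `|Z - EE (fun x => X k x * X k x) * p| <= C1 * dd k.
  have := @EE_XXph_decouple_tail k k; rewrite leqnn kn => /(_ isT).
  by rewrite subnn expr0 !mulr1.
set Q := EE (fun x => X k x * X k x) in h3.
pose S' := \sum_(k.+1 <= j < n) c j * EE (fun x => X k x * X j x).
have h4 : `|S - S' * p| <= C1 * G ^+ 2 * dd k ^+ 2.
  rewrite /S /S' mulr_suml -sumrB; apply: le_trans (ler_norm_sum _ _ _) _.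
  apply: (@le_trans _ _ (\sum_(k.+1 <= j < n) C1 * dd k ^+ 2 * ((j - k).+1%:R * theta ^+ (j - k)))).
    rewrite big_nat [leRHS]big_nat; apply: ler_sum => j /andP[kj jn].
    rewrite -mulrA -mulrBr normrM.
    have -> : C1 * dd k ^+ 2 * ((j - k).+1%:R * theta ^+ (j - k)) =
      dd k * (C1 * dd k * ((j - k).+1%:R * theta ^+ (j - k))) by ring.
    rewrite ler_pM//; first by apply: le_trans (cdd j) (ddn (ltnW kj)).
    by apply: EE_XXph_decouple_tail; rewrite ltnW.
  rewrite -mulr_sumr [leRHS]mulrAC ler_wpM2l// ?mulr_ge0 ?exprn_ge0//.
  apply: le_trans (sum_shift_arith_geo_le k n (mix_theta mix)).
  rewrite [leRHS]big_ltn// lerDr mulr_ge0// exprn_ge0//; exact: ltW.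
rewrite (V_diff kn) -/Q -/S'.
have -> : A - p * (1 - (c k ^+ 2 * Q + 2 * (c k * S')) / 2) =
  (A - p - c k * U + c k ^+ 2 / 2 * Z) + (c k * (U + S) +
  (- (c k * (S - S' * p)) - c k ^+ 2 / 2 * (Z - Q * p))) by field.
have hc := cdd k.
have h5 : `|c k * (U + S)| <= dd k * (2 * K * B ^+ 2 * G * dd k ^+ 2) by rewrite normrM ler_pM.
have h6 : `|c k * (S - S' * p)| <= dd k * (C1 * G ^+ 2 * dd k ^+ 2) by rewrite normrM ler_pM.
have h7 : `|c k ^+ 2 / 2 * (Z - Q * p)| <= dd k ^+ 2 * (C1 * dd k).
  rewrite normrM ler_pM// normrM normrX [`|2^-1|]ger0_norm//.
  have : `|c k| ^+ 2 <= dd k ^+ 2 by rewrite lerXn2r// nnegrE.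
  have : 0 <= `|c k| ^+ 2 by rewrite exprn_ge0.
  lra.
apply: le_trans (ler_normD _ _) _; apply: le_trans (lerD h1 (ler_normD _ _)) _.
apply: le_trans (lerD (lexx _) (lerD h5 (ler_normB _ _))) _; rewrite normrN.
by apply: le_trans (lerD (lexx _) (lerD (lexx _) (lerD h6 h7))) _; rewrite /C3; lra.
Qed.

Variables (dm Q : R).
Hypothesis ddm : forall j, dd j <= dm.
Hypothesis ddQ : \sum_(0 <= j < n) dd j ^+ 2 <= Q.

(** [V n] vanishes and each increment is O([dd j ^+ 2]). With all weights equal to 1 this also gives
    the linear upper bound on the variance of a Birkhoff sum. *)
Lemma V_le k : (k <= n)%N -> V k <= C2 * Q.
Proof.
move=> kn.
have Vn : V n = 0.
  by rewrite /V -[RHS](EE_cst mD muD); apply: EE_ext => x _; rewrite /Rt big_geq// expr0n.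
have -> : V k = \sum_(k <= j < n) (V j - V j.+1).
  have -> : \sum_(k <= j < n) (V j - V j.+1) = - \sum_(k <= j < n) (V j.+1 - V j).
    by rewrite -sumrN; apply: eq_bigr => j _; rewrite opprB.
  by rewrite telescope_sumr// Vn opprB subr0.
apply: (@le_trans _ _ (\sum_(k <= j < n) C2 * dd j ^+ 2)).
  rewrite big_nat [leRHS]big_nat; apply: ler_sum => j /andP[_ jn].
  by apply: le_trans (ler_norm _) (V_diff_le jn).
rewrite -mulr_sumr ler_wpM2l// (le_trans _ ddQ)//.
rewrite [leRHS](@big_cat_nat _ _ _ k)//= lerDr sumr_ge0// => j _; exact: exprn_ge0.
Qed.

(** The exponential bounds [expR (V k / 2)]. [C3] is the error of the recursion; the last term is
    the cost of replacing 1 - s by [expR (- s)], where [|s| <= C2 * dd k ^+ 2], one power of [dd k]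
    in s^2 being bounded by [dm]. *)
Definition cos_const : R := expR (C2 * Q / 2) *
  (C3 + (4 * (expR (C2 * dm ^+ 2) + 1 + C2 * dm ^+ 2) + 2) * (C2 ^+ 2 * dm)).

(* By the recursion, [expR (V k / 2) * EE (ph k)] is almost constant in [k]. *)
Lemma EE_cos_weighted :
  `|EE (fun x => cos (\sum_(0 <= j < n) c j * X j x + a))
     - cos a * expR (- (EE (fun x => (\sum_(0 <= j < n) c j * X j x) ^+ 2) / 2))|
  <= cos_const * \sum_(0 <= j < n) dd j ^+ 3.
Proof.
have dm0 : 0 <= dm by apply: le_trans (dd0 0) (ddm 0).
pose b k := EE (ph k) * expR (V k / 2).
have bn : b n = cos a.
  rewrite /b /V.
  have -> : EE (fun x => Rt n x ^+ 2) = 0.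
    by rewrite -[RHS](EE_cst mD muD); apply: EE_ext => x _; rewrite /Rt big_geq// expr0n.
  have -> : EE (ph n) = cos a.
    by rewrite -[RHS](EE_cst mD muD); apply: EE_ext => x _; rewrite /ph /Rt big_geq// add0r.
  by rewrite mul0r expR0 mulr1.
have step k : (k < n)%N -> `|b k - b k.+1| <= cos_const * dd k ^+ 3.
  move=> kn; pose s := (V k - V k.+1) / 2.
  have dk : 0 <= dd k by [].
  have hs : `|s| <= C2 * dd k ^+ 2.
    rewrite /s normrM [`|2^-1|]ger0_norm//; have := V_diff_le kn.
    by have : 0 <= `|V k - V k.+1| by []; lra.
  have hs' : `|s| <= C2 * dm ^+ 2.
    by apply: le_trans hs _; rewrite ler_wpM2l// lerXn2r// nnegrE.
  have -> : b k - b k.+1 = expR (V k / 2) * (EE (ph k) - EE (ph k.+1) * expR (- s)).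
    rewrite /b mulrBr [expR _ * EE (ph k)]mulrC; congr (_ - _).
    by rewrite mulrCA -expRD; congr (_ * expR _); rewrite /s; field.
  rewrite normrM /cos_const -mulrA ger0_norm ?expR_ge0// ler_pM ?expR_ge0//.
    by rewrite ler_expR ler_pM2r// V_le// ltnW.
  have -> : EE (ph k) - EE (ph k.+1) * expR (- s) = (EE (ph k) - EE (ph k.+1) * (1 - s))
      - EE (ph k.+1) * (expR (- s) - 1 + s) by ring.
  apply: le_trans (ler_normB _ _) _; rewrite mulrDl lerD//.
    by apply: le_trans (EE_ph_recursion kn); rewrite /s.
  rewrite normrM -[leRHS]mul1r ler_pM//.
    by apply: EE_norm => // x _; exact: cos_max.
  apply: le_trans (expRN_taylor2 hs') _; rewrite -mulrA ler_wpM2l//.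
    by rewrite addr_ge0// mulr_ge0// !addr_ge0 ?expR_ge0// mulr_ge0 ?exprn_ge0.
  rewrite -(real_normK (num_real s)).
  apply: (@le_trans _ _ ((C2 * dd k ^+ 2) ^+ 2)).
    by rewrite lerXn2r// nnegrE mulr_ge0// exprn_ge0.
  have -> : (C2 * dd k ^+ 2) ^+ 2 = C2 ^+ 2 * dd k * dd k ^+ 3 by ring.
  by rewrite ler_wpM2r ?exprn_ge0// ler_wpM2l ?exprn_ge0.
have V0 : 0 <= V 0 by apply: Rintegral_ge0 => x _; exact: sqr_ge0.
have tel : b 0%N - b n = \sum_(0 <= k < n) (b k - b k.+1).
  have -> : \sum_(0 <= j < n) (b j - b j.+1) = - \sum_(0 <= j < n) (b j.+1 - b j).
    by rewrite -sumrN; apply: eq_bigr => j _; rewrite opprB.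
  by rewrite telescope_sumr// opprB.
have main : `|b 0%N - cos a| <= cos_const * \sum_(0 <= j < n) dd j ^+ 3.
  rewrite -bn tel mulr_sumr; apply: le_trans (ler_norm_sum _ _ _) _.
  by rewrite big_nat [leRHS]big_nat; apply: ler_sum => j /andP[_ jn]; exact: step.
apply: le_trans main.
(* Undoing the weight multiplies the error by [expR (- (V 0 / 2))], which is at most 1. *)
have -> : EE (ph 0) - cos a * expR (- (V 0 / 2)) = (b 0%N - cos a) * expR (- (V 0 / 2)).
  rewrite /b mulrBl -mulrA -expRD subrr expR0 mulr1//.
rewrite normrM -[leRHS]mulr1 ler_pM// ger0_norm ?expR_ge0//.
by rewrite expR_le1 oppr_le0 divr_ge0.
Qed.

End CosineEstimate.

(** * Correlations of normalized sums *)

Lemma expRN_lip (R : realType) (x y : R) : 0 <= x -> 0 <= y ->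
  `|expR (- x) - expR (- y)| <= `|x - y|.
Proof.
wlog xy : x y / x <= y => [H x0 y0|x0 _].
  have [xy|/ltW yx] := leP x y; first exact: H.
  by rewrite distrC [leRHS]distrC; exact: H.
rewrite ger0_norm ?subr_ge0 ?ler_expR ?lerN2// distrC ger0_norm ?subr_ge0//.
have -> : - y = - x + (x - y) by ring.
rewrite expRD -[X in X - _]mulr1 -mulrBr.
have h1 := expR_ge1Dx (x - y).
have h2 : expR (- x) <= 1 by rewrite expR_le1 oppr_le0.
have h3 := expR_ge0 (- x).
apply: (@le_trans _ _ (expR (- x) * (y - x))).
  by rewrite ler_wpM2l//; lra.
by rewrite -[leRHS]mul1r ler_wpM2r// subr_ge0.
Qed.

Section PairEstimate.
Context d (Om : measurableType d) (R : realType) (mu : {measure set Om -> \bar R}).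
Context (D : set Om) (mD : measurable D) (muD : mu D = 1%E).
Context (X : nat -> Om -> R) (Fut : nat -> (Om -> R) -> Prop) (B K theta : R).
Context (mix : mixing_seq mu D X Fut B K theta).
Context (sg : nat -> R) (cs : R) (cs0 : 0 < cs).
Context (sg_ge : forall k, (1 <= k)%N -> cs * Num.sqrt k%:R <= sg k).

Local Notation "'EE' f" := (\int[mu]_(x in D) f x) (at level 10, f at level 8).
Local Notation G := ((1 - theta)^-1).

Let S k x := \sum_(0 <= j < k) X j x.
Definition normalized_sum k x := (\sum_(0 <= j < k) X j x) / sg k.
Local Notation Y := normalized_sum.

Context (sgE : forall k, (1 <= k)%N -> sg k ^+ 2 = EE (fun x => S k x ^+ 2)).

Let bX i : bmf D (X i). Proof. exact: (bmf_X mix). Qed.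
Let B0 : 0 <= B. Proof. exact: mix_B mix. Qed.
Let K0 : 0 <= K. Proof. exact: mix_K mix. Qed.
Let G0 : 0 <= G.
Proof. by have /andP[_ t1] := mix_theta mix; rewrite invr_ge0 subr_ge0 ltW. Qed.

Let sq1 k : (1 <= k)%N -> 1 <= Num.sqrt k%:R :> R.
Proof. by move=> k1; rewrite -[leLHS]sqrtr1 ler_wsqrtr ?ler1n. Qed.

Let sg_gt0 k : (1 <= k)%N -> 0 < sg k.
Proof.
move=> k1; apply: lt_le_trans (sg_ge k1); rewrite mulr_gt0//.
by apply: lt_le_trans (sq1 k1).
Qed.

Lemma bmf_Y k : bmf D (Y k).
Proof. by rewrite /normalized_sum; bmf_auto. Qed.

Lemma EE_Y2 k : (1 <= k)%N -> EE (fun x => Y k x ^+ 2) = 1.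
Proof.
move=> k1; have s0 := sg_gt0 k1.
have -> : EE (fun x => Y k x ^+ 2) = (sg k ^+ 2)^-1 * EE (fun x => S k x ^+ 2).
  rewrite -EEZ//; last by bmf_auto.
  by apply: EE_ext => x _; rewrite /normalized_sum expr_div_n mulrC.
by rewrite -sgE// mulVf// expf_neq0// gt_eqF.
Qed.

(** The first summand bounds the variance of the shorter sum per unit of time, the second its
    covariance with the block that follows. *)
Let Crho := K * B * (1 + 2 * G) + K * B * G.

(** Each [X i] with i < k has summable covariances with the later variables, so the block after k
    contributes O(k) however large l is. After normalization this is the factor (k/l)^(1/2). *)
Lemma EE_SS_le k l : (k <= l)%N -> `|EE (fun x => S k x * S l x)| <= Crho * k%:R.
Proof.
move=> kl.
pose L x := \sum_(k <= j < l) X j x.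
have SlE x : S l x = S k x + L x by rewrite /S /L (@big_cat_nat _ _ _ k).
have bL : bmf D L by rewrite /L; bmf_auto.
have -> : EE (fun x => S k x * S l x) = EE (fun x => S k x ^+ 2) + EE (fun x => S k x * L x).
  rewrite -EED//; [|by bmf_auto..].
  by apply: EE_ext => x _; rewrite SlE; ring.
apply: le_trans (ler_normD _ _) _; rewrite /Crho mulrDl lerD//.
  rewrite ger0_norm; last by apply: Rintegral_ge0 => x _; exact: sqr_ge0.
  have := @V_le _ _ _ _ _ mD muD _ _ _ _ _ mix k (fun=> 1) (fun=> 1) _ _ k%:R _ 0%N (leq0n k).
  rewrite (_ : EE (fun x => S k x ^+ 2) = EE (fun x => (\sum_(0 <= j < k) 1 * X j x) ^+ 2)).
    apply => //; first by move=> _; rewrite normr1.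
    by under eq_bigr do rewrite expr1n; rewrite sumr_const_nat subn0.
  by apply: EE_ext => x _; rewrite /S; under [in RHS]eq_bigr do rewrite mul1r.
have -> : EE (fun x => S k x * L x) = \sum_(0 <= i < k) \sum_(k <= j < l) EE (fun x => X i x * X j x).
  transitivity (\sum_(0 <= i < k) EE (fun x => X i x * L x)).
    rewrite -EE_sum//; last by move=> i; bmf_auto.
    by apply: EE_ext => x _; rewrite /S mulr_suml.
  apply: eq_bigr => i _; rewrite -EE_sum//; last by move=> j; bmf_auto.
  by apply: EE_ext => x _; rewrite /L mulr_sumr.
apply: le_trans (ler_norm_sum _ _ _) _.
apply: (@le_trans _ _ (\sum_(0 <= i < k) K * B * G)); last first.
  by rewrite sumr_const_nat subn0 mulr_natr.
rewrite big_nat [leRHS]big_nat; apply: ler_sum => i /andP[_ ik].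
apply: le_trans (ler_norm_sum _ _ _) _.
apply: (@le_trans _ _ (\sum_(k <= j < l) K * B * theta ^+ (j - i))).
  rewrite big_nat [leRHS]big_nat; apply: ler_sum => j /andP[kj _].
  by apply: (EE_XX_le mix); apply: leq_trans (ltnW ik) kj.
rewrite -mulr_sumr ler_wpM2l// ?mulr_ge0//.
apply: le_trans (sum_shift_geo_le _ (mix_theta mix) (ltnW ik)) _.
have /andP[/ltW t0 /ltW t1] := mix_theta mix.
by rewrite -[leRHS]mul1r ler_wpM2r// exprn_ile1.
Qed.

Lemma EE_YY_le k l : (1 <= k <= l)%N ->
  `|EE (fun x => Y k x * Y l x)| <= Crho / cs ^+ 2 * (Num.sqrt k%:R / Num.sqrt l%:R).
Proof.
move=> /andP[k1 kl]; have l1 := leq_trans k1 kl.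
have Crho0 : 0 <= Crho by rewrite /Crho addr_ge0 ?mulr_ge0 ?addr_ge0 ?mulr_ge0.
have -> : EE (fun x => Y k x * Y l x) = (sg k * sg l)^-1 * EE (fun x => S k x * S l x).
  rewrite -EEZ//; last by bmf_auto.
  by apply: EE_ext => x _; rewrite /normalized_sum /S invfM; ring.
rewrite normrM ger0_norm; last by rewrite invr_ge0 mulr_ge0// ltW// sg_gt0.
apply: (@le_trans _ _ ((cs * Num.sqrt k%:R * (cs * Num.sqrt l%:R))^-1 * (Crho * k%:R))).
  apply: ler_pM => //; last exact: EE_SS_le.
    by rewrite invr_ge0 mulr_ge0// ltW// sg_gt0.
  have p m : (1 <= m)%N -> 0 < cs * Num.sqrt m%:R :> R.
    by move=> m1; rewrite mulr_gt0// (lt_le_trans _ (sq1 m1)).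
  have pk := p _ k1; have pl := p _ l1.
  rewrite lef_pV2 ?posrE; [|by rewrite mulr_gt0 ?sg_gt0|by rewrite mulr_gt0].
  by apply: ler_pM; rewrite ?sg_ge// ltW.
have k0 : Num.sqrt k%:R != 0 :> R by rewrite gt_eqF// (lt_le_trans _ (sq1 k1)).
have l0 : Num.sqrt l%:R != 0 :> R by rewrite gt_eqF// (lt_le_trans _ (sq1 l1)).
have kE : (k%:R : R) = Num.sqrt k%:R * Num.sqrt k%:R by rewrite -expr2 sqr_sqrtr.
rewrite [X in Crho * X]kE.
have c0 : cs != 0 by rewrite gt_eqF.
suff -> : forall r q : R, r != 0 -> q != 0 ->
  (cs * r * (cs * q))^-1 * (Crho * (r * r)) = Crho / cs ^+ 2 * (r / q) by [].
by move=> r q r0 q0; field; rewrite ?c0 ?r0 ?q0.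
Qed.

Variable t0 : R.
Hypothesis t00 : 0 <= t0.

Let dm := 2 * t0 / cs.
Let dm0 : 0 <= dm. Proof. by rewrite /dm divr_ge0 ?mulr_ge0// ltW. Qed.

Definition pair_const : R := cos_const B K theta dm (2 * dm ^+ 2) * (2 * dm ^+ 3).

(** Dominates the coefficients of [s * Y k + t * Y l]. Before time k both sums contribute, each at
    most t0 / (cs k^(1/2)), whence the factor 2 in [dm]. *)
Let dseq k l (j : nat) := if (j < k)%N then dm / Num.sqrt k%:R else dm / Num.sqrt l%:R.

Lemma EE_cos_pair k l s t a : (1 <= k <= l)%N -> `|s| <= t0 -> `|t| <= t0 ->
  `|EE (fun x => cos (s * Y k x + t * Y l x + a))
    - cos a * expR (- ((s ^+ 2 + t ^+ 2 + 2 * s * t * EE (fun x => Y k x * Y l x)) / 2))|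
  <= pair_const / Num.sqrt k%:R.
Proof.
move=> /andP[k1 kl] st tt; have l1 := leq_trans k1 kl.
pose c j := (if (j < k)%N then s / sg k else 0) + t / sg l.
have sk0 : 0 < Num.sqrt k%:R :> R by apply: lt_le_trans (sq1 k1).
have sl0 : 0 < Num.sqrt l%:R :> R by apply: lt_le_trans (sq1 l1).
have skl : Num.sqrt k%:R <= Num.sqrt l%:R :> R by rewrite ler_wsqrtr// ler_nat.
have q m r : (1 <= m)%N -> `|r| <= t0 -> `|r / sg m| <= t0 / cs / Num.sqrt m%:R.
  move=> m1 rt; have sm0 : 0 < Num.sqrt m%:R :> R by apply: lt_le_trans (sq1 m1).
  rewrite normrM normfV (ger0_norm (ltW (sg_gt0 m1))) -mulrA -invfM.
  rewrite ler_pM ?invr_ge0 ?(ltW (sg_gt0 m1))// lef_pV2 ?posrE ?mulr_gt0 ?sg_gt0//.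
  exact: sg_ge.
have tcs0 : 0 <= t0 / cs by rewrite divr_ge0// ltW.
have cE x : \sum_(0 <= j < l) c j * X j x = s * Y k x + t * Y l x.
  rewrite /c; under eq_bigr do rewrite mulrDl.
  rewrite big_split/= -mulr_sumr (@big_cat_nat _ _ _ k)//= [X in _ + X + _]big_nat.
  rewrite [X in _ + X + _]big1 => [|j /andP[kj _]]; last by rewrite ltnNge kj mul0r.
  rewrite addr0 big_nat; under eq_bigr => j /andP[_ jk] do rewrite jk.
  by rewrite -big_nat -mulr_sumr /normalized_sum; ring.
have cdd j : `|c j| <= dseq k l j.
  rewrite /c /dseq; case: ifPn => _.
    apply: le_trans (ler_normD _ _) _; apply: le_trans (lerD (q _ _ k1 st) (q _ _ l1 tt)) _.
    have : t0 / cs / Num.sqrt l%:R <= t0 / cs / Num.sqrt k%:R by rewrite ler_wpM2l// lef_pV2.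
    by rewrite /dm; set A := t0 / cs / Num.sqrt k%:R; rewrite (_ : 2 * t0 / cs / Num.sqrt k%:R = 2 * A);
       [lra|rewrite /A; ring].
  rewrite add0r; apply: le_trans (q _ _ l1 tt) _.
  by rewrite ler_wpM2r ?invr_ge0 ?(ltW sl0)// /dm -mulrA; lra.
have ddn i j : (i <= j)%N -> dseq k l j <= dseq k l i.
  move=> ij; rewrite /dseq; case: ifPn => [jk|_]; first by rewrite (leq_ltn_trans ij jk).
  by case: ifPn => _ //; rewrite ler_wpM2l// lef_pV2.
have ddm j : dseq k l j <= dm.
  rewrite /dseq; case: ifPn => _.
    by rewrite ler_pdivrMr// ler_peMr// sq1.
  by rewrite ler_pdivrMr// ler_peMr// sq1.
(* The k terms before time k give [dm ^+ p.+2] times k^(-p/2), and similarly for the at most l terms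
   after it. The case p = 0 bounds the squares independently of k and l, the case p = 1 yields the
   rate k^(-1/2). *)
have sumd p : \sum_(0 <= j < l) dseq k l j ^+ p.+2 <= dm ^+ p.+2 * (Num.sqrt k%:R ^- p + Num.sqrt l%:R ^- p).
  rewrite (@big_cat_nat _ _ _ k)//= mulrDr lerD//.
    rewrite big_nat; under eq_bigr => j /andP[_ jk] do rewrite /dseq jk.
    rewrite -big_nat sumr_const_nat subn0 expr_div_n -[leLHS]mulr_natr -mulrA.
    rewrite ler_wpM2l ?exprn_ge0// -[X in _ * X]sqr_sqrtr//.
    rewrite -addn2 exprD invfM -mulrA mulVf ?mulr1// expf_neq0// gt_eqF//.
  rewrite big_nat; under eq_bigr => j /andP[kj _] do rewrite /dseq ltnNge kj/=.
  rewrite -big_nat sumr_const_nat expr_div_n -[leLHS]mulr_natr -mulrA.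
  rewrite ler_wpM2l ?exprn_ge0//.
  apply: (@le_trans _ _ (Num.sqrt l%:R ^- p.+2 * l%:R)).
    by rewrite ler_wpM2l ?invr_ge0 ?exprn_ge0// ler_nat leq_subr.
  rewrite -[X in _ * X]sqr_sqrtr//.
  by rewrite -addn2 exprD invfM -mulrA mulVf ?mulr1// expf_neq0// gt_eqF.
have ddQ : \sum_(0 <= j < l) dseq k l j ^+ 2 <= 2 * dm ^+ 2.
  by apply: le_trans (sumd 0%N) _; rewrite !expr0 invr1; lra.
have := EE_cos_weighted mD muD mix a cdd ddn ddm ddQ.
have -> : EE (fun x => cos (\sum_(0 <= j < l) c j * X j x + a)) =
    EE (fun x => cos (s * Y k x + t * Y l x + a)) by apply: EE_ext => x _; rewrite cE.
have -> : EE (fun x => (\sum_(0 <= j < l) c j * X j x) ^+ 2) =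
    s ^+ 2 + t ^+ 2 + 2 * s * t * EE (fun x => Y k x * Y l x).
  have bY := bmf_Y.
  have -> : s ^+ 2 + t ^+ 2 + 2 * s * t * EE (fun x => Y k x * Y l x) =
    s ^+ 2 * EE (fun x => Y k x ^+ 2) + t ^+ 2 * EE (fun x => Y l x ^+ 2)
      + 2 * s * t * EE (fun x => Y k x * Y l x) by rewrite !EE_Y2// !mulr1.
  rewrite -!EEZ//; [|by bmf_auto..].
  rewrite -!EED//; [|by bmf_auto..].
  by apply: EE_ext => x _; rewrite cE; ring.
move=> /le_trans; apply; rewrite /pair_const -mulrA ler_wpM2l//.
  have Cge : 0 <= K * B * (1 + 2 * G) by rewrite !mulr_ge0// addr_ge0// mulr_ge0.
  rewrite /cos_const mulr_ge0 ?expR_ge0// addr_ge0//.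
    by rewrite !addr_ge0// ?mulr_ge0 ?addr_ge0 ?exprn_ge0// !mulr_ge0// exprn_ge0.
  have Cd : 0 <= K * B * (1 + 2 * G) * dm ^+ 2 by rewrite mulr_ge0 ?exprn_ge0.
  apply: mulr_ge0; last by rewrite mulr_ge0 ?exprn_ge0.
  by have := expR_ge0 (K * B * (1 + 2 * G) * dm ^+ 2); lra.
apply: le_trans (sumd 1%N) _; rewrite !expr1.
have h : (Num.sqrt l%:R)^-1 <= (Num.sqrt k%:R)^-1 :> R by rewrite lef_pV2.
have -> : 2 * dm ^+ 3 / Num.sqrt k%:R = dm ^+ 3 * (2 * (Num.sqrt k%:R)^-1) by ring.
by apply: ler_wpM2l; [exact: exprn_ge0|lra].
Qed.

Definition cos_dev t a k x := cos (t * Y k x + a) - cos a * expR (- (t ^+ 2 / 2)).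

Lemma bmf_cos_dev t a k : bmf D (cos_dev t a k).
Proof. by have bY := bmf_Y; rewrite /cos_dev; bmf_auto. Qed.

(** The 3 collects half an error for the sum, half for the difference, and one for each single sum;
    the other term is the effect of the correlation of the two normalized sums. *)
Definition dev_const : R := 3 * pair_const + t0 ^+ 2 * (Crho / cs ^+ 2).

(** The product of two cosines is half the sum of the cosines of the sum (phase 2a) and of the
    difference (phase 0). These have variances 2 t^2 (1 + rho) and 2 t^2 (1 - rho), rho being the
    correlation. At rho = 0 the main terms cancel by cos 2a + 1 = 2 cos^2 a, and the dependence on
    rho is Lipschitz. *)
Lemma EE_cos_dev_le t a k l : (1 <= k <= l)%N -> `|t| <= t0 ->
  `|EE (fun x => cos_dev t a k x * cos_dev t a l x)| <=
    dev_const * (Num.sqrt k%:R / Num.sqrt l%:R + (Num.sqrt k%:R)^-1).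
Proof.
move=> kl tt; have /andP[k1 kl'] := kl; have l1 := leq_trans k1 kl'.
have bY := bmf_Y.
pose m : R := cos a * expR (- (t ^+ 2 / 2)).
pose e := pair_const / Num.sqrt k%:R.
pose rho := EE (fun x => Y k x * Y l x).
have sk0 : 0 < Num.sqrt k%:R :> R by apply: lt_le_trans (sq1 k1).
have sl0 : 0 < Num.sqrt l%:R :> R by apply: lt_le_trans (sq1 l1).
have n0 : `|0 : R| <= t0 by rewrite normr0.
have pc0 : 0 <= pair_const.
  have := EE_cos_pair 0 kl n0 n0; move=> /(le_trans (normr_ge0 _)).
  by rewrite ler_pdivlMr// mul0r.
(* A single sum is the pair (j, j) with second frequency 0. *)
have one j : (1 <= j)%N -> `|EE (fun x => cos (t * Y j x + a)) - m| <= pair_const / Num.sqrt j%:R.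
  move=> j1; have jj : (1 <= j <= j)%N by rewrite j1 leqnn.
  have := EE_cos_pair a jj tt n0; rewrite expr0n/= !mulr0 !mul0r !addr0.
  have -> // : EE (fun x => cos (t * Y j x + 0 * Y j x + a)) = EE (fun x => cos (t * Y j x + a)).
  by apply: EE_ext => x _; rewrite mul0r addr0.
have hk := one _ k1.
have hl : `|EE (fun x => cos (t * Y l x + a)) - m| <= e.
  apply: le_trans (one _ l1) _; rewrite ler_wpM2l// lef_pV2//.
  by rewrite ler_wsqrtr// ler_nat.
have hA := EE_cos_pair (a + a) kl tt tt.
have tN : `|- t| <= t0 by rewrite normrN.
have hB := EE_cos_pair 0 kl tt tN.
set P := EE (fun x => cos (t * Y k x + a)) in hk; set Q := EE (fun x => cos (t * Y l x + a)) in hl.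
set A := EE (fun x => cos (_ + (a + a))) in hA; set B' := EE (fun x => cos (_ + 0)) in hB.
have -> : EE (fun x => cos_dev t a k x * cos_dev t a l x) = 2^-1 * A + 2^-1 * B' - m * P - m * Q + m * m.
  rewrite /A /B' /P /Q -!EEZ//; [|by bmf_auto..].
  rewrite -[X in _ + X](EE_cst mD muD).
  rewrite -EED//; [|by bmf_auto..].
  rewrite -EEB//; [|by bmf_auto..].
  rewrite -EEB//; [|by bmf_auto..].
  rewrite -EED//; [|by bmf_auto..].
  apply: EE_ext => x _; rewrite /cos_dev -/m.
  have -> : t * Y k x + t * Y l x + (a + a) = (t * Y k x + a) + (t * Y l x + a) by ring.
  have -> : t * Y k x + - t * Y l x + 0 = (t * Y k x + a) - (t * Y l x + a) by ring.
  set u := t * Y k x + a; set v := t * Y l x + a.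
  by rewrite (cosD u v) (cosB u v); field.
(* The Lipschitz bound on [expR (- x)] needs nonnegative arguments; that the correlation is at most
   1 in absolute value follows from the second moments of [Y k + Y l] and [Y k - Y l]. *)
have rp (r : R) : (r = 1) \/ (r = -1) -> 0 <= 1 + r * rho.
  move=> hr; have : 0 <= EE (fun x => (Y k x + r * Y l x) ^+ 2).
    by apply: Rintegral_ge0 => x _; exact: sqr_ge0.
  have -> : EE (fun x => (Y k x + r * Y l x) ^+ 2) = EE (fun x => Y k x ^+ 2) + r ^+ 2 * EE (fun x => Y l x ^+ 2) + 2 * r * rho.
    rewrite /rho -!EEZ//; [|by bmf_auto..].
    do ?[rewrite -EED//; [|by bmf_auto..]].
    by apply: EE_ext => x _; ring.
  by rewrite !EE_Y2//; case: hr => ->; lra.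
pose E1 := expR (- (t ^+ 2 * (1 + rho))); pose E2 := expR (- (t ^+ 2 * (1 - rho))).
pose E0 := expR (- t ^+ 2).
have t2 : t ^+ 2 <= t0 ^+ 2 by rewrite -(real_normK (num_real t)) lerXn2r// nnegrE.
have t20 : 0 <= t ^+ 2 := sqr_ge0 t.
have d1 : `|E1 - E0| <= t0 ^+ 2 * `|rho|.
  apply: le_trans (expRN_lip _ _) _ => //.
    by rewrite mulr_ge0//; have := rp 1 (or_introl erefl); rewrite mul1r.
  rewrite (_ : _ - _ = t ^+ 2 * rho); last by ring.
  by rewrite normrM (ger0_norm t20) ler_wpM2r.
have d2 : `|E2 - E0| <= t0 ^+ 2 * `|rho|.
  apply: le_trans (expRN_lip _ _) _ => //.
    by rewrite mulr_ge0//; have := rp (-1) (or_intror erefl); rewrite mulN1r.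
  rewrite (_ : _ - _ = - (t ^+ 2 * rho)); last by ring.
  by rewrite normrN normrM (ger0_norm t20) ler_wpM2r.
have mE : m * m = cos a ^+ 2 * E0.
  rewrite /m /E0 (_ : - t ^+ 2 = - (t ^+ 2 / 2) + - (t ^+ 2 / 2)); last by field.
  by rewrite expRD; ring.
have hA' : `|A - cos (a + a) * E1| <= e.
  by apply: le_trans hA; rewrite /E1 -/rho (_ : (t ^+ 2 + t ^+ 2 + 2 * t * t * rho) / 2 = t ^+ 2 * (1 + rho))//; field.
have hB' : `|B' - E2| <= e.
  by apply: le_trans hB; rewrite /E2 -/rho cos0 mul1r (_ : (t ^+ 2 + (- t) ^+ 2 + 2 * t * - t * rho) / 2 = t ^+ 2 * (1 - rho))//; field.
have -> : 2^-1 * A + 2^-1 * B' - m * P - m * Q + m * m =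
  2^-1 * (A - cos (a + a) * E1) + (2^-1 * (B' - E2) + (2^-1 * (cos (a + a) * (E1 - E0)) + (2^-1 * (E2 - E0)
    + (- (m * (P - m)) - m * (Q - m))))).
  have c2 : cos (a + a) = 2 * cos a ^+ 2 - 1 by rewrite cosD -!expr2 sin2cos2; ring.
  rewrite c2.
  have -> : m * (P - m) = m * P - m * m by ring.
  have -> : m * (Q - m) = m * Q - m * m by ring.
  by rewrite mE; field.
have m1 : `|m| <= 1.
  rewrite /m normrM -[leRHS]mulr1 ler_pM// ?cos_max// ger0_norm ?expR_ge0//.
  by rewrite expR_le1 oppr_le0 divr_ge0.
have f1 (x y : R) : `|x| <= y -> `|2^-1 * x| <= 2^-1 * y.
  by move=> xy; rewrite normrM ger0_norm// ler_wpM2l.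
have e1 := f1 _ _ hA'; have e2 := f1 _ _ hB'; have e4 := f1 _ _ d2.
have e3 : `|2^-1 * (cos (a + a) * (E1 - E0))| <= 2^-1 * (t0 ^+ 2 * `|rho|).
  apply: f1; rewrite normrM -[leRHS]mul1r ler_pM// cos_max//.
have e5 : `|m * (P - m)| <= e by rewrite normrM -[leRHS]mul1r ler_pM.
have e6 : `|m * (Q - m)| <= e by rewrite normrM -[leRHS]mul1r ler_pM.
apply: (@le_trans _ _ (3 * e + t0 ^+ 2 * `|rho|)).
  apply: le_trans (ler_normD _ _) _; apply: le_trans (lerD e1 (ler_normD _ _)) _.
  apply: le_trans (lerD (lexx _) (lerD e2 (ler_normD _ _))) _.
  apply: le_trans (lerD (lexx _) (lerD (lexx _) (lerD e3 (ler_normD _ _)))) _.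
  apply: le_trans (lerD (lexx _) (lerD (lexx _) (lerD (lexx _) (lerD e4 (ler_normB _ _))))) _.
  rewrite normrN.
  apply: le_trans (lerD (lexx _) (lerD (lexx _) (lerD (lexx _) (lerD (lexx _) (lerD e5 e6))))) _.
  lra.
have hr := EE_YY_le kl; rewrite -/rho in hr.
have hr' : t0 ^+ 2 * `|rho| <= t0 ^+ 2 * (Crho / cs ^+ 2) * (Num.sqrt k%:R / Num.sqrt l%:R).
  by rewrite -mulrA ler_wpM2l// exprn_ge0.
apply: le_trans (lerD (lexx _) hr') _; rewrite /e /dev_const.
set u := (Num.sqrt k%:R)^-1; set v := _ / Num.sqrt l%:R.
have u0 : 0 <= u by rewrite invr_ge0 ltW.
have v0 : 0 <= v by rewrite divr_ge0// ltW.
have CC0 : 0 <= t0 ^+ 2 * (Crho / cs ^+ 2).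
  by rewrite mulr_ge0 ?exprn_ge0// divr_ge0 ?exprn_ge0 ?(ltW cs0)// /Crho addr_ge0 ?mulr_ge0 ?addr_ge0 ?mulr_ge0.
set W := t0 ^+ 2 * _ in CC0 *.
have : 0 <= pair_const * v by rewrite mulr_ge0.
have : 0 <= W * u by rewrite mulr_ge0.
lra.
Qed.

End PairEstimate.

(** * Logarithmic averages *)

Section InverseRootSums.
Context {R : realType}.

Lemma sum_inv_sqrt_le n :
  \sum_(1 <= k < n.+1) (Num.sqrt k%:R)^-1 <= 2 * Num.sqrt n%:R :> R.
Proof.
elim: n => [|n IH]; first by rewrite big_geq// sqrtr0 mulr0.
rewrite big_nat_recr//=; apply: le_trans (lerD IH (lexx _)) _.
set p := Num.sqrt n%:R; set q := Num.sqrt n.+1%:R.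
have q0 : 0 < q by rewrite sqrtr_gt0 ltr0n.
have p0 : 0 <= p by exact: sqrtr_ge0.
have pq : q ^+ 2 = p ^+ 2 + 1 by rewrite !sqr_sqrtr// natr1.
rewrite -(ler_pM2r q0) mulrDl mulVf ?gt_eqF//; nra.
Qed.

Lemma sum_inv_sqrt3_le n :
  \sum_(1 <= k < n.+1) (k%:R * Num.sqrt k%:R)^-1 <= 3 :> R.
Proof.
suff H : (1 <= n)%N -> \sum_(1 <= k < n.+1) (k%:R * Num.sqrt k%:R)^-1 <= 3 - 2 / Num.sqrt n%:R :> R.
  case: n H => [_|n H]; first by rewrite big_geq.
  apply: le_trans (H isT) _; rewrite gerBl divr_ge0//.
elim: n => // -[_ _|n IH _].
  by rewrite big_nat1 sqrtr1 mulr1 invr1; lra.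
rewrite big_nat_recr//=; apply: le_trans (lerD (IH isT) (lexx _)) _.
set p := Num.sqrt n.+1%:R; set q := Num.sqrt n.+2%:R.
have q0 : 0 < q by rewrite sqrtr_gt0 ltr0n.
have p0 : 0 < p by rewrite sqrtr_gt0 ltr0n.
have nE : n.+2%:R = q ^+ 2 :> R by rewrite sqr_sqrtr.
have pq : q ^+ 2 = p ^+ 2 + 1 by rewrite !sqr_sqrtr// natr1.
have plq : p <= q by rewrite ler_wsqrtr// ler_nat.
rewrite nE -addrA lerD2l -subr_ge0.
have -> : - (2 / q) - (- (2 / p) + (q ^+ 2 * q)^-1) = (2 * q ^+ 2 * (q - p) - p) / (p * q ^+ 3).
  by field; rewrite !gt_eqF.
rewrite divr_ge0 ?mulr_ge0 ?exprn_ge0 ?(ltW p0) ?(ltW q0)//.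
have h : (q - p) * (q + p) = 1 by rewrite -subr_sqr pq; ring.
have h2 : 0 <= q - p by rewrite subr_ge0.
rewrite -(pmulr_rge0 _ (_ : 0 < q + p)) ?addr_gt0//.
have -> : (q + p) * (2 * q ^+ 2 * (q - p) - p) = 2 * q ^+ 2 * ((q - p) * (q + p)) - p * (q + p) by ring.
by rewrite h mulr1; nra.
Qed.

(** Nonnegativity of the empirical variance of the [z i]. *)
Lemma sqr_sum_le m (z : nat -> R) :
  (\sum_(0 <= i < m) z i) ^+ 2 <= m%:R * \sum_(0 <= i < m) z i ^+ 2.
Proof.
case: m => [|m]; first by rewrite !big_geq// expr0n mul0r.
set S := \sum_(0 <= i < m.+1) z i; set Q := \sum_(0 <= i < m.+1) z i ^+ 2.
have m0 : (0 : R) < m.+1%:R by rewrite ltr0n.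
have : 0 <= \sum_(0 <= i < m.+1) (z i - S / m.+1%:R) ^+ 2 by apply: sumr_ge0 => i _; exact: sqr_ge0.
have -> : \sum_(0 <= i < m.+1) (z i - S / m.+1%:R) ^+ 2 = Q - S ^+ 2 / m.+1%:R.
  transitivity (\sum_(0 <= i < m.+1) (z i ^+ 2 + (- 2 * (S / m.+1%:R)) * z i + (S / m.+1%:R) ^+ 2)).
    by apply: eq_bigr => i _; ring.
  rewrite !big_split/= -mulr_sumr -/S -/Q sumr_const_nat subn0 -[_ *+ m.+1]mulr_natr.
  by field; rewrite gt_eqF.
by rewrite subr_ge0 ler_pdivrMr// mulrC.
Qed.

End InverseRootSums.

Section LogAverages.
Context {R : realType}.

Lemma Hsum_harmonic n : Hsum n = series (@harmonic R) n.
Proof.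
rewrite /Hsum /series/= big_add1/=; apply: eq_bigr => i _; rewrite /harmonic/=.
by [].
Qed.

Lemma le_Hsum : {homo @Hsum R : m n / (m <= n)%N >-> m <= n}.
Proof.
move=> m n mn; rewrite /Hsum [leRHS](@big_cat_nat _ _ _ m.+1)//= lerDl sumr_ge0// => i _.
Qed.

Lemma Hsum_dvg (M : R) : exists n, M <= Hsum n.
Proof.
apply: contrapT => /forallNP H.
apply: (@dvg_harmonic R); apply: nondecreasing_is_cvgn.
  by move=> m n mn; rewrite -!Hsum_harmonic le_Hsum.
exists M => _ [n _ <-]; rewrite -Hsum_harmonic.
by have /negP := H n; rewrite -ltNge => /ltW.
Qed.

Lemma Hsum_geE (j : nat) : exists n, j.+1%:R ^+ 2 <= @Hsum R n.
Proof. exact: Hsum_dvg. Qed.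

(* Along these indices H_n grows like j^2, so that second moments O(1/H_n) are
   summable while consecutive terms have ratio tending to 1. *)
Definition log_index j := ex_minn (Hsum_geE j).

Lemma log_index_ge j : j.+1%:R ^+ 2 <= @Hsum R (log_index j).
Proof. by rewrite /log_index; case: ex_minnP. Qed.

Lemma log_index_gt0 j : (0 < log_index j)%N.
Proof.
have := log_index_ge j; case: (log_index j) => //.
by rewrite /Hsum big_geq// leNgt exprn_gt0// ltr0n.
Qed.

Lemma log_index_le j : @Hsum R (log_index j) <= j.+1%:R ^+ 2 + 1.
Proof.
have := log_index_gt0 j; rewrite /log_index; case: ex_minnP => -[//|n] _ mn _.
have h : @Hsum R n < j.+1%:R ^+ 2.
  by rewrite ltNge; apply/negP => /mn; rewrite ltnn.
rewrite /Hsum big_nat_recr//= -/(Hsum n) lerD ?(ltW h)//.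
by rewrite invf_le1 ?ltr0n// ler1n.
Qed.

Lemma log_index_min j n : j.+1%:R ^+ 2 <= @Hsum R n -> (log_index j <= n)%N.
Proof. by rewrite /log_index; case: ex_minnP => m _ mn /mn. Qed.

Lemma log_index_max j n : @Hsum R n < j.+1%:R ^+ 2 -> (n <= log_index j)%N.
Proof.
move=> h; rewrite leqNgt; apply/negP => /ltnW/le_Hsum.
by move=> /(le_trans (log_index_ge j)); rewrite leNgt h.
Qed.

Definition log_avg (g : nat -> R) n := (Hsum n)^-1 * \sum_(1 <= k < n.+1) k%:R^-1 * g k.

(** For n between two consecutive indices, the first being N, the averages at n and at N differ by
    at most 2 M (H_n - H_N) / H_n. The increment of H is O(j) while H_n is at least (j + 1)^2. *)
Lemma log_avg_interpolate (g : nat -> R) (M l : R) : (forall k, `|g k| <= M) ->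
  log_avg g (log_index j) @[j --> \oo] --> l -> log_avg g n @[n --> \oo] --> l.
Proof.
move=> gM gl.
have M0 : 0 <= M by apply: le_trans (gM 0%N).
have key j n : (log_index j <= n <= log_index j.+1)%N ->
    `|log_avg g n - log_avg g (log_index j)| <= 16 * M / j.+1%:R.
  move=> /andP[jn nj]; set N := log_index j.
  have H1 : j.+1%:R ^+ 2 <= @Hsum R N by exact: log_index_ge.
  have H2 : @Hsum R n <= j.+2%:R ^+ 2 + 1 by apply: le_trans (le_Hsum nj) (log_index_le _).
  have H3 : @Hsum R N <= Hsum n by exact: le_Hsum.
  have j0 : (0 : R) < j.+1%:R by rewrite ltr0n.
  have HN0 : 0 < @Hsum R N by apply: lt_le_trans H1; rewrite exprn_gt0.
  have Hn0 : 0 < @Hsum R n by apply: lt_le_trans H3.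
  have sM p q : (0 < p)%N -> `|\sum_(p <= k < q) k%:R^-1 * g k| <= M * \sum_(p <= k < q) k%:R^-1.
    move=> p0; apply: le_trans (ler_norm_sum _ _ _) _; rewrite mulr_sumr; apply: ler_sum => k _.
    by rewrite normrM normfV normr_nat [leLHS]mulrC ler_wpM2r ?invr_ge0 ?gM.
  have -> : log_avg g n - log_avg g N =
      (Hsum n)^-1 * \sum_(N.+1 <= k < n.+1) k%:R^-1 * g k
      + (((Hsum n)^-1 - (Hsum N)^-1) * \sum_(1 <= k < N.+1) k%:R^-1 * g k).
    by rewrite /log_avg (@big_cat_nat _ _ _ N.+1)//=; ring.
  have dH : \sum_(N.+1 <= k < n.+1) k%:R^-1 = Hsum n - Hsum N :> R.
    by rewrite /Hsum [in RHS](@big_cat_nat _ _ _ N.+1)//=; ring.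
  have e1 : `|(Hsum n)^-1 * \sum_(N.+1 <= k < n.+1) k%:R^-1 * g k| <= M * ((Hsum n - Hsum N) / Hsum n).
    rewrite normrM ger0_norm ?invr_ge0 ?(ltW Hn0)// mulrC mulrA ler_wpM2r ?invr_ge0 ?(ltW Hn0)//.
    by rewrite -dH; exact: sM.
  have e2 : `|((Hsum n)^-1 - (Hsum N)^-1) * \sum_(1 <= k < N.+1) k%:R^-1 * g k| <= M * ((Hsum n - Hsum N) / Hsum n).
    rewrite normrM distrC (ger0_norm (_ : 0 <= (Hsum N)^-1 - (Hsum n)^-1)) ?subr_ge0 ?lef_pV2//.
    apply: (@le_trans _ _ (((Hsum N)^-1 - (Hsum n)^-1) * (M * Hsum N))).
      by rewrite ler_wpM2l ?subr_ge0 ?lef_pV2//; exact: sM.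
    rewrite le_eqVlt; apply/orP; left; apply/eqP; field.
    by rewrite !gt_eqF.
  apply: le_trans (ler_normD _ _) _; apply: le_trans (lerD e1 e2) _.
  have e3 : (Hsum n - Hsum N) / Hsum n <= 8 / j.+1%:R :> R.
    rewrite ler_pdivrMr// mulrAC ler_pdivlMr//.
    have : j.+2%:R = j.+1%:R + 1 :> R by rewrite natr1.
    have : 1 <= j.+1%:R :> R by rewrite ler1n.
    move: H1 H2 H3; set u := j.+1%:R; set v := j.+2%:R; set hn := Hsum n; set hN := Hsum N.
    by move=> H1 H2 H3 u1 vu; subst v; nra.
  have : M * ((Hsum n - Hsum N) / Hsum n) <= M * (8 / j.+1%:R) by rewrite ler_wpM2l.
  by rewrite (_ : 16 * M / j.+1%:R = M * (8 / j.+1%:R) + M * (8 / j.+1%:R)); [move=> h; exact: lerD|ring].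
apply/cvgrPdist_le => e e0.
have e20 : 0 < e / 2 by lra.
move/cvgrPdist_le : gl => /(_ _ e20)[J1 _ HJ1].
have [J2 HJ2] : exists J2 : nat, 16 * M / (e / 2) <= J2%:R.
  exists (Num.bound (16 * M / (e / 2))); apply: ltW; apply: archi_boundP.
  by rewrite divr_ge0 ?mulr_ge0// ltW.
exists (log_index (maxn J1 J2)) => // n /= Jn.
have [j [jJ jn]] : exists j, (maxn J1 J2 <= j)%N /\ (log_index j <= n <= log_index j.+1)%N.
  have ex : exists i, @Hsum R n < i.+1%:R ^+ 2.
    exists (Num.bound (@Hsum R n)).
    have h : @Hsum R n < (Num.bound (@Hsum R n))%:R by rewrite archi_boundP// Hsum_ge0.
    apply: lt_le_trans h _; rewrite -natr1; set b : R := _%:R.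
    by have : 0 <= b by []; nra.
  case: (ex_minnP ex) => i Hi mi.
  have Ji : (maxn J1 J2 < i)%N.
    rewrite ltnNge; apply/negP => iJ.
    have : @Hsum R (log_index (maxn J1 J2)) < i.+1%:R ^+ 2 by apply: le_lt_trans (le_Hsum Jn) Hi.
    rewrite ltNge; apply/negP/negPn; apply: le_trans (log_index_ge _).
    by rewrite lerXn2r ?nnegrE// ler_nat.
  case: i Hi mi Ji => // i Hi mi Ji; exists i; split => //; apply/andP; split; last exact: log_index_max.
  apply: log_index_min; rewrite leNgt; apply/negP => /mi; by rewrite ltnn.
have h1 := HJ1 j (leq_trans (leq_maxl _ _) jJ).
have h2 := key j n jn.
have h3 : 16 * M / j.+1%:R <= e / 2.
  rewrite ler_pdivrMr ?ltr0n// [leRHS]mulrC -ler_pdivrMr//; apply: le_trans HJ2 _.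
  by rewrite ler_nat (leq_trans _ (leqnSn _))// (leq_trans (leq_maxr _ _) jJ).
rewrite (_ : l - log_avg g n = (l - log_avg g (log_index j)) - (log_avg g n - log_avg g (log_index j))); last by ring.
apply: le_trans (ler_normB _ _) _; rewrite [leRHS]splitr; apply: lerD => //; exact: le_trans h2 h3.
Qed.

End LogAverages.

(** * Second moments of logarithmic sums *)

Section SecondMoments.
Context d (Om : measurableType d) (R : realType) (mu : {measure set Om -> \bar R}).
Context (D : set Om) (mD : measurable D) (muD : mu D = 1%E).

Local Notation "'EE' f" := (\int[mu]_(x in D) f x) (at level 10, f at level 8).

(** Induction on n. Weighted by 1/k, the covariances with the new term sum to at most 5 C: 2 C from
    (n + 1)^(-1/2) times the sum of k^(-1/2), and 3 C from the sum of k^(-3/2). The cross terms thus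
    add 10 C / (n + 1) and the diagonal term at most 2 C / (n + 1), whence the constant 12. *)
Lemma EE_log_sum_le (u : nat -> Om -> R) (C : R) : 0 <= C -> (forall k, bmf D (u k)) ->
  (forall k l, (1 <= k <= l)%N -> `|EE (fun x => u k x * u l x)| <=
    C * (Num.sqrt k%:R / Num.sqrt l%:R + (Num.sqrt k%:R)^-1)) ->
  forall n, EE (fun x => (\sum_(1 <= k < n.+1) k%:R^-1 * u k x) ^+ 2) <= 12 * C * Hsum n.
Proof.
move=> C0 bu cov; elim=> [|n IH].
  rewrite /Hsum [in leRHS]big_geq// mulr0 (_ : EE (fun x => _) = 0)//.
  have z x : \sum_(1 <= k < 1) k%:R^-1 * u k x = 0 by rewrite big_geq.
  by rewrite -[RHS](EE_cst mD muD); apply: EE_ext => x _; rewrite z; exact: (mulr0 (0 : R)).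
have -> : EE (fun x => (\sum_(1 <= k < n.+2) k%:R^-1 * u k x) ^+ 2) =
   EE (fun x => (\sum_(1 <= k < n.+1) k%:R^-1 * u k x) ^+ 2) +
   2 / n.+1%:R * \sum_(1 <= k < n.+1) k%:R^-1 * EE (fun x => u k x * u n.+1 x) +
   n.+1%:R ^- 2 * EE (fun x => u n.+1 x * u n.+1 x).
  have -> : \sum_(1 <= k < n.+1) k%:R^-1 * EE (fun x => u k x * u n.+1 x) =
     EE (fun x => \sum_(1 <= k < n.+1) k%:R^-1 * (u k x * u n.+1 x)).
    by rewrite EE_sum//; [apply: eq_bigr => k _; rewrite EEZ//; bmf_auto|move=> k; bmf_auto].
  rewrite -!EEZ//; [|by bmf_auto..].
  rewrite -EED//; [|by bmf_auto..].
  rewrite -EED//; [|by bmf_auto..].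
  apply: EE_ext => x _; rewrite big_nat_recr//=.
  under [X in _ = _ + _ * X + _]eq_bigr do rewrite mulrA.
  by rewrite -mulr_suml; set S := \sum_(_ <= _ < _) _; field; rewrite addrC natr1 pnatr_eq0.
have N0 : 0 < Num.sqrt n.+1%:R :> R by rewrite sqrtr_gt0 ltr0n.
have n0 : (0 : R) < n.+1%:R by rewrite ltr0n.
have h1 : `|\sum_(1 <= k < n.+1) k%:R^-1 * EE (fun x => u k x * u n.+1 x)| <= C * 5.
  apply: le_trans (ler_norm_sum _ _ _) _.
  apply: (@le_trans _ _ (\sum_(1 <= k < n.+1) C * ((Num.sqrt n.+1%:R)^-1 * (Num.sqrt k%:R)^-1 + (k%:R * Num.sqrt k%:R)^-1))).
    rewrite big_nat [leRHS]big_nat; apply: ler_sum => k /andP[k1 kn].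
    rewrite normrM ger0_norm ?invr_ge0//.
    apply: le_trans (ler_wpM2l _ (cov k n.+1 _)) _; rewrite ?invr_ge0// ?k1 ?(ltnW kn)//.
    have k0 : 0 < Num.sqrt k%:R :> R by rewrite sqrtr_gt0 ltr0n.
    have kE : k%:R = Num.sqrt k%:R * Num.sqrt k%:R :> R by rewrite -expr2 sqr_sqrtr.
    have gen (p q r : R) : 0 < p -> 0 < q -> r = q * q ->
        r^-1 * (C * (q / p + q^-1)) = C * (p^-1 * q^-1 + (r * q)^-1).
      by move=> p0 q0 ->; field; rewrite !gt_eqF.
    by rewrite (gen _ _ _ N0 k0 kE).
  rewrite -mulr_sumr ler_wpM2l// big_split/= -mulr_sumr.
  have s1 := @sum_inv_sqrt_le R n; have s2 := @sum_inv_sqrt3_le R n.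
  have s3 : (Num.sqrt n.+1%:R)^-1 * \sum_(1 <= k < n.+1) (Num.sqrt k%:R)^-1 <= 2 :> R.
    rewrite mulrC ler_pdivrMr//; apply: le_trans s1 _.
    by rewrite ler_pM2l// ler_wsqrtr// ler_nat.
  by apply: le_trans (lerD s3 s2) _; lra.
have h2 : `|EE (fun x => u n.+1 x * u n.+1 x)| <= C * 2.
  have := cov n.+1 n.+1; rewrite leqnn/= => /(_ isT)/le_trans; apply.
  rewrite ler_wpM2l// divff ?gt_eqF//.
  have : (Num.sqrt n.+1%:R)^-1 <= 1 :> R.
    by rewrite invf_le1// -[leLHS]sqrtr1 ler_wsqrtr ?ler1n.
  by lra.
have -> : 12 * C * Hsum n.+1 = 12 * C * Hsum n + 10 * C / n.+1%:R + 2 * C / n.+1%:R.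
  by rewrite {1}/Hsum big_nat_recr//= -/(Hsum n); ring.
apply: lerD; first apply: lerD IH _.
  apply: le_trans (ler_norm _) _; rewrite normrM ger0_norm ?divr_ge0//.
  apply: le_trans (ler_wpM2l _ h1) _; first by rewrite divr_ge0.
  by rewrite le_eqVlt; apply/orP; left; apply/eqP; ring.
apply: le_trans (ler_norm _) _; rewrite normrM ger0_norm ?invr_ge0 ?exprn_ge0//.
apply: le_trans (ler_wpM2l _ h2) _; first by rewrite invr_ge0 exprn_ge0.
have n1 : n.+1%:R^-1 <= 1 :> R by rewrite invf_le1// ler1n.
have gen (v : R) : 0 <= v -> v <= 1 -> v * v * (C * 2) <= 2 * C * v.
  by move=> v0 v1; have := mulr_ge0 C0 (mulr_ge0 v0 (_ : 0 <= 1 - v)); rewrite subr_ge0 => /(_ v1); lra.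
by rewrite expr2 invfM; apply: gen; rewrite ?invr_ge0.
Qed.

End SecondMoments.

Lemma sum_inv_sqr_le (R : realType) n : \sum_(0 <= j < n) (j.+1%:R ^+ 2)^-1 <= 2 :> R.
Proof.
case: n => [|n]; first by rewrite big_geq.
suff H : \sum_(0 <= j < n.+1) (j.+1%:R ^+ 2)^-1 <= 2 - n.+1%:R^-1 :> R.
  by apply: le_trans H _; rewrite gerBl invr_ge0.
elim: n => [|n IH]; first by rewrite big_nat1 expr1n invr1; lra.
rewrite big_nat_recr//=; apply: le_trans (lerD IH (lexx _)) _.
have n2 : n.+2%:R = n.+1%:R + 1 :> R by rewrite natr1.
have : 1 <= n.+1%:R :> R by rewrite ler1n.
rewrite n2; set u := n.+1%:R => u1.
rewrite -subr_ge0.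
have -> : 2 - (u + 1)^-1 - (2 - u^-1 + (u + 1) ^- 2) = (u * (u + 1) ^+ 2)^-1.
  by field; rewrite !gt_eqF//; lra.
by rewrite invr_ge0 mulr_ge0 ?exprn_ge0//; lra.
Qed.

(** * Almost sure convergence from summable second moments *)

Section AlmostSureConvergence.
Context d (Om : measurableType d) (R : realType) (mu : {measure set Om -> \bar R}).
Context (D : set Om) (mD : measurable D) (muD : mu D = 1%E).

Local Notation "'EE' f" := (\int[mu]_(x in D) f x) (at level 10, f at level 8).

Lemma bmf_EFinE f : bmf D f -> (\int[mu]_(x in D) (f x)%:E)%E = (EE f)%:E.
Proof.
by move=> bf; rewrite fineK//; apply: integrable_fin_num => //; exact: bmf_integrable.
Qed.

(** The series of the squares has integral at most 2 C, so it is finite almost everywhere and its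
    terms tend to 0. *)
Lemma ae_cvg0_of_moment2 (g : nat -> Om -> R) (C : R) :
  (forall j, bmf D (g j)) -> (forall j, EE (fun x => g j x ^+ 2) <= C / j.+1%:R ^+ 2) ->
  {ae mu, forall x, D x -> g j x @[j --> \oo] --> 0}.
Proof.
move=> bg gC.
have C0 : 0 <= C.
  have := le_trans _ (gC 0%N); rewrite expr1n divr1; apply.
  by apply: Rintegral_ge0 => x _; exact: sqr_ge0.
pose F x := (\sum_(j <oo) (g j x ^+ 2)%:E)%E.
have bg2 j : bmf D (fun x => g j x ^+ 2) by bmf_auto.
have mg j : measurable_fun D (fun x => (g j x ^+ 2)%:E).
  by apply/measurable_EFinP; case: (bg2 j).
have F0 x : (0 <= F x)%E by apply: nneseries_ge0 => j _ _; rewrite lee_fin sqr_ge0.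
have iF : mu.-integrable D F.
  apply/integrableP; split.
    by apply: ge0_emeasurable_sum => // j x Dx _; rewrite lee_fin sqr_ge0.
  under eq_integral => x _ do rewrite gee0_abs//.
  rewrite /F integral_nneseries//; last by move=> j x _; rewrite lee_fin sqr_ge0.
  apply: (@le_lt_trans _ _ (2 * C)%:E); last by rewrite ltry.
  apply: lime_le.
    by apply: is_cvg_nneseries => j _ _; apply: integral_ge0 => x _; rewrite lee_fin sqr_ge0.
  apply: nearW => n.
  under eq_bigr do rewrite bmf_EFinE//.
  rewrite sumEFin lee_fin.
  apply: (@le_trans _ _ (\sum_(0 <= j < n) C * (j.+1%:R ^+ 2)^-1)).
    by apply: ler_sum => j _; exact: gC.
  by rewrite -mulr_sumr mulrC ler_wpM2r// sum_inv_sqr_le.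
apply: filterS (integrable_ae mD iF) => x Fx Dx.
have {}Fx := Fx Dx.
have h : g j x ^+ 2 @[j --> \oo] --> 0.
  apply: cvg_series_cvg_0; apply: nondecreasing_is_cvgn.
    apply/nondecreasing_seqP => n; rewrite seriesSr/= lerDl sqr_ge0//.
  exists (fine (F x)) => _ [n _ <-].
  rewrite -lee_fin fineK// /series/= -sumEFin.
  by apply: nneseries_lim_ge => j _ _; rewrite lee_fin sqr_ge0.
have := cvg_comp _ _ h (@sqrt_continuous R 0); rewrite sqrtr0 => h2.
apply/norm_cvg0P; suff -> : (fun j => `|g j x|) = Num.sqrt \o (fun j => g j x ^+ 2) by [].
by apply/funext => j /=; rewrite sqrtr_sqr.
Qed.

(** Convexity of the square: a second-moment bound valid for each frequency passes to the mean over
    a grid of frequencies, whatever its size. *)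
Lemma EE_avg_log_sum_le (m : nat) (u : nat -> nat -> Om -> R) (C : R) n : 0 <= C -> (0 < m)%N ->
  (forall i k, bmf D (u i k)) ->
  (forall i, (i < m)%N -> EE (fun x => (\sum_(1 <= k < n.+1) k%:R^-1 * u i k x) ^+ 2) <= C) ->
  EE (fun x => (\sum_(1 <= k < n.+1) k%:R^-1 * (m%:R^-1 * \sum_(0 <= i < m) u i k x)) ^+ 2) <= C.
Proof.
move=> C0 m0 bu uC.
have m0' : (0 : R) < m%:R by rewrite ltr0n.
pose z i x := \sum_(1 <= k < n.+1) k%:R^-1 * u i k x.
have bz i : bmf D (z i) by rewrite /z; bmf_auto.
apply: (@le_trans _ _ (EE (fun x => m%:R^-1 * \sum_(0 <= i < m) z i x ^+ 2))).
  apply: EE_le => //; [by bmf_auto|by bmf_auto|move=> x _].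
  have -> : \sum_(1 <= k < n.+1) k%:R^-1 * (m%:R^-1 * \sum_(0 <= i < m) u i k x) =
      m%:R^-1 * \sum_(0 <= i < m) z i x.
    rewrite /z exchange_big/= mulr_sumr; apply: eq_bigr => k _.
    by rewrite mulrCA mulr_sumr.
  rewrite exprMn expr2 -mulrA ler_pM2l ?invr_gt0//.
  by rewrite mulrC ler_pdivrMr// mulrC; exact: sqr_sum_le.
rewrite EEZ//; last by bmf_auto.
rewrite EE_sum//; last by move=> i; bmf_auto.
rewrite mulrC ler_pdivrMr//.
apply: (@le_trans _ _ (\sum_(0 <= i < m) C)).
  by rewrite big_nat [leRHS]big_nat; apply: ler_sum => i /andP[_ im]; exact: uC.
by rewrite sumr_const_nat subn0 mulr_natr.
Qed.

End AlmostSureConvergence.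

(** * The standard normal law *)

(** [p] agrees almost everywhere with the Radon-Nikodym derivative, since both have the same
    integral over every measurable set. *)
Lemma integral_density d (T : measurableType d) (R : realType)
  (nu : {finite_measure set T -> \bar R}) (mu : {sigma_finite_measure set T -> \bar R})
  (p : T -> \bar R) (f : T -> \bar R) :
  mu.-integrable [set: T] p -> nu `<< mu ->
  (forall A, measurable A -> nu A = \int[mu]_(x in A) p x)%E ->
  nu.-integrable [set: T] f ->
  (\int[nu]_x f x = \int[mu]_x (f x * p x))%E.
Proof.
move=> ip numu nuE fi.
have numu' : charge_of_finite_measure nu `<< mu by [].
rewrite -(Radon_Nikodym_change_of_variables numu)//.
have mf := measurable_int _ fi; have mp := measurable_int _ ip.
apply: ae_eq_integral => //.
- by apply: emeasurable_funM => //; apply: (measurable_int mu); exact: Radon_Nikodym_integrable.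
- by apply: emeasurable_funM.
- apply: ae_eqe_mul2l => /=; apply: integral_ae_eq => //.
  + exact: Radon_Nikodym_integrable.
  + by move=> E _ mE; rewrite -Radon_Nikodym_integral// -nuE.
Qed.

Section StandardNormal.
Context {R : realType}.
Local Notation leb := (@lebesgue_measure R).
Local Notation gam := (@normal_prob R 0 1).
Local Notation w := (@normal_pdf R 0 1).

Let c0 : R := normal_peak 1.

Lemma normal_pdf01E x : w x = c0 * expR (- (x ^+ 2 / 2)).
Proof.
rewrite /normal_pdf (negbTE (oner_neq0 _)) /normal_fun subr0 expr1n.
by congr (_ * expR _); rewrite mulNr.
Qed.

Lemma integral_normalE (f : R -> R) : measurable_fun setT f -> (exists B : R, forall x, `|f x| <= B) ->
  \int[gam]_x f x = \int[leb]_x (f x * w x).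
Proof.
move=> mf [B fB]; rewrite /Rintegral; congr fine.
have -> : (\int[leb]_x (f x * w x)%:E = \int[leb]_x ((f x)%:E * (w x)%:E))%E by [].
apply: integral_density => //.
- exact: integrable_normal_pdf.
- exact: normal_prob_dominates.
- apply: measurable_bounded_integrable => //.
    by rewrite -ge0_fin_numE ?fin_num_measure.
  exists B; split; first exact: num_real.
  by move=> M BM x _; apply: le_trans (fB x) (ltW BM).
Qed.

Lemma xsqr_expR_le (x : R) : x ^+ 2 * expR (- (x ^+ 2 / 2)) <= 4 * expR (- (x ^+ 2 / 4)).
Proof.
have -> : - (x ^+ 2 / 2) = - (x ^+ 2 / 4) + - (x ^+ 2 / 4) by field.
rewrite expRD mulrA ler_pM2r ?expR_gt0// expRN ler_pdivrMr ?expR_gt0//.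
by have := expR_ge1Dx (x ^+ 2 / 4); lra.
Qed.

(** The normal density of variance 2 decays like exp(- x^2 / 4) and serves as an integrable majorant
    of [(1 + |x|) * w x]. *)
Let s2 : R := Num.sqrt 2.
Let c2 : R := normal_peak s2.

Let s2_neq0 : s2 != 0. Proof. by rewrite gt_eqF// sqrtr_gt0. Qed.

Let w2E x : normal_pdf 0 s2 x = c2 * expR (- (x ^+ 2 / 4)).
Proof.
rewrite /normal_pdf (negbTE s2_neq0) /normal_fun subr0 sqr_sqrtr//.
by congr (_ * expR _); rewrite mulNr; congr (- (_ / _)); rewrite -mulr_natr; lra.
Qed.

Let K0 : R := 5 * c0 / c2.

Let c00 : 0 < c0. Proof. by rewrite normal_peak_gt0// oner_neq0. Qed.
Let c20 : 0 < c2. Proof. by rewrite normal_peak_gt0. Qed.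

Lemma xM_pdf_le (x : R) : (1 + `|x|) * w x <= 2 * K0 * normal_pdf 0 s2 x.
Proof.
rewrite normal_pdf01E w2E /K0.
have -> : 2 * (5 * c0 / c2) * (c2 * expR (- (x ^+ 2 / 4))) = c0 * (10 * expR (- (x ^+ 2 / 4))).
  by field; rewrite gt_eqF.
rewrite mulrCA ler_pM2l//.
have e1 := expR_gt0 (- (x ^+ 2 / 2)).
have h := xsqr_expR_le x.
have h2 : expR (- (x ^+ 2 / 2)) <= expR (- (x ^+ 2 / 4)).
  by rewrite ler_expR lerN2 ler_wpM2l ?sqr_ge0// lef_pV2 ?posrE// ler_nat.
have h3 : 1 + `|x| <= 2 + x ^+ 2.
  by rewrite -(real_normK (num_real x)); have := sqr_ge0 (`|x| - 1); have : 0 <= `|x| by []; nra.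
apply: le_trans (ler_wpM2r (ltW e1) h3) _.
by rewrite mulrDl; lra.
Qed.

Lemma integrable_xM_pdf : leb.-integrable setT (fun x => ((1 + `|x|) * w x)%:E).
Proof.
apply: (@le_integrable _ _ _ leb setT measurableT _ (fun x => (2 * K0 * normal_pdf 0 s2 x)%:E)).
- apply/measurable_EFinP; apply: measurable_funM.
    by apply: measurable_funD => //; apply: measurableT_comp.
  exact: measurable_normal_pdf.
- move=> x _; rewrite !abse_EFin lee_fin ger0_norm.
    by apply: le_trans (xM_pdf_le x) _; exact: ler_norm.
  by rewrite mulr_ge0 ?normal_pdf_ge0// addr_ge0.
- exact: (integrableZl measurableT (2 * K0) (integrable_normal_pdf 0 s2)).
Qed.

Lemma integrable_M_pdf (f : R -> R) (C : R) : measurable_fun setT f ->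
  (forall x, `|f x| <= C * (1 + `|x|)) -> leb.-integrable setT (fun x => (f x * w x)%:E).
Proof.
move=> mf fC.
apply: (@le_integrable _ _ _ leb setT measurableT _ (fun x => (C * ((1 + `|x|) * w x))%:E)).
- by apply/measurable_EFinP; apply: measurable_funM => //; exact: measurable_normal_pdf.
- move=> x _; rewrite !abse_EFin lee_fin normrM mulrA.
  rewrite (ger0_norm (normal_pdf_ge0 0 1 x)).
  apply: le_trans (ler_norm _).
  by rewrite ler_wpM2r ?normal_pdf_ge0.
- exact: (integrableZl measurableT C integrable_xM_pdf).
Qed.

Let is_derive_w (x : R) : is_derive x 1 (w : R -> R) (- x * w x).
Proof.
rewrite (_ : (w : R -> R) = fun x => c0 * expR (- (x ^+ 2 / 2))); last first.
  by apply/funext => y; exact: normal_pdf01E.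
apply: is_derive_eq; rewrite /GRing.scale/=; lra.
Qed.

Variable a : R.

Let mcos (t : R) : measurable_fun setT (fun x : R => cos (t * x + a)).
Proof.
apply: measurableT_comp; first by apply: continuous_measurable_fun; exact: continuous_cos.
by apply: measurable_funD => //; exact: measurable_funM.
Qed.

Let msin (t : R) : measurable_fun setT (fun x : R => sin (t * x + a)).
Proof.
apply: measurableT_comp; first by apply: continuous_measurable_fun; exact: continuous_sin.
by apply: measurable_funD => //; exact: measurable_funM.
Qed.

(** A primitive of [h t], vanishing at infinity. *)
Let H (t : R) (x : R) : R := - (sin (t * x + a)) * w x.
Let h (t : R) (x : R) : R := (x * sin (t * x + a) - t * cos (t * x + a)) * w x.

Let is_derive_H t (x : R) : is_derive x 1 (H t) (h t x).
Proof.
rewrite /H /h; have := is_derive_w x => dw.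
apply: is_derive_eq; rewrite /GRing.scale/=; ring.
Qed.

Let h_bnd t x : `|x * sin (t * x + a) - t * cos (t * x + a)| <= (1 + `|t|) * (1 + `|x|).
Proof.
apply: le_trans (ler_normB _ _) _; rewrite !normrM.
have := sin_max (t * x + a); have := cos_max (t * x + a).
have : 0 <= `|x| by []. have : 0 <= `|t| by [].
have : 0 <= `|sin (t * x + a)| by []. have : 0 <= `|cos (t * x + a)| by [].
nra.
Qed.

Let mh t : measurable_fun setT (fun x : R => x * sin (t * x + a) - t * cos (t * x + a)).
Proof. by apply: measurable_funB; apply: measurable_funM. Qed.

Let integrable_h t : leb.-integrable setT (EFin \o h t).
Proof. by apply: (@integrable_M_pdf _ (1 + `|t|)) => //; exact: h_bnd. Qed.

Lemma cvg_pdf_0 : w n%:R @[n --> \oo] --> 0.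
Proof.
apply: (@squeeze_cvgr _ _ _ _ (cst 0) (fun n => 2 * c0 * n.+1%:R^-1)).
- apply: nearW => n; rewrite normal_pdf_ge0/= normal_pdf01E.
  suff hh : expR (- (n%:R ^+ 2 / 2)) <= 2 / n.+1%:R :> R.
    have -> : 2 * c0 / n.+1%:R = c0 * (2 / n.+1%:R) :> R by ring.
    by apply: ler_wpM2l => //; exact: ltW.
  rewrite expRN ler_pdivlMr ?ltr0n// mulrC ler_pdivrMr ?expR_gt0//.
  have n1 : n.+1%:R = n%:R + 1 :> R by rewrite natr1.
  have := expR_ge1Dx (n%:R ^+ 2 / 2 : R); rewrite n1.
  set u : R := n%:R; set v := expR _; have := sqr_ge0 (u - 1); nra.
- exact: cvg_cst.
- rewrite -[X in _ --> X](mulr0 (2 * c0)); apply: cvgM; first exact: cvg_cst.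
  exact: cvg_harmonic.
Qed.

(** Gaussian integration by parts, E Z g(Z) = E g'(Z), for g(x) = sin(t x + a): the boundary values
    of [H t] on growing intervals tend to 0, and dominated convergence passes to the whole line. *)
Lemma stein_identity (t : R) : \int[leb]_x h t x = 0.
Proof.
pose Dn (n : nat) : set R := `[(- n.+1%:R), n.+1%:R]%classic.
have mD n : measurable (Dn n) by exact: measurable_itv.
have cont : continuous (h t).
  move=> x; rewrite /h; apply: cvgM.
    apply: cvgB; apply: cvgM; [exact: cvg_id| |exact: cvg_cst|].
      apply: continuous_comp; last exact: continuous_sin.
      by apply: cvgD; [apply: cvgM; [exact: cvg_cst|exact: cvg_id]|exact: cvg_cst].
    apply: continuous_comp; last exact: continuous_cos.
    by apply: cvgD; [apply: cvgM; [exact: cvg_cst|exact: cvg_id]|exact: cvg_cst].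
  by apply: continuous_normal_pdf; rewrite oner_neq0.
have IE n : (\int[leb]_x ((h t \_ (Dn n)) x)%:E = (H t n.+1%:R - H t (- n.+1%:R))%:E)%E.
  have -> : (\int[leb]_x ((h t \_ (Dn n)) x)%:E = \int[leb]_(x in Dn n) (h t x)%:E)%E.
    by rewrite [in RHS]integral_mkcond; apply: eq_integral => x _; rewrite restrict_EFin.
  rewrite EFinB; apply: continuous_FTC2.
  - by rewrite (@lt_trans _ _ 0)// ?oppr_lt0 ltr0n.
  - by apply: continuous_subspaceT.
  - have dH x : derivable (H t) x 1 by exact: ex_derive.
    have cH : continuous (H t) by move=> x; apply: differentiable_continuous; exact/derivable1_diffP.
    split; [by move=> x _|by apply: cvg_at_right_filter; exact: cH|by apply: cvg_at_left_filter; exact: cH].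
  - by move=> x _; rewrite derive1E; apply: derive_val.
have mf n : measurable_fun setT (fun x => ((h t \_ (Dn n)) x)%:E).
  have m1 : measurable_fun (Dn n) (h t).
    by apply: measurable_funTS; exact: (continuous_measurable_fun cont).
  by apply/measurable_EFinP; exact: (measurable_restrictT (h t) (mD n)).1 m1.
have mf' := measurable_int _ (integrable_h t).
have pc : {ae leb, forall x, setT x -> ((h t \_ (Dn n)) x)%:E @[n --> \oo] --> (h t x)%:E}.
  apply: aeW => x _; apply/fine_cvgP; split; first exact: nearW.
  apply: cvg_near_cst; exists (Num.bound `|x|) => // n /= bn.
  rewrite /= patchE ifT// inE /Dn/= in_itv/= -ler_norml.
  by apply/ltW/(lt_le_trans (archi_boundP _)) => //; rewrite ler_nat (leq_trans bn).
have dm : {ae leb, forall x n, setT x -> (`|((h t \_ (Dn n)) x)%:E| <= `|(h t x)%:E|)%E}.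
  apply: aeW => x n _; rewrite patchE; case: ifP => _//.
  by rewrite abse_EFin normr0 lee_fin.
have [_ _ dc] := @dominated_convergence _ _ _ leb setT measurableT _ _ _ mf mf' pc (integrable_abse (integrable_h t)) dm.
have L : (\int[leb]_x ((h t \_ (Dn n)) x)%:E)%E @[n --> \oo] --> 0%E.
  under eq_fun do rewrite IE.
  apply/fine_cvgP; split; first exact: nearW.
  rewrite /=.
  apply/norm_cvg0P.
  apply: (@squeeze_cvgr _ _ _ _ (cst 0) (fun n => 2 * w n.+1%:R)).
  - apply: nearW => n; rewrite normr_ge0/=.
    have wN : w (- n.+1%:R) = w n.+1%:R by rewrite !normal_pdf01E sqrrN.
    rewrite /H wN -mulrBl normrM (ger0_norm (normal_pdf_ge0 _ _ _)) ler_wpM2r ?normal_pdf_ge0//.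
    apply: le_trans (ler_normB _ _) _; rewrite !normrN.
    by have := sin_max (t * n.+1%:R + a); have := sin_max (t * - n.+1%:R + a); lra.
  - exact: cvg_cst.
  - rewrite -[X in _ --> X](mulr0 2); apply: cvgM; first exact: cvg_cst.
    by rewrite (cvg_shiftS (fun n => w n%:R)); exact: cvg_pdf_0.
by rewrite /Rintegral (cvg_unique (@ereal_hausdorff R) dc L).
Qed.

(** As a function of the frequency s, the integral F satisfies F' = - s F, by differentiation under
    the integral sign and [stein_identity]. So F(s) exp(s^2 / 2) is constant, equal to F(0) = cos
    a. *)
Lemma normal_cos (t : R) : \int[gam]_x cos (t * x + a) = cos a * expR (- (t ^+ 2 / 2)).
Proof.
have bc (s : R) : exists B : R, forall x, `|cos (s * x + a)| <= B.
  by exists 1 => x; exact: cos_max.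
pose F (s : R) : R := \int[leb]_x (cos (s * x + a) * w x).
have FE s : \int[gam]_x cos (s * x + a) = F s by exact: integral_normalE.
pose f (s x : R) : R := cos (s * x + a) * w x.
have d1 (s x : R) : is_derive s 1 (fun s => f s x) (- x * sin (s * x + a) * w x).
  by apply: is_derive_eq; rewrite /GRing.scale/=; ring.
have d1E s x : partial1of2 f s x = - x * sin (s * x + a) * w x.
  by rewrite partial1of2E; apply: derive_val.
have intf s : leb.-integrable setT (EFin \o f s).
  apply: (@integrable_M_pdf _ 1) => // x; rewrite mul1r.
  by apply: le_trans (cos_max _) _; rewrite lerDl.
have dF (s : R) : is_derive s (1 : R) F (- s * F s).
  have Ia : `](s - 1), (s + 1)[%classic s by rewrite /= in_itv/=; apply/andP; split; lra.
  have e1 x y : `](s - 1), (s + 1)[%classic x -> setT y -> derivable (f ^~ y) x 1.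
    by move=> _ _; exact: ex_derive.
  have e2 (x y : R) : `](s - 1), (s + 1)[%classic x -> setT y -> `|partial1of2 f x y| <= (1 + `|y|) * w y.
    move=> _ _; rewrite d1E normrM (ger0_norm (normal_pdf_ge0 _ _ _)) ler_wpM2r ?normal_pdf_ge0//.
    rewrite normrM normrN; have := sin_max (x * y + a); have : 0 <= `|y| by [].
    by have : 0 <= `|sin (x * y + a)| by []; nra.
  have g0 (y : R) : 0 <= (1 + `|y|) * w y by rewrite mulr_ge0 ?normal_pdf_ge0// addr_ge0.
  have D := @derivable_under_integral R _ _ leb f setT measurableT s _ _ Ia
    (fun x _ => intf x) e1 _ g0 integrable_xM_pdf e2.
  have E := @differentiation_under_integral R _ _ leb f setT measurableT s _ _ Ia
    (fun x _ => intf x) e1 _ g0 integrable_xM_pdf e2.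
  have -> : - s * F s = F^`()%classic s.
    rewrite E.
    have -> : \int[leb]_y partial1of2 f s y = \int[leb]_y (- 1 * (h s y) + - s * f s y).
      by apply: eq_Rintegral => y _; rewrite d1E /h /f; ring.
    have E1 : \int[leb]_y (- 1 * h s y) = 0.
      by rewrite -[RHS](mulr0 (-1)) -(stein_identity s); apply: RintegralZl => //; exact: integrable_h.
    have E2 : \int[leb]_y (- s * f s y) = - s * F s by apply: RintegralZl => //; exact: intf.
    rewrite RintegralD//; last 2 first.
      exact: (integrableZl measurableT (- 1) (integrable_h s)).
      exact: (integrableZl measurableT (- s) (intf s)).
    by rewrite E1 E2 add0r.
  by rewrite derive1E; exact: derivableP.
pose q (s : R) := F s * expR (s ^+ 2 / 2).
have dq (s : R) : is_derive s (1 : R) q 0.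
  have := dF s => dFs; apply: is_derive_eq; rewrite /GRing.scale/=; lra.
have qc : q t = q 0.
  have := @is_derive_0_is_cst R q t 0; apply => x; exact: dq.
have q0 : q 0 = cos a.
  rewrite /q expr0n/= mul0r expR0 mulr1 -FE -[RHS](@EE_cst _ _ _ gam setT measurableT _).
    by apply: eq_Rintegral => x _; rewrite mul0r add0r.
  exact: probability_setT.
by rewrite FE -q0 -qc /q -mulrA -expRD subrr expR0 mulr1.
Qed.

End StandardNormal.

Lemma normal_tail (R : realType) (e : R) : 0 < e ->
  exists L : nat, \int[@normal_prob R 0 1]_x (\1_[set y | L%:R < `|y|] x) <= e.
Proof.
move=> e0.
pose F (n : nat) : set R := [set y | n%:R < `|y|].
have mF n : measurable (F n).
  have -> : F n = ~` `[(- n%:R), n%:R]%classic.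
    apply/seteqP; split => x; rewrite /F/= in_itv/= -ler_norml.
      by move=> nx; apply/negP; rewrite -ltNge.
    by move/negP; rewrite -ltNge.
  exact: measurableC.
have F0 : \bigcap_n F n = set0.
  rewrite -subset0 => x /= h; have := h (Num.bound `|x|) I; rewrite /F/= ltNge => /negP; apply.
  exact/ltW/archi_boundP.
have := @nonincreasing_cvg_mu _ _ _ (@normal_prob R 0 1) F _ mF _ _.
rewrite F0 measure0 => h.
have {}h : (@normal_prob R 0 1 \o F) x @[x --> \oo] --> 0%E.
  apply: h => //; first exact: (le_lt_trans (@probability_le1 _ _ R (normal_prob 0 1) (F 0%N) (mF 0%N)) (ltry 1)).
  move=> n m nm; apply/subsetPset => x; rewrite /F/=; apply: le_lt_trans.
  by rewrite ler_nat.
have /fine_cvgP[_ /cvgrPdist_le/(_ _ e0)[N _ HN]] := h.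
exists N; have := HN N (leqnn N); rewrite /= sub0r normrN => /(le_trans (ler_norm _)) => {}HN.
rewrite /Rintegral integral_indic//= ?setIT//; exact: mF.
Qed.

(** * A continuity theorem for logarithmic averages *)

Section BinomialMean.
Context {R : realType}.
Implicit Types (u : R) (g : nat -> R).

(* Mean of [g] under the binomial law of parameters [n] and [u]; in the variable
   [u] these are the Bernstein polynomials. *)
Fixpoint binomial_mean u n g : R :=
  if n is n'.+1 then (1 - u) * binomial_mean u n' g + u * binomial_mean u n' (fun k => g k.+1)
  else g 0%N.

Lemma binomial_mean_le u n g g' : 0 <= u <= 1 -> (forall k, (k <= n)%N -> g k <= g' k) ->
  binomial_mean u n g <= binomial_mean u n g'.
Proof.
move=> /andP[u0 u1]; elim: n g g' => [|n IH] g g' gg'; first exact: gg'.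
rewrite /= lerD// ler_wpM2l// ?subr_ge0// IH// => k kn; apply: gg' => //.
exact: leqW.
Qed.

Lemma binomial_mean_affine u n g (a b : R) :
  binomial_mean u n (fun k => a + b * g k) = a + b * binomial_mean u n g.
Proof. by elim: n g => [//|n IH] g /=; rewrite !IH; ring. Qed.

(** The shift [c] carries the induction, since moving [g] by one index turns c into c + 1. For c = -
    n u this is the binomial variance n u (1 - u). *)
Lemma binomial_mean_sqr u n (c : R) :
  binomial_mean u n (fun k => (k%:R + c) ^+ 2) = (n%:R * u + c) ^+ 2 + n%:R * u * (1 - u).
Proof.
elim: n c => [|n IH] c /=; first by ring.
rewrite IH (_ : (fun k => (k.+1%:R + c) ^+ 2) = fun k => (k%:R + (c + 1)) ^+ 2); last first.
  by apply/funext => k; rewrite -natr1; ring.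
by rewrite IH -natr1; ring.
Qed.

Lemma binomial_mean_norm_le u n g (B : R) : 0 <= u <= 1 -> (forall k, `|g k| <= B) ->
  `|binomial_mean u n g| <= B.
Proof.
move=> u01 gB.
have cst c : binomial_mean u n (fun=> c) = c.
  by elim: (n) => //= m ->; ring.
rewrite ler_norml -{1}(cst (- B)) -{2}(cst B) !binomial_mean_le// => k _;
  by have := gB k; rewrite ler_norml => /andP[].
Qed.

(** Bernstein's argument with the modulus of continuity replaced by a quadratic majorant, whose
    binomial mean is e + c u (1 - u) / n. *)
Lemma binomial_mean_approx u n g (y e c : R) : 0 <= u <= 1 -> 0 <= c -> (0 < n)%N ->
  (forall k, (k <= n)%N -> `|g k - y| <= e + c * (k%:R / n%:R - u) ^+ 2) ->
  `|binomial_mean u n g - y| <= e + c / n%:R.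
Proof.
move=> u01 c0 n0 gy; have /andP[u0 u1] := u01.
have n0' : (0 : R) < n%:R by rewrite ltr0n.
have key : binomial_mean u n (fun k => (k%:R + (- (n%:R * u))) ^+ 2) <= n%:R.
  rewrite binomial_mean_sqr subrr expr0n/= add0r -mulrA -[leRHS]mulr1 ler_pM2l//.
  by nra.
have kE k : (k%:R / n%:R - u) ^+ 2 = (n%:R ^+ 2)^-1 * (k%:R + - (n%:R * u)) ^+ 2.
  by field; rewrite gt_eqF.
have key2 : c * (n%:R ^+ 2)^-1 * binomial_mean u n (fun k => (k%:R + (- (n%:R * u))) ^+ 2) <= c / n%:R.
  rewrite -mulrA ler_wpM2l//.
  apply: le_trans (ler_wpM2l _ key) _; first by rewrite invr_ge0 exprn_ge0// ltW.
  by rewrite expr2 invfM -mulrA mulVf ?mulr1// gt_eqF.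
rewrite ler_norml; apply/andP; split.
  have : binomial_mean u n (fun k => (y - e) + (- (c * (n%:R ^+ 2)^-1)) * (k%:R + - (n%:R * u)) ^+ 2)
      <= binomial_mean u n g.
    apply: binomial_mean_le => // k kn; have := gy k kn; rewrite ler_norml kE mulrA => /andP[+ _].
    by lra.
  by rewrite binomial_mean_affine; lra.
have : binomial_mean u n g <=
    binomial_mean u n (fun k => (y + e) + (c * (n%:R ^+ 2)^-1) * (k%:R + - (n%:R * u)) ^+ 2).
  apply: binomial_mean_le => // k kn; have := gy k kn; rewrite ler_norml kE mulrA => /andP[_ +].
  by lra.
by rewrite binomial_mean_affine; lra.
Qed.

End BinomialMean.

(** * Trigonometric approximation on long intervals *)

Section TrigApproximation.
Context {R : realType}.
Variables (phi : R -> R) (cphi : continuous phi) (B : R) (phiB : forall x, `|phi x| <= B).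
Variables (q : nat).
Local Notation L := (q.+1%:R : R).

(* On [- L pi / 2, L pi / 2], phi is a continuous function of sin (x / L); its
   Bernstein polynomials are trigonometric polynomials in x. *)
Definition trig_grid n k : R := phi (L * asin (k%:R / n%:R * 2 - 1)).
Definition trig_var (x : R) : R := (1 + sin (x / L)) / 2.
Definition trig_poly n x := binomial_mean (trig_var x) n (trig_grid n).

Let L0 : 0 < L. Proof. by rewrite ltr0n. Qed.

Lemma trig_var01 x : 0 <= trig_var x <= 1.
Proof. by rewrite /trig_var; have := sin_geN1 (x / L); have := sin_le1 (x / L); lra. Qed.

Lemma trig_poly_le n x : `|trig_poly n x| <= B.
Proof. by apply: binomial_mean_norm_le; [exact: trig_var01|move=> k; exact: phiB]. Qed.

Let B0 : 0 <= B. Proof. exact: le_trans (phiB 0). Qed.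

(** Compactness of [-L, L] makes the local continuity uniform. For x there, |x / L| is at most 1 <
    pi / 2, so sin (x / L) stays in the open interval (-1, 1), on which [asin] is continuous and
    inverts [sin]. *)
Lemma asin_modulus (e : R) : 0 < e -> exists N : nat, forall x v : R, -L <= x <= L -> -1 <= v <= 1 ->
  `|v - sin (x / L)| <= N.+1%:R^-1 -> `|phi (L * asin v) - phi x| <= e.
Proof.
move=> e0.
have := (compact_near_coveringP `[(- L), L]%classic).1 (@segment_compact R _ _).
move=> /(_ nat \oo (fun N x => forall v, -1 <= v <= 1 ->
  `|v - sin (x / L)| <= N.+1%:R^-1 -> `|phi (L * asin v) - phi x| <= e) _).
case=> [x0 /= x0L|N _ HN]; last first.
  exists N => x v xL v1 h; apply: (HN N) => //=; by rewrite in_itv.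
have e20 : 0 < e / 2 by lra.
pose v0 := sin (x0 / L).
have x0L1 : -1 <= x0 / L <= 1.
  by move: x0L; rewrite in_itv/= ler_pdivrMr// ler_pdivlMr// mul1r mulN1r.
have pi2 : 1 <= pi / 2 :> R by exact: pihalf_ge1.
have pi2' : 1 < pi / 2 :> R.
  rewrite lt_neqAle pi2 andbT; apply/eqP => h.
  by have := @cos1_gt0 R; rewrite h cos_pihalf ltxx.
have gen (r : R) : -1 <= r <= 1 -> - (pi / 2) <= r <= pi / 2 by lra.
have gen' (r : R) : -1 <= r <= 1 -> - (pi / 2) < r < pi / 2 by lra.
have v0E : L * asin v0 = x0.
  rewrite /v0 sinK ?in_itv/= ?gen//.
  by rewrite mulrC divfK// gt_eqF.
have v0lt : -1 < v0 < 1.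
  have sN : sin (- (pi / 2)) = -1 :> R by rewrite sinN sin_pihalf.
  have pm : - (pi / 2) <= (- (pi / 2) : R) <= pi / 2 by lra.
  have pp : - (pi / 2) <= (pi / 2 : R) <= pi / 2 by lra.
  have /andP[a1 a2] := gen' _ x0L1.
  rewrite -{1}sN -[X in _ < _ < X](@sin_pihalf R) /v0.
  by rewrite !ltr_sin ?a1 ?a2 ?in_itv/= ?pm ?pp ?gen.
have c1 : {for v0, continuous (fun v => phi (L * asin v))}.
  apply: continuous_comp; last exact: cphi.
  by apply: cvgM; [exact: cvg_cst|exact: continuous_asin].
have /cvgrPdist_le/(_ _ e20) := c1; rewrite v0E => /nbhs_ballP[d /= d0 Hd].
have d20 : 0 < d / 2 by lra.
have c2 : continuous (fun x : R => sin (x / L)).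
  move=> x; apply: continuous_comp; last exact: continuous_sin.
  by apply: cvgM; [exact: cvg_id|exact: cvg_cst].
have /cvgrPdist_lt/(_ _ d20) A1 := c2 x0.
have /cvgrPdist_le/(_ _ e20) A2 := @cphi x0.
have A3 : \forall N \near \oo, N.+1%:R^-1 < d / 2.
  have := @cvg_harmonic R; move/cvgrPdist_lt => /(_ _ d20).
  by apply: filterS => N /=; rewrite sub0r normrN ger0_norm.
near=> x N => v v1 /= vx.
have h1 : `|v0 - v| < d.
  have a1 : `|v0 - sin (x / L)| < d / 2 by near: x.
  have a3 : N.+1%:R^-1 < d / 2 :> R by near: N.
  rewrite (_ : v0 - v = (v0 - sin (x / L)) - (v - sin (x / L))); last by ring.
  by apply: le_lt_trans (ler_normB _ _) _; rewrite [ltRHS]splitr ltr_leD// (le_trans vx)// ltW.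
have h2 : `|phi x0 - phi (L * asin v)| <= e / 2 by apply: Hd.
have h3 : `|phi x0 - phi x| <= e / 2 by near: x.
rewrite (_ : _ - _ = (phi x0 - phi x) - (phi x0 - phi (L * asin v))); last by ring.
by apply: le_trans (ler_normB _ _) _; rewrite [leRHS]splitr lerD.
Unshelve. all: by end_near.
Qed.

Lemma trig_poly_approx (e : R) : 0 < e ->
  exists n, forall x : R, -L <= x <= L -> `|trig_poly n x - phi x| <= e.
Proof.
move=> e0; have e20 : 0 < e / 2 by lra.
have [N HN] := asin_modulus e20.
have N0 : (0 : R) < N.+1%:R by rewrite ltr0n.
(* Chosen so that the quadratic majorant exceeds the trivial bound 2 B as soon as v is farther than
   1 / (N + 1) from sin (x / L); this distance is twice that of k / n to [trig_var x]. *)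
pose c : R := 8 * B * N.+1%:R ^+ 2.
have c0 : 0 <= c by rewrite /c !mulr_ge0// exprn_ge0// ltW.
have [n hn] : exists n : nat, c / (e / 2) <= n.+1%:R.
  exists (Num.bound (c / (e / 2))); apply: ltW; apply: (lt_trans (archi_boundP _)); last by rewrite ltr_nat.
  by rewrite divr_ge0// ltW.
exists n.+1 => x xL.
apply: (@le_trans _ _ (e / 2 + c / n.+1%:R)); last first.
  by rewrite [leRHS]splitr lerD2l ler_pdivrMr ?ltr0n// mulrC -ler_pdivrMr.
apply: binomial_mean_approx => //; first exact: trig_var01.
move=> k kn; rewrite /trig_grid; set v : R := _ * 2 - 1.
have v1 : -1 <= v <= 1.
  have gen (r : R) : 0 <= r <= 1 -> -1 <= r * 2 - 1 <= 1 by lra.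
  by apply: gen; rewrite divr_ge0//= ler_pdivrMr ?ltr0n// mul1r ler_nat.
have vE : v - sin (x / L) = 2 * (k%:R / n.+1%:R - trig_var x) by rewrite /v /trig_var; field.
have [h|h] := leP `|v - sin (x / L)| N.+1%:R^-1.
  by apply: le_trans (HN _ _ xL v1 h) _; rewrite lerDl mulr_ge0// sqr_ge0.
apply: (@le_trans _ _ (2 * B)).
  by apply: le_trans (ler_normB _ _) _; have := phiB x; have := phiB (L * asin v); lra.
apply: (@le_trans _ _ (c * (k%:R / n.+1%:R - trig_var x) ^+ 2)); last by rewrite lerDr ltW.
set r := k%:R / n.+1%:R - trig_var x in vE *.
rewrite vE normrM ger0_norm// in h.
have h2 : 1 <= (2 * `|r| * N.+1%:R) ^+ 2.
  rewrite expr_ge1 ?mulr_ge0 ?(ltW N0)//.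
  by rewrite -ler_pdivrMr// mul1r ltW.
have -> : c * r ^+ 2 = 2 * B * (2 * `|r| * N.+1%:R) ^+ 2.
  by rewrite /c -(real_normK (num_real r)); ring.
by rewrite ler_peMr// mulr_ge0.
Qed.

End TrigApproximation.

(** * Continuity theorem from countably many frequencies *)

Section Levy.
Context {R : realType}.
Local Notation gam := (@normal_prob R 0 1).
Local Notation "'EG' f" := (\int[gam]_(x in setT) f x) (at level 10, f at level 8).

Let gam1 : gam setT = 1%E. Proof. exact: probability_setT. Qed.

Variable y : nat -> R.
Let A (f : R -> R) j := log_avg (fun k => f (y k)) (@log_index R j).

Lemma log_avg_lin (f g : nat -> R) (a b : R) n :
  log_avg (fun k => a * f k + b * g k) n = a * log_avg f n + b * log_avg g n.
Proof.
rewrite /log_avg; under eq_bigr do rewrite mulrDr.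
by rewrite big_split/= mulrDr; congr (_ + _); rewrite !mulr_sumr; apply: eq_bigr => k _; ring.
Qed.

Definition avg_cvg (f : R -> R) :=
  [/\ bmf (setT : set R) f & log_avg (fun k => f (y k)) (@log_index R j) @[j --> \oo] --> EG f].

Lemma avg_cvg_lin f g a b : avg_cvg f -> avg_cvg g -> avg_cvg (fun x => a * f x + b * g x).
Proof.
move=> [bf cf] [bg cg]; split; first by bmf_auto.
rewrite (EED measurableT gam1); [|by bmf_auto..].
rewrite !(EEZ measurableT gam1)//.
under eq_fun do rewrite (log_avg_lin (fun k => f (y k)) (fun k => g (y k))).
by apply: cvgD; apply: cvgM => //; exact: cvg_cst.
Qed.

Hypothesis Hcos : forall (i q : nat) (a : R),
  log_avg (fun k => cos (i%:R / q.+1%:R * y k + a)) (@log_index R j) @[j --> \oo]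
    --> cos a * expR (- ((i%:R / q.+1%:R) ^+ 2 / 2)).

Lemma avg_cvg_cos (i q : nat) (a : R) : avg_cvg (fun x => cos (i%:R / q.+1%:R * x + a)).
Proof.
split; last by rewrite normal_cos; exact: Hcos.
split; last by exists 1 => x _; exact: cos_max.
apply: continuous_measurable_fun => x.
apply: continuous_comp; last exact: continuous_cos.
by apply: cvgD; [apply: cvgM; [exact: cvg_cst|exact: cvg_id]|exact: cvg_cst].
Qed.

(** The cosine factor makes the induction on the degree possible: one more degree multiplies by
    [trig_var] or its complement, that is by constants and a sine, and sine times cosine is again a
    combination of cosines of the same family. *)
Lemma avg_cvg_binomial q n (g : nat -> R) i a :
  avg_cvg (fun x => binomial_mean (trig_var q x) n g * cos (i%:R / q.+1%:R * x + a)).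
Proof.
elim: n g i a => [|n IH] g i a /=.
  have := avg_cvg_lin (g 0%N) 0 (avg_cvg_cos i q a) (avg_cvg_cos i q a).
  by congr avg_cvg; apply/funext => x; ring.
pose b' x := binomial_mean (trig_var q x) n g; pose b x := binomial_mean (trig_var q x) n (fun k => g k.+1).
have hq : (q.+1%:R : R) != 0 by rewrite pnatr_eq0.
(* Multiplication by sin (x / (q+1)) shifts the frequency i by one in each direction. *)
have prod_step (h : nat -> R) : avg_cvg (fun x => binomial_mean (trig_var q x) n h *
     (sin (x / q.+1%:R) * cos (i%:R / q.+1%:R * x + a))).
  have h1 := IH h i.+1 (a - pi / 2).
  have h2 : avg_cvg (fun x => binomial_mean (trig_var q x) n h *
      cos ((i%:R / q.+1%:R * x + a) - x / q.+1%:R + pi / 2)).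
    (* For i = 0 the lowered frequency is negative; parity of the cosine turns it into 1 and changes
       the sign of the phase. *)
    case: i {h1} => [|i].
      have := IH h 1%N (- a - pi / 2); congr avg_cvg; apply/funext => x; congr (_ * _).
      by rewrite -[RHS]cosN; congr cos; rewrite mul0r; field; rewrite nat1r hq.
    have := IH h i (a + pi / 2); congr avg_cvg; apply/funext => x; congr (_ * cos _).
    by rewrite -[i.+1%:R]natr1; field; rewrite nat1r hq.
  have := avg_cvg_lin (2^-1) (2^-1) h1 h2; congr avg_cvg; apply/funext => x.
  set m := binomial_mean _ _ _.
  have -> : i.+1%:R / q.+1%:R * x + (a - pi / 2) = (i%:R / q.+1%:R * x + a) + x / q.+1%:R - pi / 2.
    by rewrite -[i.+1%:R]natr1; field; rewrite nat1r hq.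
  rewrite cosBpihalf cosDpihalf.
  set u := i%:R / _ * x + a; set v := x / _.
  by rewrite sinD sinB; field.
have s1 := prod_step g; have s2 := prod_step (fun k => g k.+1).
have := avg_cvg_lin 1 1 (avg_cvg_lin (2^-1) (- 2^-1) (IH g i a) s1)
  (avg_cvg_lin (2^-1) (2^-1) (IH (fun k => g k.+1) i a) s2).
congr avg_cvg; apply/funext => x; rewrite {1 2 5 7}/trig_var; by field.
Qed.

Hypothesis Htight : forall e : R, 0 < e -> exists L : R, \forall j \near \oo,
  log_avg (fun k => \1_[set z | L < `|z|] (y k)) (@log_index R j) <= e.

(** A trigonometric polynomial [p] is close to [phi] on [-(q+1), q+1]. Outside, both are bounded by
    [B], and the mass there is small for the averages, by [Htight], and for the normal law. *)
Lemma levy (phi : R -> R) (B : R) : continuous phi -> (forall x, `|phi x| <= B) ->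
  log_avg (fun k => phi (y k)) n @[n --> \oo] --> EG phi.
Proof.
move=> cphi phiB.
have B0 : 0 <= B by apply: le_trans (phiB 0).
apply: (@log_avg_interpolate _ _ B) => //.
have bphi : bmf (setT : set R) phi.
  by split; [exact: continuous_measurable_fun|exists B => x _].
apply/cvgrPdist_le => e e0.
(* The errors add up to [e1 * (3 + 4 * B)]: one for the convergence of [p], and [e1 + 2 * B * e1]
   for replacing [phi] by [p] on either side. *)
pose e1 : R := e / (4 + 4 * B).
have den0 : 0 < 4 + 4 * B by lra.
have e10 : 0 < e1 by rewrite divr_gt0.
have [L1 tight1] := Htight e10.
have [L2 tight2] := normal_tail e10.
pose q := (Num.bound `|L1| + L2)%N.
have qL1 : L1 <= q.+1%:R.
  apply: le_trans (ler_norm _) _; apply/ltW/(lt_le_trans (archi_boundP _)) => //.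
  by rewrite ler_nat /q leqW// leq_addr.
have qL2 : L2%:R <= q.+1%:R :> R by rewrite ler_nat /q leqW// leq_addl.
have [n Hn] := trig_poly_approx cphi phiB q e10.
pose p := trig_poly phi q n.
have [bp cp] : avg_cvg p.
  have := avg_cvg_binomial q n (trig_grid phi q n) 0 0.
  congr avg_cvg; apply/funext => x; rewrite /p /trig_poly mul0r mul0r addr0 cos0 mulr1//.
have pphi (L : R) x : L <= q.+1%:R -> `|p x - phi x| <= e1 + 2 * B * \1_[set z | L < `|z|] x.
  move=> Lq; rewrite indicE; have [Lx|xL] := ltP L `|x|.
    rewrite mem_set// mulr1; apply: le_trans (ler_normB _ _) _.
    by have := trig_poly_le phiB q n x; have := phiB x; rewrite -/p; lra.
  rewrite memNset ?mulr0 ?addr0; last by apply/negP; rewrite -leNgt.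
  by apply: Hn; rewrite -ler_norml; exact: le_trans Lq.
have d2 : `|EG p - EG phi| <= e1 + 2 * B * e1.
  have mI : measurable [set z : R | L2%:R < `|z|].
    have -> : [set z : R | L2%:R < `|z|] = ~` `[(- L2%:R), L2%:R]%classic.
      apply/seteqP; split => x; rewrite /= in_itv/= -ler_norml.
        by move=> nx; apply/negP; rewrite -ltNge.
      by move/negP; rewrite -ltNge.
    exact: measurableC.
  have bI : bmf (setT : set R) (\1_[set z : R | L2%:R < `|z|] : R -> R).
    split; first exact: measurable_indic.
    by exists 1 => x _; rewrite indicE; case: (_ \in _); rewrite ?normr1 ?normr0.
  rewrite -(EEB measurableT gam1)//.
  apply: le_trans (le_normr_Rintegral measurableT _) _.
    by apply: (bmf_integrable measurableT gam1); bmf_auto.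
  apply: (@le_trans _ _ (EG (fun x => e1 + 2 * B * \1_[set z : R | L2%:R < `|z|] x))).
    by apply: (EE_le measurableT gam1); [bmf_auto|bmf_auto|move=> x _; exact: pphi].
  rewrite (EED measurableT gam1); [|by bmf_auto..].
  rewrite (EE_cst measurableT gam1) (EEZ measurableT gam1)// lerD2l ler_wpM2l ?mulr_ge0//.
have /cvgrPdist_le/(_ _ e10) near1 := cp.
near=> j.
have h1 : `|EG p - log_avg (fun k => p (y k)) (@log_index R j)| <= e1 by near: j.
have h2 : log_avg (fun k => \1_[set z | L1 < `|z|] (y k)) (@log_index R j) <= e1 by near: j.
have h3 : `|log_avg (fun k => p (y k)) (@log_index R j) - log_avg (fun k => phi (y k)) (@log_index R j)|
    <= e1 + 2 * B * e1.
  have Hj : 0 < @Hsum R (@log_index R j).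
    by apply: lt_le_trans (log_index_ge j); rewrite exprn_gt0// ltr0n.
  have -> : log_avg (fun k => p (y k)) (@log_index R j) - log_avg (fun k => phi (y k)) (@log_index R j) =
     log_avg (fun k => p (y k) - phi (y k)) (@log_index R j).
    have := log_avg_lin (fun k => p (y k)) (fun k => phi (y k)) 1 (-1) (@log_index R j).
    rewrite mul1r mulN1r => <-; congr log_avg; apply/funext => k; ring.
  apply: (@le_trans _ _ (log_avg (fun k => e1 * 1 + 2 * B * \1_[set z | L1 < `|z|] (y k)) (@log_index R j))).
    rewrite /log_avg normrM ger0_norm ?invr_ge0 ?(ltW Hj)// ler_pM2l ?invr_gt0//.
    apply: le_trans (ler_norm_sum _ _ _) _; apply: ler_sum => k _.
    by rewrite normrM ger0_norm ?invr_ge0// ler_wpM2l ?invr_ge0// mulr1; exact: pphi.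
  rewrite (log_avg_lin (fun=> 1)) lerD//; last by rewrite ler_wpM2l ?mulr_ge0.
  rewrite /log_avg; under eq_bigr do rewrite mulr1.
  by rewrite -/(Hsum _) mulVf ?mulr1// gt_eqF.
rewrite (_ : EG phi - _ = (EG p - log_avg (fun k => p (y k)) (@log_index R j)) - (EG p - EG phi)
  + (log_avg (fun k => p (y k)) (@log_index R j) - log_avg (fun k => phi (y k)) (@log_index R j))); last by ring.
apply: le_trans (ler_normD _ _) _; apply: le_trans (lerD (ler_normB _ _) (lexx _)) _.
apply: le_trans (lerD (lerD h1 d2) h3) _.
have -> : e1 + (e1 + 2 * B * e1) + (e1 + 2 * B * e1) = e1 * (3 + 4 * B) by ring.
by rewrite /e1 -mulrA ler_piMr ?(ltW e0)// mulrC ler_pdivrMr// mul1r lerD2r ler_nat.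
Unshelve. all: by end_near.
Qed.

End Levy.

(** * The almost sure central limit theorem for mixing sequences *)

Section DirichletKernel.
Context {R : realType}.

Lemma sum_cos_dirichlet (al : R) m :
  2 * sin (al / 2) * \sum_(0 <= i < m) cos (i.+1%:R * al) =
  sin (m%:R * al + al / 2) - sin (al / 2).
Proof.
elim: m => [|m IH]; first by rewrite big_geq// mulr0 mul0r add0r subrr.
rewrite big_nat_recr//= mulrDr IH.
have -> : m%:R * al + al / 2 = m.+1%:R * al - al / 2 by rewrite -natr1; field.
by rewrite sinB sinD; ring.
Qed.

Lemma sin_ge_half (u : R) : `|u| <= 2^-1 -> `|u| / 2 <= `|sin u|.
Proof.
move=> u2; have := sinB_le3 u.
have : `|u| ^+ 3 <= `|u| / 2.
  have : 0 <= `|u| by []. by set v : R := `|u| in u2 *; nra.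
have : `|u| <= `|sin u| + `|sin u - u|.
  by rewrite -[X in `|X| <= _](subKr (sin u)); exact: ler_normB.
lra.
Qed.

(** The condition [|y| <= m] keeps the angle al = dl y / m within [-1, 1], where |sin (al / 2)| is
    at least |al| / 4. The Dirichlet sum is then at most 4 / |al|, and dl |y| > 8 makes this at most
    m / 2. *)
Lemma cos_avg_le_half (m : nat) (dl y : R) : (0 < m)%N -> 0 < dl <= 1 -> `|y| <= m%:R ->
  8 / dl < `|y| -> m%:R^-1 * \sum_(0 <= i < m) cos (i.+1%:R * dl / m%:R * y) <= 2^-1.
Proof.
move=> m0 /andP[d0 d1] ym yd.
have m0' : (0 : R) < m%:R by rewrite ltr0n.
have y0 : 0 < `|y| by apply: lt_trans yd; rewrite divr_gt0.
pose al := dl * y / m%:R.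
have alE : `|al| = dl * `|y| / m%:R.
  by rewrite /al !normrM normfV (gtr0_norm d0) (gtr0_norm m0').
have al0 : 0 < `|al| by rewrite alE divr_gt0// mulr_gt0.
have al1 : `|al| <= 1.
  by rewrite alE ler_pdivrMr// mul1r; apply: le_trans ym; rewrite ler_piMl.
have h1 : `|al| / 4 <= `|sin (al / 2)|.
  have a2 : `|al / 2| = `|al| / 2 by rewrite normrM [`|2^-1|]ger0_norm.
  have := @sin_ge_half (al / 2); rewrite a2 => H.
  by apply: le_trans (H _); lra.
set S := \sum_(0 <= i < m) _.
have SE : S = \sum_(0 <= i < m) cos (i.+1%:R * al).
  by apply: eq_bigr => i _; rewrite /al; congr cos; ring.
have h2 : `|al| / 2 * `|S| <= 2.
  have e := sum_cos_dirichlet al m; rewrite -SE in e.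
  have : `|2 * sin (al / 2) * S| <= 2.
    rewrite e; apply: le_trans (ler_normB _ _) _.
    by have := sin_max (m%:R * al + al / 2); have := sin_max (al / 2); lra.
  rewrite (normrM (2 * _)) (normrM 2) (ger0_norm (_ : 0 <= 2))//; apply: le_trans.
  by rewrite ler_wpM2r//; lra.
have h3 : `|S| <= 2^-1 * m%:R.
  have h4 : 8 <= `|al| * m%:R.
    rewrite alE divfK ?gt_eqF//.
    by apply/ltW; rewrite mulrC -ltr_pdivrMr.
  have S0 : 0 <= `|S| by [].
  rewrite -(ler_pM2l al0).
  have : `|al| * `|S| <= 4 by lra.
  by lra.
rewrite mulrC ler_pdivrMr//; exact: le_trans (ler_norm _) h3.
Qed.

End DirichletKernel.

Section AlmostSureCLT.
Context d (Om : measurableType d) (R : realType) (mu : {measure set Om -> \bar R}).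
Context (D : set Om) (mD : measurable D) (muD : mu D = 1%E).
Context (X : nat -> Om -> R) (Fut : nat -> (Om -> R) -> Prop) (B K theta : R).
Context (mix : mixing_seq mu D X Fut B K theta).
Context (sg : nat -> R) (cs : R) (cs0 : 0 < cs).
Context (sg_ge : forall k, (1 <= k)%N -> cs * Num.sqrt k%:R <= sg k).

Local Notation "'EE' f" := (\int[mu]_(x in D) f x) (at level 10, f at level 8).
Local Notation Y := (normalized_sum X sg).
Local Notation nj := (@log_index R).

Context (sgE : forall k, (1 <= k)%N -> sg k ^+ 2 = EE (fun x => (\sum_(0 <= j < k) X j x) ^+ 2)).

Let Hj0 j : 0 < @Hsum R (nj j).
Proof. by apply: lt_le_trans (log_index_ge j); rewrite exprn_gt0// ltr0n. Qed.

Lemma EE_log_cos_dev_le (t0 t a : R) n : 0 <= t0 -> `|t| <= t0 ->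
  EE (fun x => (\sum_(1 <= k < n.+1) k%:R^-1 * cos_dev X sg t a k x) ^+ 2)
    <= 12 * dev_const B K theta cs t0 * Hsum n.
Proof.
move=> t00 tt; apply: EE_log_sum_le => //.
(* Nonnegativity of [dev_const] is read off the estimate at k = l = 1. *)
- have := EE_cos_dev_le mD muD mix cs0 sg_ge sgE t00 a (isT : (1 <= 1 <= 1)%N) tt.
  move=> /(le_trans (normr_ge0 _)); rewrite sqrtr1 divr1 invr1 => h.
  by rewrite -(pmulr_lge0 _ (_ : (0 : R) < 1 + 1)).
- by move=> k; exact: (bmf_cos_dev mix).
- by move=> k l kl; exact: (EE_cos_dev_le mD muD mix cs0 sg_ge sgE t00).
Qed.

Let C0 := 12 * dev_const B K theta cs.

Lemma EE_sqr_normalized_le (z : Om -> R) (C : R) j : bmf D z ->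
  EE (fun x => z x ^+ 2) <= C * Hsum (nj j) ->
  EE (fun x => ((Hsum (nj j))^-1 * z x) ^+ 2) <= C / j.+1%:R ^+ 2.
Proof.
move=> bz zC; have H0 := Hj0 j.
have -> : EE (fun x => ((Hsum (nj j))^-1 * z x) ^+ 2) = (Hsum (nj j) ^+ 2)^-1 * EE (fun x => z x ^+ 2).
  by rewrite -(EEZ mD muD); [apply: EE_ext => x _; rewrite exprMn exprVn|bmf_auto].
have z0 : 0 <= EE (fun x => z x ^+ 2) by apply: Rintegral_ge0 => x _; exact: sqr_ge0.
have Cp : 0 <= C by rewrite -(pmulr_lge0 _ H0); exact: le_trans zC.
apply: (@le_trans _ _ ((Hsum (nj j) ^+ 2)^-1 * (C * Hsum (nj j)))).
  by rewrite ler_wpM2l// invr_ge0 sqr_ge0.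
have -> : (Hsum (nj j) ^+ 2)^-1 * (C * Hsum (nj j)) = C * (Hsum (nj j))^-1 by field; rewrite gt_eqF.
by rewrite ler_wpM2l// lef_pV2 ?posrE ?log_index_ge// exprn_gt0// ltr0n.
Qed.

Lemma ae_log_avg_cos (t a : R) : {ae mu, forall x, D x ->
  log_avg (fun k => cos (t * Y k x + a)) (nj j) @[j --> \oo] --> cos a * expR (- (t ^+ 2 / 2))}.
Proof.
have bdev k := bmf_cos_dev mix sg t a k.
pose g j x := (Hsum (nj j))^-1 * \sum_(1 <= k < (nj j).+1) k%:R^-1 * cos_dev X sg t a k x.
have bg j : bmf D (g j) by rewrite /g; bmf_auto.
have gC j : EE (fun x => g j x ^+ 2) <= 12 * dev_const B K theta cs `|t| / j.+1%:R ^+ 2.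
  by apply: EE_sqr_normalized_le; [bmf_auto|exact: EE_log_cos_dev_le].
apply: filterS (ae_cvg0_of_moment2 mD muD bg gC) => x gx Dx.
have {}gx := gx Dx.
set l := cos a * _.
have -> : (fun j => log_avg (fun k => cos (t * Y k x + a)) (nj j)) = (fun j => g j x + l).
  apply/funext => j; rewrite /g /log_avg /cos_dev -/l.
  under [in RHS]eq_bigr do rewrite mulrBr.
  rewrite sumrB -mulr_suml -/(Hsum (nj j)) mulrBr mulrA mulVf ?gt_eqF//.
  by rewrite mul1r subrK.
by rewrite -[X in _ --> X]add0r; apply: cvgD => //; exact: cvg_cst.
Qed.

Lemma normalized_sum_le k x : D x -> `|Y k x| <= B / cs * k%:R \/ k = 0%N.
Proof.
case: k => [|k] Dx; [by right|left].
have s1 : 1 <= Num.sqrt k.+1%:R :> R by rewrite -[leLHS]sqrtr1 ler_wsqrtr ?ler1n.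
have s0 : cs <= sg k.+1 by apply: le_trans (sg_ge _) => //; rewrite ler_peMr// ltW.
have sg0 : 0 < sg k.+1 by apply: lt_le_trans s0.
rewrite /normalized_sum normrM normfV (gtr0_norm sg0) mulrAC.
have BB := mix_B mix.
apply: ler_pM => //; [by rewrite invr_ge0 ltW| |by rewrite lef_pV2].
apply: le_trans (ler_norm_sum _ _ _) _.
apply: (@le_trans _ _ (\sum_(0 <= j < k.+1) B)); first by apply: ler_sum => j _; exact: (mix_bound mix).
by rewrite sumr_const_nat subn0 mulr_natr.
Qed.

(** A number of frequencies exceeding every |Y_k| with k up to [nj j], as [cos_avg_le_half]
    requires; the crude bound |S_k| <= B k suffices, because the size of the grid does not enter the
    moment bounds. *)
Let mj j := (Num.bound (B / cs * (nj j)%:R)).+1.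

(* The averages of [1 - cos (t y)] over a grid of small frequencies [t] dominate
   the indicator of [8 / dl < |y|]. *)
Lemma ae_tight (p : nat) : {ae mu, forall x, D x ->
  \forall j \near \oo, log_avg (fun k => \1_[set z : R | 8 * p.+1%:R < `|z|] (Y k x) : R) (nj j)
     <= 2 / p.+1%:R ^+ 2}.
Proof.
pose dl : R := p.+1%:R^-1.
have dl0 : 0 < dl by rewrite invr_gt0 ltr0n.
have dl1 : dl <= 1 by rewrite invf_le1 ?ltr0n// ler1n.
pose tt j i : R := i.+1%:R * dl / (mj j)%:R.
have m0 j : (0 : R) < (mj j)%:R by rewrite ltr0n.
have tt1 j i : (i < mj j)%N -> `|tt j i| <= 1.
  move=> im; rewrite ger0_norm; last by rewrite !mulr_ge0 ?invr_ge0// ltW.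
  rewrite ler_pdivrMr// mul1r; apply: (@le_trans _ _ i.+1%:R); last by rewrite ler_nat.
  by rewrite ler_piMr.
have bdev j i k := bmf_cos_dev mix sg (tt j i) 0 k.
pose V j k x := (mj j)%:R^-1 * \sum_(0 <= i < mj j) cos_dev X sg (tt j i) 0 k x.
pose g j x := (Hsum (nj j))^-1 * \sum_(1 <= k < (nj j).+1) k%:R^-1 * V j k x.
have bg j : bmf D (g j) by rewrite /g /V; bmf_auto.
have Cp : 0 <= 12 * dev_const B K theta cs 1.
  have := @EE_log_cos_dev_le 1 1 0 1%N ler01.
  rewrite normr1 lexx => /(_ isT); rewrite /Hsum big_nat1 invr1 mulr1; apply: le_trans.
  by apply: Rintegral_ge0 => x _; exact: sqr_ge0.
have gC j : EE (fun x => g j x ^+ 2) <= 12 * dev_const B K theta cs 1 / j.+1%:R ^+ 2.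
  apply: EE_sqr_normalized_le; first by rewrite /V; bmf_auto.
  apply: EE_avg_log_sum_le => //.
    by rewrite mulr_ge0// Hsum_ge0.
  by move=> i im; apply: EE_log_cos_dev_le => //; exact: tt1.
apply: filterS (ae_cvg0_of_moment2 mD muD bg gC) => x gx Dx.
have e0 : 0 < dl ^+ 2 / 2 by rewrite divr_gt0// exprn_gt0.
have /cvgrPdist_le/(_ _ e0) := gx Dx.
apply: filterS => j; rewrite sub0r normrN => gj.
(* The frequencies are at most [dl], so exp(- t^2 / 2) is at least 1 - dl^2 / 2 and [V j k x] is at
   most Sc - 1 + dl^2 / 2, where Sc is the mean of the cosines. Hence the right-hand side is at
   least 2 (1 - Sc): always nonnegative, and at least 1 when Sc is at most 1/2. *)
have pw k : (1 <= k <= nj j)%N ->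
    \1_[set z : R | 8 * p.+1%:R < `|z|] (Y k x) <= dl ^+ 2 - 2 * V j k x :> R.
  move=> /andP[k1 kn].
  have Ym : `|Y k x| <= (mj j)%:R.
    case: (normalized_sum_le k Dx) => [h|k0]; last by rewrite k0 in k1.
    apply: le_trans h _; apply: (@le_trans _ _ (B / cs * (nj j)%:R)).
      by rewrite ler_wpM2l ?ler_nat// divr_ge0 ?(mix_B mix)// ltW.
    rewrite /mj -natr1; apply: (@le_trans _ _ (Num.bound (B / cs * (nj j)%:R))%:R); last by rewrite lerDl.
    by apply/ltW/archi_boundP; rewrite mulr_ge0// divr_ge0 ?(mix_B mix)// ltW.
  set Sc := (mj j)%:R^-1 * \sum_(0 <= i < mj j) cos (tt j i * Y k x).
  have Vge : V j k x <= Sc - 1 + dl ^+ 2 / 2.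
    have -> : Sc - 1 + dl ^+ 2 / 2 = (mj j)%:R^-1 * \sum_(0 <= i < mj j) (cos (tt j i * Y k x) - (1 - dl ^+ 2 / 2)).
      rewrite sumrB mulrBr -/Sc sumr_const_nat subn0 -(mulr_natl (1 - dl ^+ 2 / 2) (mj j)) mulrA mulVf ?gt_eqF//.
      by ring.
    rewrite ler_pM2l ?invr_gt0//.
    rewrite big_nat [leRHS]big_nat; apply: ler_sum => i /andP[_ im].
    rewrite /cos_dev addr0 cos0 mul1r lerD2l lerN2.
    apply: le_trans (expR_ge1Dx _).
    rewrite lerD2l lerN2 ler_pM2r ?invr_gt0// lerXn2r ?nnegrE ?(ltW dl0)//.
      by rewrite !mulr_ge0 ?invr_ge0// ltW.
    rewrite /tt ler_pdivrMr// mulrC ler_pM2l// ler_nat.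
    exact: im.
  rewrite indicE; have [h|h] := ltP (8 * p.+1%:R) `|Y k x|.
    rewrite mem_set//.
    have : Sc <= 2^-1.
      apply: cos_avg_le_half => //; first by rewrite dl0.
      by rewrite /dl invrK.
    by move: Vge; set V0 := V j k x; set e := dl ^+ 2; move=> ? ?; rewrite /=; lra.
  rewrite memNset/=; last by apply/negP; rewrite -leNgt.
  have : Sc <= 1.
    rewrite /Sc mulrC ler_pdivrMr// mul1r.
    apply: (@le_trans _ _ (\sum_(0 <= i < mj j) 1)); first by apply: ler_sum => i _; exact: cos_le1.
    by rewrite sumr_const_nat subn0.
  by lra.
apply: (@le_trans _ _ (log_avg (fun k => dl ^+ 2 * 1 + (- 2) * V j k x) (nj j))).
  rewrite /log_avg ler_pM2l ?invr_gt0//.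
  rewrite big_nat [leRHS]big_nat; apply: ler_sum => k /andP[k1 kn].
  rewrite ler_wpM2l ?invr_ge0// mulr1 mulNr; apply: pw.
  by rewrite k1.
rewrite (log_avg_lin (fun=> 1) (fun k => V j k x)).
have -> : log_avg (fun=> 1) (nj j) = 1 :> R.
  rewrite /log_avg; under eq_bigr do rewrite mulr1.
  by rewrite -/(Hsum _) mulVf ?gt_eqF.
rewrite -[log_avg _ _]/(g j x) mulr1.
have -> : 2 / p.+1%:R ^+ 2 = 2 * dl ^+ 2 by rewrite /dl exprVn.
move: gj; rewrite ler_norml => /andP[gj _].
by move: gj; set e := dl ^+ 2; lra.
Qed.

Theorem ae_clt_log_avg : {ae mu, forall x, D x ->
  forall (phi : R -> R), continuous phi -> (exists B : R, forall z, `|phi z| <= B) ->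
  log_avg (fun k => phi (Y k x)) n @[n --> \oo] --> \int[normal_prob 0 1]_z phi z}.
Proof.
(* Phases form an uncountable family, but cos(u + a) = cos a cos u + sin a cos(u + pi/2), so the
   phases 0 and pi/2 suffice. *)
have A1 : {ae mu, forall x, forall i q : nat, D x ->
  log_avg (fun k => cos (i%:R / q.+1%:R * Y k x + 0)) (nj j) @[j --> \oo]
    --> cos 0 * expR (- ((i%:R / q.+1%:R) ^+ 2 / 2))}.
  by apply: ae_foralln => i; apply: ae_foralln => q; exact: ae_log_avg_cos.
have A2 : {ae mu, forall x, forall i q : nat, D x ->
  log_avg (fun k => cos (i%:R / q.+1%:R * Y k x + pi / 2)) (nj j) @[j --> \oo]
    --> cos (pi / 2) * expR (- ((i%:R / q.+1%:R) ^+ 2 / 2))}.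
  by apply: ae_foralln => i; apply: ae_foralln => q; exact: ae_log_avg_cos.
have A3 : {ae mu, forall x, forall p : nat, D x ->
  \forall j \near \oo, log_avg (fun k => \1_[set z : R | 8 * p.+1%:R < `|z|] (Y k x) : R) (nj j)
     <= 2 / p.+1%:R ^+ 2}.
  by apply: ae_foralln => p; exact: ae_tight.
apply: filterS3 A1 A2 A3 => x h1 h2 h3 Dx phi cphi [C phiC].
apply: levy cphi phiC.
- move=> i q a; set t := i%:R / q.+1%:R.
  have -> : cos a * expR (- (t ^+ 2 / 2)) = cos a * (cos 0 * expR (- (t ^+ 2 / 2)))
    + sin a * (cos (pi / 2) * expR (- (t ^+ 2 / 2))).
    by rewrite cos0 cos_pihalf; ring.
  have -> : (fun j => log_avg (fun k => cos (t * Y k x + a)) (nj j)) = (fun j =>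
      cos a * log_avg (fun k => cos (t * Y k x + 0)) (nj j)
      + sin a * log_avg (fun k => cos (t * Y k x + pi / 2)) (nj j)).
    apply/funext => j; rewrite -log_avg_lin; congr log_avg; apply/funext => k.
    by rewrite addr0 cosDpihalf cosD; ring.
  by apply: cvgD; apply: cvgM; [exact: cvg_cst|exact: h1|exact: cvg_cst|exact: h2].
- move=> e e0.
  pose p := Num.bound (2 / e).
  exists (8 * p.+1%:R); apply: filterS (h3 p Dx) => j /le_trans; apply.
  have p0 : (0 : R) < p.+1%:R by rewrite ltr0n.
  rewrite ler_pdivrMr ?exprn_gt0// mulrC -ler_pdivrMr//.
  apply: (@le_trans _ _ p.+1%:R); last by rewrite ler_eXnr ?ler1n.
  apply: (@le_trans _ _ p%:R); last by rewrite ler_nat.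
  by apply/ltW/archi_boundP; rewrite divr_ge0// ltW.
Qed.

End AlmostSureCLT.

(** * Functions of bounded variation *)

Section AlmostEverywhereIntegrals.
Context d (T : measurableType d) (R : realType) (mu : {measure set T -> \bar R}) (D : set T) (mD : measurable D).
Implicit Types u v : T -> R.
Local Notation L1 u := (mu.-integrable D (EFin \o u)).
Lemma ae_inS (P Q : T -> Prop) : (forall x, D x -> P x -> Q x) -> {ae mu, forall x, D x -> P x} -> {ae mu, forall x, D x -> Q x}.
Proof. by move=> PQ; apply: filterS => x Px Dx; apply: PQ => //; exact: Px. Qed.
Lemma ae_inS2 (P Q S : T -> Prop) : (forall x, D x -> P x -> Q x -> S x) ->
  {ae mu, forall x, D x -> P x} -> {ae mu, forall x, D x -> Q x} -> {ae mu, forall x, D x -> S x}.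
Proof. by move=> PQ; apply: filterS2 => x Px Qx Dx; apply: PQ => //; [exact: Px|exact: Qx]. Qed.
Lemma integrable_EFinD u v : L1 u -> L1 v -> L1 (fun x => u x + v x).
Proof.
by move=> u1 v1; exact: (integrableD mD u1 v1).
Qed.
Lemma integrable_EFinZ (c : R) u : L1 u -> L1 (fun x => c * u x).
Proof.
by move=> u1; exact: (integrableZl mD c u1).
Qed.
Lemma integrable_EFin_norm u : L1 u -> L1 (fun x => `|u x|).
Proof. by move=> u1; exact: (integrable_abse u1). Qed.
Lemma integrable_ae_le u v : measurable_fun D u -> L1 v -> {ae mu, forall x, D x -> `|u x| <= v x} ->
  L1 u /\ \int[mu]_(x in D) `|u x| <= \int[mu]_(x in D) v x.
Proof.
move=> mu0 iv uv.
have mu' : measurable_fun D (fun x => (`|u x|)%:E).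
  by apply/measurable_EFinP; apply: measurableT_comp.
have mv : measurable_fun D v by apply/measurable_EFinP; exact: measurable_int iv.
have mv' : measurable_fun D (fun x => (`|v x|)%:E).
  by apply/measurable_EFinP; apply: measurableT_comp.
have le : (\int[mu]_(x in D) (`|u x|)%:E <= \int[mu]_(x in D) (`|v x|)%:E)%E.
  apply: (ae_ge0_le_integral mD) => //.
  by apply: ae_inS uv => x Ix h; rewrite lee_fin (le_trans h)// ler_norm.
have iu : L1 u.
  apply/integrableP; split; first exact/measurable_EFinP.
  by apply: le_lt_trans le _; case/integrableP: iv.
split => //.
have vv : (\int[mu]_(x in D) (`|v x|)%:E = \int[mu]_(x in D) (v x)%:E)%E.
  apply: ae_eq_integral => //.
  - exact: measurable_int iv.
  - by apply: ae_inS uv => x Ix h; rewrite ger0_norm// (le_trans _ h).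
rewrite vv in le.
apply: fine_le => //.
- by apply: integrable_fin_num => //; exact: (integrable_abse iu).
- by apply: integrable_fin_num => //; exact: iv.
Qed.
Lemma RintegralZ_EFin (c : R) u : L1 u -> \int[mu]_(x in D) (c * u x) = c * \int[mu]_(x in D) u x.
Proof. by move=> u1; rewrite RintegralZl. Qed.

End AlmostEverywhereIntegrals.

Section BoundedVariation.
Context {R : realType}.
Local Notation m := (@lebesgue_measure R).
Implicit Types (f g u v : R -> R).

Lemma measurable_I01 : measurable (I01 : set (measurableTypeR R)).
Proof. exact: measurable_itv. Qed.

Lemma lebesgue_I01 : m (I01 : set R) = 1%E.
Proof. by rewrite lebesgue_measure_itv/= lte01 oppr0 adde0. Qed.

Local Notation mI := measurable_I01.
Local Notation EE f := (\int[m]_(x in I01) f x).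

Lemma ae01W (P : R -> Prop) : (forall x, I01 x -> P x) -> ae01 P.
Proof. by move=> H; apply: aeW => x; exact: H. Qed.

Lemma ae01S (P Q : R -> Prop) : (forall x, I01 x -> P x -> Q x) -> ae01 P -> ae01 Q.
Proof. exact: (@ae_inS _ (measurableTypeR R) R m I01 P Q). Qed.

Lemma ae01S2 (P Q S : R -> Prop) : (forall x, I01 x -> P x -> Q x -> S x) ->
  ae01 P -> ae01 Q -> ae01 S.
Proof. exact: (@ae_inS2 _ (measurableTypeR R) R m I01 P Q S). Qed.

Lemma in_L1_bmf u : bmf (I01 : set (measurableTypeR R)) u -> in_L1 u.
Proof. exact: (bmf_integrable mI lebesgue_I01). Qed.

Lemma in_L1_norm u : in_L1 u -> in_L1 (fun x => `|u x|).
Proof. exact: integrable_EFin_norm. Qed.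

Lemma in_L1_D u v : in_L1 u -> in_L1 v -> in_L1 (fun x => u x + v x).
Proof. exact: (integrable_EFinD mI). Qed.

Lemma in_L1_Z (c : R) u : in_L1 u -> in_L1 (fun x => c * u x).
Proof. exact: (integrable_EFinZ mI). Qed.

Lemma int01D u v : in_L1 u -> in_L1 v -> EE (fun x => u x + v x) = EE u + EE v.
Proof. exact: (RintegralD mI). Qed.

Lemma int01B u v : in_L1 u -> in_L1 v -> EE (fun x => u x - v x) = EE u - EE v.
Proof. exact: (RintegralB mI). Qed.

Lemma int01Z (c : R) u : in_L1 u -> EE (fun x => c * u x) = c * EE u.
Proof. exact: (RintegralZ_EFin mI). Qed.

Lemma int01_cst (c : R) : EE (fun=> c) = c.
Proof. exact: (EE_cst mI lebesgue_I01). Qed.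

Lemma in_L1_ae_le u v : measurable_fun (I01 : set R) u -> in_L1 v ->
  ae01 (fun x => `|u x| <= v x) -> in_L1 u /\ EE (fun x => `|u x|) <= EE v.
Proof. exact: (integrable_ae_le mI). Qed.

(** One comparison of increments covers products, differences and Lipschitz functions, according to
    the choice of [g], [g'] and the coefficients. *)
Lemma total_variation_comb (h g g' : R -> R) (A A' V V' : R) : 0 <= A -> 0 <= A' ->
  (total_variation 0 1 g <= V%:E)%E -> (total_variation 0 1 g' <= V'%:E)%E ->
  (forall x y, I01 x -> I01 y -> `|h x - h y| <= A * `|g x - g y| + A' * `|g' x - g' y|) ->
  (total_variation 0 1 h <= (A * V + A' * V')%:E)%E.
Proof.
move=> A0 A'0 gV gV' hgg'; apply: ge_ereal_sup => _ [_ [s ps <-] <-].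
(* Beyond the end of the list [nth] returns its default 1, which still lies in [I01]. *)
have inI n : I01 (nth 1 (0 :: s) n).
  rewrite /= in_itv/=; case: (ltnP n (size (0 :: s))) => [|ns]; last first.
    by rewrite nth_default// lexx ler01.
  case: n => [|n] /= ns; first by rewrite lexx ler01.
  by have := itv_partition_nth_ge ns ps; have := itv_partition_nth_le ns ps => /= -> ->.
rewrite lee_fin.
have vg : variation 0 1 g s <= V.
  by rewrite -lee_fin; apply: le_trans gV; apply: ereal_sup_ubound; exists (variation 0 1 g s) => //; exists s.
have vg' : variation 0 1 g' s <= V'.
  by rewrite -lee_fin; apply: le_trans gV'; apply: ereal_sup_ubound; exists (variation 0 1 g' s) => //; exists s.
apply: (@le_trans _ _ (A * variation 0 1 g s + A' * variation 0 1 g' s)); last first.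
  by rewrite lerD// ler_wpM2l.
rewrite /variation !mulr_sumr -big_split/=; apply: ler_sum => n _.
by apply: hgg'; [exact: (inI n.+1)|exact: (inI n)].
Qed.

Lemma total_variation_dist g (V : R) x y : (total_variation 0 1 g <= V%:E)%E ->
  I01 x -> I01 y -> `|g x - g y| <= V.
Proof.
wlog xy : x y / x <= y => [H gV Ix Iy|].
  have [xy|/ltW yx] := leP x y; first exact: H.
  by rewrite distrC; exact: H.
move=> gV; rewrite /= !in_itv/= => /andP[x0 x1] /andP[y0 y1].
rewrite -lee_fin; apply: le_trans gV.
rewrite (@total_variationD R 0 1 x)// (@total_variationD R x 1 y)//.
rewrite distrC; apply: le_trans (total_variation_ge g xy) _.
apply: le_trans (leeDr _ (total_variation_ge0 g x0)).
exact: (leeDl _ (total_variation_ge0 g y1)).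
Qed.

(* [BVle f b] bounds the BV norm of [f] by [b], with a witness for the infimum
   over representatives in the definition of the essential variation. *)
Definition BVle f (b : R) := in_L1 f /\ exists g (V : R),
  [/\ ae01 (fun x => g x = f x), (total_variation 0 1 g <= V%:E)%E &
      V + EE (fun x => `|f x|) <= b].

Lemma Lnorm01_1E f : in_L1 f -> Lnorm01 1 f = (EE (fun x => `|f x|))%:E.
Proof.
move=> f1; rewrite /Lnorm01 Lnorm1 fineK; last first.
  by apply: integrable_fin_num; [exact: mI|exact: (integrable_abse f1)].
rewrite [RHS]integral_mkcond; apply: eq_integral => x _.
by rewrite !patchE; case: ifP => //= _; rewrite normr0.
Qed.

Lemma BVle_normBV f b : BVle f b -> in_BV f /\ (normBV f <= b%:E)%E.
Proof.
move=> [f1 [g [V [gf gV Vb]]]].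
have ev : (essvar f <= V%:E)%E by apply: le_trans gV; apply: ereal_inf_lbound; exists g.
split; first by split => //; apply: le_lt_trans ev (ltry _).
rewrite /normBV Lnorm01_1E//; apply: le_trans (leeD ev (lexx _)) _.
by rewrite -EFinD lee_fin.
Qed.

Lemma normBV_BVle f b b' : in_L1 f -> (normBV f <= b%:E)%E -> b < b' -> BVle f b'.
Proof.
move=> f1 fb bb'; split => //.
have := le_lt_trans fb (_ : b%:E < b'%:E)%E; rewrite lte_fin => /(_ bb').
rewrite /normBV Lnorm01_1E// -lteBrDr// -EFinB => /ereal_inf_lt[_ [g gf <-] gb].
by exists g, (b' - EE (fun x => `|f x|)); split; [exact: gf|exact: ltW|rewrite subrK].
Qed.

Lemma BVle_le f b b' : BVle f b -> b <= b' -> BVle f b'.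
Proof. by move=> [f1 [g [V [gf gV Vb]]]] bb'; split => //; exists g, V; split => //; exact: le_trans bb'. Qed.

Lemma BVle_rep f b : BVle f b -> exists g (V : R),
  [/\ ae01 (fun x => g x = f x), (total_variation 0 1 g <= V%:E)%E,
      V + EE (fun x => `|f x|) <= b, 0 <= V & forall x, I01 x -> `|g x| <= b].
Proof.
move=> [f1 [g [V [gf gV Vb]]]]; exists g, V.
have V0 : 0 <= V by rewrite -lee_fin; apply: le_trans gV; exact: total_variation_ge0.
split => // x Ix; apply: le_trans Vb.
have iabs := in_L1_norm f1.
have icst : in_L1 (fun=> V) by apply: in_L1_bmf; exact: bmf_cst.
have iv := in_L1_D icst iabs.
have [|_] := @in_L1_ae_le (fun=> g x) _ (measurable_cst _) iv; last first.
  by rewrite int01D// !int01_cst.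
apply: ae01S gf => y Iy gy; rewrite -gy// -lerBlDr.
apply: le_trans (total_variation_dist gV Ix Iy).
by rewrite lerBlDr -[X in `|X| <= _](subrK (g y)) ler_normD.
Qed.

Lemma BVle_ae_le f b : BVle f b -> ae01 (fun x => `|f x| <= b).
Proof.
move=> /BVle_rep[g [V [gf _ _ _ gb]]]; apply: ae01S gf => x Ix gx.
by rewrite -gx gb.
Qed.

Lemma BVle_ge0 f b : BVle f b -> 0 <= b.
Proof.
move=> /BVle_rep[g [V [_ _ _ _ gb]]]; apply: le_trans (normr_ge0 (g 0)) (gb _ _).
by rewrite /= in_itv/= lexx ler01.
Qed.

Lemma in_L1_measurable f : in_L1 f -> measurable_fun (I01 : set R) f.
Proof. by move=> f1; apply/measurable_EFinP; exact: measurable_int f1. Qed.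

(** The variation of the product is at most b V' + b' V and its L^1 norm at most b times that of
    [f']. Grouping the two terms with factor b gives one b b', and b' V the other. *)
Lemma BVle_mul f f' b b' : BVle f b -> BVle f' b' -> BVle (fun x => f x * f' x) (2 * (b * b')).
Proof.
move=> F F'; have b0 := BVle_ge0 F; have b'0 := BVle_ge0 F'.
have [f1 _] := F; have [f1' _] := F'.
have [g [V [gf gV Vb V0 gb]]] := BVle_rep F.
have [g' [V' [gf' gV' Vb' V0' gb']]] := BVle_rep F'.
have ibf' := in_L1_Z b (in_L1_norm f1').
have [h1 h2] : in_L1 (fun x => f x * f' x) /\ EE (fun x => `|f x * f' x|) <= EE (fun x => b * `|f' x|).
  apply: in_L1_ae_le => //.
    by apply: measurable_funM; exact: in_L1_measurable.
  by apply: ae01S (BVle_ae_le F) => x Ix fx; rewrite normrM ler_wpM2r.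
split => //; exists (fun x => g x * g' x), (b * V' + b' * V); split.
- by apply: ae01S2 gf gf' => x Ix -> ->.
- rewrite addrC; apply: (total_variation_comb (g := g) (g' := g')) => //.
  move=> x y Ix Iy.
  have -> : g x * g' x - g y * g' y = g' x * (g x - g y) + g y * (g' x - g' y) by ring.
  apply: le_trans (ler_normD _ _) _; rewrite !normrM lerD// ler_wpM2r//; [exact: gb'|exact: gb].
- rewrite int01Z in h2; last exact: in_L1_norm.
  apply: le_trans (lerD (lexx _) h2) _.
  have I0 : 0 <= EE (fun x => `|f x|) by apply: Rintegral_ge0 => x _; exact: normr_ge0.
  have I0' : 0 <= EE (fun x => `|f' x|) by apply: Rintegral_ge0 => x _; exact: normr_ge0.
  have e1 : b * (V' + EE (fun x => `|f' x|)) <= b * b' by rewrite ler_wpM2l.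
  have e2 : b' * V <= b' * b by rewrite ler_wpM2l// (le_trans _ Vb)// lerDl.
  by move: e1 e2; rewrite mulrDr [b' * b]mulrC; clear; lra.
Qed.

Lemma BVle_sub f f' b b' (c : R) : BVle f b -> BVle f' b' ->
  BVle (fun x => f x - c * f' x) (b + `|c| * b').
Proof.
move=> F F'.
have [f1 _] := F; have [f1' _] := F'.
have [g [V [gf gV Vb V0 gb]]] := BVle_rep F.
have [g' [V' [gf' gV' Vb' V0' gb']]] := BVle_rep F'.
have ia := in_L1_norm f1; have ia' := in_L1_norm f1'.
have iw := in_L1_D ia (in_L1_Z `|c| ia').
have [h1 h2] : in_L1 (fun x => f x - c * f' x) /\
    EE (fun x => `|f x - c * f' x|) <= EE (fun x => `|f x| + `|c| * `|f' x|).
  apply: in_L1_ae_le => //.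
    apply: measurable_funB; first exact: in_L1_measurable.
    by apply: measurable_funM => //; exact: in_L1_measurable.
  by apply: ae01W => x Ix; apply: le_trans (ler_normB _ _) _; rewrite normrM.
split => //; exists (fun x => g x - c * g' x), (1 * V + `|c| * V'); split.
- by apply: ae01S2 gf gf' => x Ix -> ->.
- apply: (total_variation_comb (g := g) (g' := g')) => // x y _ _.
  have -> : g x - c * g' x - (g y - c * g' y) = (g x - g y) - c * (g' x - g' y) by ring.
  by apply: le_trans (ler_normB _ _) _; rewrite mul1r normrM.
- rewrite (int01D ia (in_L1_Z `|c| ia')) (int01Z _ ia') in h2.
  apply: le_trans (lerD (lexx _) h2) _.
  have : `|c| * (V' + EE (fun x => `|f' x|)) <= `|c| * b' by rewrite ler_wpM2l.
  by move: Vb; rewrite mulrDr mul1r; clear; lra.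
Qed.

Lemma BVle_lipschitz f (M A : R) : 0 <= A -> measurable_fun (I01 : set R) f ->
  (forall x y, I01 x -> I01 y -> `|f x - f y| <= A * `|x - y|) ->
  (forall x, I01 x -> `|f x| <= M) -> BVle f (A + M).
Proof.
move=> A0 mf fA fM.
have iM : in_L1 (fun=> M) by apply: in_L1_bmf; exact: bmf_cst.
have [h1 h2] : in_L1 f /\ EE (fun x => `|f x|) <= EE (fun=> M).
  by apply: in_L1_ae_le => //; exact: ae01W.
rewrite int01_cst in h2.
have tv1 : (total_variation 0 1 (id : R -> R) <= 1%:E)%E.
  by rewrite nondecreasing_total_variation// ?subr0.
split => //; exists f, (A * 1 + 0 * 1); split.
- exact: ae01W.
- by apply: (total_variation_comb (g := id) (g' := id)) => // x y Ix Iy; rewrite mul0r addr0; exact: fA.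
- by rewrite mulr1 mul0r addr0 lerD2l.
Qed.

Lemma BVle_cst (c : R) : BVle (fun=> c) `|c|.
Proof.
rewrite -[`|c|]add0r; apply: BVle_lipschitz => // x y _ _.
by rewrite subrr normr0 mul0r.
Qed.

End BoundedVariation.

(** * Pushforward of a density *)

(** Nonnegativity and integrability are arguments so that the finite measure structure can be
    attached to the term. *)
Definition density_measure d (T : measurableType d) (R : realType)
    (mu : {measure set T -> \bar R}) (p : T -> R) & (forall x, 0 <= p x)
    & mu.-integrable [set: T] (EFin \o p) :=
  fun A => (\int[mu]_(x in A) (p x)%:E)%E.

Section DensityMeasure.
Context d (T : measurableType d) (R : realType) (mu : {measure set T -> \bar R}).
Variables (p : T -> R) (p0 : forall x, 0 <= p x) (ip : mu.-integrable [set: T] (EFin \o p)).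
Local Notation nu := (density_measure p0 ip).

Let density_measure0 : nu set0 = 0%E.
Proof. by rewrite /density_measure integral_set0. Qed.

Let density_measure_ge0 A : (0 <= nu A)%E.
Proof. by apply: integral_ge0 => x _; rewrite lee_fin. Qed.

Let density_measure_sigma_additive : semi_sigma_additive nu.
Proof.
apply: semi_sigma_additive_nng_induced => //; first exact: measurable_int ip.
Qed.

HB.instance Definition _ := isMeasure.Build _ _ _ nu
  density_measure0 density_measure_ge0 density_measure_sigma_additive.

Let density_measure_fin : fin_num_fun nu.
Proof. by move=> A mA; apply: integrable_fin_num => //; exact: integrableS ip. Qed.

HB.instance Definition _ := @Measure_isFinite.Build _ _ _ nu density_measure_fin.

End DensityMeasure.

Section DensityPushforward.
Context d (T : measurableType d) (R : realType) (mu : {sigma_finite_measure set T -> \bar R}).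
Implicit Types (p q h : T -> R).

Lemma bounded_on_EFin (D : set T) h (B : R) : (forall x, D x -> `|h x| <= B) -> [bounded h x | x in D].
Proof. by move=> hB; exists B; split; [exact: num_real|move=> M BM x Dx; exact: le_trans (hB _ Dx) (ltW BM)]. Qed.

Lemma integrable_bounded_mul (nu : {measure set T -> \bar R}) (D : set T) p h (B : R) : measurable D ->
  nu.-integrable D (EFin \o p) -> measurable_fun D h -> (forall x, D x -> `|h x| <= B) ->
  nu.-integrable D (EFin \o (fun x => p x * h x)).
Proof.
by move=> mD ip mh hB; exact: (integrableMl mD ip mh (bounded_on_EFin hB)).
Qed.

Lemma integral_density_measure (p : T -> R) (p0 : forall x, 0 <= p x)
    (ip : mu.-integrable [set: T] (EFin \o p)) h (B : R) :
  measurable_fun setT h -> (forall x, `|h x| <= B) ->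
  (\int[density_measure p0 ip]_x (h x)%:E = \int[mu]_x (p x * h x)%:E)%E.
Proof.
move=> mh hB.
rewrite (@integral_density _ _ _ (density_measure p0 ip) mu (EFin \o p))//.
- by apply: eq_integral => x _; rewrite /= -EFinM mulrC.
- apply/null_content_dominatesP => A mA A0; rewrite /= /density_measure.
  apply: null_set_integral => //.
  by apply: measurable_funTS; exact: measurable_int ip.
- apply: measurable_bounded_integrable => //; last exact: (@bounded_on_EFin _ _ B).
  by rewrite ltey_eq fin_num_measure.
Qed.

(** [q] is the Radon-Nikodym derivative of the image under [phi] of the measure of density [p].
    Nonsingularity is asked only where [p] does not vanish, because [phi] will be an interval map
    extended by 0, which collapses the complement of [I01]. *)
Lemma density_pushforward_nneg (phi : T -> T) (p : T -> R) : measurable_fun setT phi ->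
  (forall x, 0 <= p x) -> mu.-integrable [set: T] (EFin \o p) ->
  (forall A, measurable A -> mu A = 0%E -> mu.-negligible (phi @^-1` A `&` [set x | p x != 0])) ->
  exists q : T -> R, mu.-integrable [set: T] (EFin \o q) /\
    forall h (B : R), measurable_fun setT h -> (forall x, `|h x| <= B) ->
      \int[mu]_x (q x * h x) = \int[mu]_x (p x * h (phi x)).
Proof.
move=> mphi p0 ip ns.
pose nu1 : {finite_measure set T -> \bar R} := density_measure p0 ip.
have mpre A : measurable A -> measurable (phi @^-1` A).
  by move=> mA; rewrite -[X in measurable X]setTI; exact: mphi.
pose push := (pushforward nu1 phi : {measure set T -> \bar R}).
pose nu2 := push mphi.
have fin2 : fin_num_fun nu2.
  by move=> A mA; rewrite /nu2/= /pushforward; apply: fin_num_measure; exact: mpre.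
pose nu3 : {finite_measure set T -> \bar R} :=
  HB.pack_for {finite_measure set T -> \bar R} (Measure.sort nu2) (Measure.class nu2) (@Measure_isFinite.Build _ _ _ nu2 fin2).
have ac : charge_of_finite_measure nu3 `<< mu.
  apply/null_content_dominatesP => A mA A0.
  apply: (@le_anti _ (\bar R)); rewrite measure_ge0 andbT.
  rewrite [leLHS](_ : _ = \int[mu]_(x in phi @^-1` A) (p x)%:E)%E//.
  have [N [mN N0 subN]] := ns A mA A0.
  rewrite (ae_eq_integral (fun=> 0%E))//; first by rewrite integral0.
  - exact: mpre.
  - by apply: measurable_funTS; exact: measurable_int ip.
  - exists N; split => // x /= /not_implyP[Ax] px; apply: subN; split => //=.
    by apply/eqP => p0x; apply: px; rewrite p0x.
pose q := fun x => fine (Radon_Nikodym (charge_of_finite_measure nu3) mu x).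
have qE : EFin \o q = Radon_Nikodym (charge_of_finite_measure nu3) mu.
  by apply/funext => x /=; rewrite fineK// Radon_Nikodym_fin_num.
have iq : mu.-integrable [set: T] (EFin \o q).
  by rewrite qE; exact: Radon_Nikodym_integrable.
exists q; split => // h B mh hB; congr fine.
have inth : nu3.-integrable [set: T] (EFin \o h).
  apply: measurable_bounded_integrable => //; last exact: (@bounded_on_EFin _ _ B).
  by rewrite ltey_eq fin_num_measure.
transitivity (\int[nu3]_x (h x)%:E)%E.
  rewrite -(Radon_Nikodym_change_of_variables ac measurableT inth).
  by apply: eq_integral => x _; rewrite /= EFinM muleC; congr (_ * _)%E; rewrite -qE.
transitivity (\int[nu1]_x ((EFin \o h) \o phi) x)%E.
  rewrite -[in RHS](preimage_setT phi) -integral_pushforward//.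
    exact/measurable_EFinP.
  rewrite preimage_setT; apply: measurable_bounded_integrable => //.
  - by rewrite ltey_eq fin_num_measure.
  - exact: measurableT_comp.
  - exact: (@bounded_on_EFin _ _ B).
exact: (@integral_density_measure p p0 ip (h \o phi) B (measurableT_comp mh mphi) (fun x => hB (phi x))).
Qed.

End DensityPushforward.

(** * Nonsingularity of piecewise expanding maps *)

Section Expanding.
Context {R : realType}.
Local Notation m := (@lebesgue_measure R).
Implicit Types (E A J U V : set R) (T : R -> R).

Lemma lebesgue_interval_ge J (x y : R) : measurable (J : set (measurableTypeR R)) -> is_interval J ->
  J x -> J y -> (`|x - y|%:E <= m J)%E.
Proof.
wlog xy : x y / x <= y => [H mJ iJ Jx Jy|mJ iJ Jx Jy].
  have [xy|/ltW yx] := leP x y; first exact: H.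
  by rewrite distrC; exact: H.
rewrite distrC ger0_norm ?subr_ge0//.
have -> : (y - x)%:E = m `[x, y]%classic.
  rewrite lebesgue_measure_itv/= lte_fin; case: ifPn => // ; rewrite -leNgt => yx.
  by have -> : y = x by [apply/le_anti/andP]; rewrite subrr.
apply: le_measure; rewrite ?inE//.
move=> z /=; rewrite in_itv/= => /andP[xz zy].
by apply: (iJ x y) => //; rewrite xz zy.
Qed.

(** The open set is a disjoint union of intervals. Since T does not contract on E, the preimage in E
    of an interval of length l has diameter at most l, so it lies in an interval of length 2 l
    around any of its points. *)
Lemma expanding_preimage_le E T V (e : R) : (forall x y, E x -> E y -> `|x - y| <= `|T x - T y|) ->
  open V -> (m V < e%:E)%E ->
  exists W : set R, [/\ measurable (W : set (measurableTypeR R)), (m W <= (2 * e)%:E)%E & E `&` T @^-1` V `<=` W].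
Proof.
move=> expT oV Ve.
pose I := open_disjoint_itv oV.
have VE : V = \bigcup_q I q by exact: open_disjoint_itv_bigcup.
have mI q : measurable (I q : set (measurableTypeR R)).
  by apply: open_measurable; exact: open_disjoint_itv_open.
have Isub q : I q `<=` V by rewrite VE; exact: bigcup_sup.
have Ifin q : m (I q) \is a fin_num.
  rewrite ge0_fin_numE//; apply: le_lt_trans (lt_trans Ve (ltry _)).
  by apply: le_measure; rewrite ?inE//; exact: open_measurable.
have /choice[K KP] : forall q, exists K : set R, [/\ measurable (K : set (measurableTypeR R)),
    (m K <= 2%:E * m (I q))%E & E `&` T @^-1` I q `<=` K].
  move=> q; have [->|/set0P[x0 [Ex0 Ix0]]] := eqVneq (E `&` T @^-1` I q) set0.
    by exists set0; split => //; rewrite measure0 mule_ge0.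
  pose l := fine (m (I q)).
  have lE : m (I q) = l%:E by rewrite fineK.
  have l0 : 0 <= l by rewrite -lee_fin -lE.
  exists `[x0 - l, x0 + l]%classic; split.
  - exact: measurable_itv.
  - rewrite lebesgue_measure_itv/= lE -EFinM.
    case: ifPn => _; last by rewrite lee_fin mulr_ge0.
    by rewrite -EFinD lee_fin; lra.
  - move=> x [Ex Ix] /=; rewrite in_itv/= -ler_distl distrC.
    rewrite distrC (le_trans (expT _ _ Ex Ex0))// -lee_fin -lE.
    by apply: lebesgue_interval_ge => //; exact: open_disjoint_itv_is_interval.
exists (\bigcup_q K q); split.
- by apply: bigcup_measurable => q _; case: (KP q).
- apply: (@le_trans _ _ (\sum_(0 <= q <oo) m (K q))%E).
    apply: measure_sigma_subadditive => //; first by move=> q; case: (KP q).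
    by apply: bigcup_measurable => q _; case: (KP q).
  apply: (@le_trans _ _ (\sum_(0 <= q <oo) (2%:E * m (I q)))%E).
    by apply: lee_nneseries => // q _; case: (KP q).
  rewrite nneseriesZl//.
  have <- : m V = (\sum_(0 <= q <oo) m (I q))%E.
    rewrite [in LHS]VE measure_bigcup//; last exact: open_disjoint_itv_trivIset.
    by apply: eq_eseriesl => q; rewrite in_setT.
  by rewrite EFinM lee_wpmul2l// ltW.
- move=> x [Ex]; rewrite /= {1}VE => -[q _ Iq].
  by exists q => //; case: (KP q) => _ _; apply; split.
Qed.

(** Outer regularity encloses [A] in open sets of measure below 1 / (n + 1), whose preimages in E
    lie in measurable sets of measure at most 2 / (n + 1); their intersection is null. *)
Lemma expanding_negligible E T A : (forall x y, E x -> E y -> `|x - y| <= `|T x - T y|) ->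
  measurable (A : set (measurableTypeR R)) -> m A = 0%E -> m.-negligible (E `&` T @^-1` A).
Proof.
move=> expT mA A0.
have /choice[W WP] : forall n : nat, exists W : set R, [/\ measurable (W : set (measurableTypeR R)),
    (m W <= (2 * n.+1%:R^-1)%:E)%E & E `&` T @^-1` A `<=` W].
  move=> n.
  have Afin : (m A < +oo)%E by rewrite A0.
  have eps0 : 0 < n.+1%:R^-1 :> R by rewrite invr_gt0.
  have [V [oV AV VA]] := lebesgue_regularity_outer mA Afin eps0.
  have mV : measurable (V : set (measurableTypeR R)) by exact: open_measurable.
  have VE : (m V < (n.+1%:R^-1)%:E)%E.
    apply: le_lt_trans VA; rewrite -[V in leLHS](setDUK AV).
    apply: (@le_trans _ _ (m A + m (V `\` A))%E); last by rewrite A0 add0e.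
    have mVA : measurable (V `\` A : set (measurableTypeR R)) by exact: measurableD.
    exact: (@measureU2 _ _ _ m _ _ mA mVA).
  have [W [mW Wle sub]] := expanding_preimage_le expT oV VE.
  by exists W; split => // x [Ex Ax]; apply: sub; split => //; exact: AV.
exists (\bigcap_n W n); split.
- by apply: bigcap_measurable => // n _; case: (WP n).
- apply/le_anti; rewrite measure_ge0 andbT; apply/lee_addgt0Pr => e e0; rewrite add0e.
  have [n ne] : exists n : nat, 2 * n.+1%:R^-1 <= e.
    have [n _ /(_ n (leqnn n))] := near_infty_natSinv_lt (PosNum (divr_gt0 e0 (ltr0Sn R 1))).
    rewrite /= => h; exists n; rewrite mulrC -ler_pdivlMr//; exact: ltW.
  apply: (@le_trans _ _ (m (W n))).
    apply: le_measure; rewrite ?inE; last by move=> x; apply.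
    - by apply: bigcap_measurable => // k _; case: (WP k).
    - by case: (WP n).
  by apply: le_trans (_ : (2 * n.+1%:R^-1)%:E <= _)%E; [case: (WP n)|rewrite lee_fin].
- by move=> x ETx n _; case: (WP n) => _ _; apply.
Qed.

Lemma negligible_fin_bigcup (I : choiceType) (D : set I) (F : I -> set R) : finite_set D ->
  (forall i, D i -> m.-negligible (F i)) -> m.-negligible (\bigcup_(i in D) F i).
Proof.
move=> fD nF; have /choice[G GP] : forall i, exists G : set R, D i ->
    [/\ measurable (G : set (measurableTypeR R)), m G = 0%E & F i `<=` G].
  move=> i; have [Di|nDi] := pselect (D i); last by exists set0.
  by have [G GP] := nF i Di; exists G.
exists (\bigcup_(i in D) G i); split.
- by apply: fin_bigcup_measurable => // i Di; case: (GP i Di).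
- apply/le_anti; rewrite measure_ge0 andbT.
  apply: le_trans (content_sub_fsum _ fD _ _ (@subset_refl _ _)) _.
  + by move=> i Di; case: (GP i Di).
  + by apply: fin_bigcup_measurable => // i Di; case: (GP i Di).
  + by rewrite fsbig1// => i Di; case: (GP i Di).
- by apply: subset_bigcup => i Di; case: (GP i Di).
Qed.

Lemma interval_diff_interior J : is_interval J -> has_lbound J -> has_ubound J ->
  J `\` interior J `<=` [set inf J; sup J].
Proof.
move=> iJ lJ uJ x [Jx]; rewrite interval_bounded_interior//= => /negP; rewrite negb_and -!leNgt.
move=> /orP[h|h]; [left|right]; apply/le_anti/andP; split => //.
- exact: ge_inf.
- exact: ub_le_sup.
Qed.

End Expanding.

(** * Measurability and nonsingularity of piecewise expanding maps *)

Section PexpMap.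
Context {R : realType}.
Local Notation m := (@lebesgue_measure R).
Variable T : pexp_map R.

Lemma pexp_part_bounded J : pexp_part T J -> [/\ is_interval J, has_lbound J & has_ubound J].
Proof.
have [_ PJ cov _ _] := pexp_partP T => TJ.
have JI : J `<=` I01 by rewrite -cov; exact: bigcup_sup.
split; first by case: (PJ J TJ).
- by exists 0 => x /JI /=; rewrite in_itv/= => /andP[].
- by exists 1 => x /JI /=; rewrite in_itv/= => /andP[].
Qed.

Lemma pexp_derivable J x : pexp_part T J -> interior J x ->
  derivable T x 1 /\ 1 <= `|T^`()%classic x|.
Proof.
move=> TJ Jx; have [_ _ _ _ /(_ J TJ)[U [g [oU JU gU Tg]]]] := pexp_partP T.
split; last first.
  rewrite -lee_fin; apply: le_trans (ltW (pexp_expanding T)) _.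
  by apply: ereal_inf_lbound; exists x => //; exists J.
have Ux : U x by apply: JU; apply: subset_closure; exact: interior_subset.
have [dg _ _] := gU x Ux.
apply: near_eq_derivable dg.
have : nbhs x (interior J) by apply: open_nbhs_nbhs; split => //; exact: open_interior.
by apply: filterS => y Jy; rewrite Tg.
Qed.

Lemma pexp_expands J : pexp_part T J ->
  forall x y, interior J x -> interior J y -> `|x - y| <= `|T x - T y|.
Proof.
move=> TJ x y; wlog xy : x y / x < y => [H Jx Jy|Jx Jy].
  have [xy|yx|->] := ltgtP x y; first exact: H.
    by rewrite distrC [leRHS]distrC; exact: H.
  by rewrite !subrr.
have [iJ lJ uJ] := pexp_part_bounded TJ.
have Jz z : x <= z <= y -> interior J z.
  move: Jx Jy; rewrite interval_bounded_interior//= => /andP[ix xs] /andP[iy ys] /andP[xz zy].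
  by rewrite (lt_le_trans ix xz) (le_lt_trans zy ys).
have dT z : z \in `]x, y[ -> is_derive z 1 (T : R -> R) (T^`()%classic z).
  rewrite in_itv/= => /andP[/ltW xz /ltW zy].
  have [dz _] := pexp_derivable TJ (Jz z (introT andP (conj xz zy))).
  by rewrite derive1E; exact: derivableP.
have cT : {within `[x, y], continuous (T : R -> R)}.
  apply: derivable_within_continuous => z; rewrite in_itv/= => zxy.
  by have [] := pexp_derivable TJ (Jz z zxy).
have [c cxy Tc] := MVT xy dT cT.
rewrite distrC [leRHS]distrC Tc normrM ler_peMl//.
move: cxy; rewrite in_itv/= => /andP[/ltW xc /ltW cy].
by have [] := pexp_derivable TJ (Jz c (introT andP (conj xc cy))).
Qed.

(** The endpoints belonging to the elements: a finite set, hence null, on which the smooth branches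
    give no information about T. *)
Let rest := \bigcup_(J in pexp_part T) (J `\` interior J).

Let finite_rest : finite_set rest.
Proof.
have [fA _ _ _ _] := pexp_partP T.
apply: bigcup_finite => // J TJ; have [iJ lJ uJ] := pexp_part_bounded TJ.
apply: sub_finite_set (interval_diff_interior iJ lJ uJ) _.
exact: finite_set2.
Qed.

Lemma pexp_preimage (B : set R) : I01 `&` T @^-1` B =
  \bigcup_(J in pexp_part T) (interior J `&` T @^-1` B) `|` (rest `&` T @^-1` B).
Proof.
have [_ _ cov _ _] := pexp_partP T; rewrite -cov; apply/seteqP; split => x.
- move=> [[J TJ Jx] Bx]; have [iJx|niJx] := pselect (interior J x).
    by left; exists J.
  by right; split => //; exists J.
- move=> [[J TJ [Jx Bx]]|[[J TJ [Jx _]] Bx]]; split => //; exists J => //.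
  exact: interior_subset.
Qed.

Lemma pexp_measurable : measurable_fun (I01 : set R) T.
Proof.
have [fA _ _ _ _] := pexp_partP T.
move=> _ B mB; rewrite pexp_preimage; apply: measurableU.
  apply: fin_bigcup_measurable => // J TJ.
  apply: (open_continuous_measurable_fun (D := interior J)) => //.
  - exact: open_interior.
  - move=> x; rewrite inE => Jx; have [dT _] := pexp_derivable TJ Jx.
    by apply: differentiable_continuous; exact/derivable1_diffP.
  - by apply: open_measurable; exact: open_interior.
apply: countable_measurable; first by move=> t; exact: measurable_set1.
by apply: finite_set_countable; apply: sub_finite_set finite_rest => x [].
Qed.

Lemma pexp_nonsingular (A : set R) : measurable (A : set (measurableTypeR R)) -> m A = 0%E ->
  m.-negligible (I01 `&` T @^-1` A).
Proof.
have [fA _ _ _ _] := pexp_partP T.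
move=> mA A0; rewrite pexp_preimage; apply: negligibleU.
  by apply: negligible_fin_bigcup => // J TJ; exact: expanding_negligible (pexp_expands TJ) mA A0.
have cr : countable (rest `&` T @^-1` A).
  by apply: finite_set_countable; apply: sub_finite_set finite_rest => x [].
exists (rest `&` T @^-1` A); split => //.
- by apply: countable_measurable => // t; exact: measurable_set1.
- exact: countable_lebesgue_measure0.
Qed.

End PexpMap.

(** * Existence of the transfer operator *)

Section Transfer.
Context {R : realType}.
Local Notation m := (@lebesgue_measure R).
Local Notation mI := measurable_I01.
Local Notation EE f := (\int[m]_(x in I01) f x).
Implicit Types (f g h u v : R -> R) (T : pexp_map R).

Lemma int01_ae_eq u v : measurable_fun (I01 : set R) u -> measurable_fun (I01 : set R) v ->
  ae01 (fun x => u x = v x) -> EE u = EE v.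
Proof.
move=> mu mv uv; congr fine; apply: ae_eq_integral => //.
- exact/measurable_EFinP.
- exact/measurable_EFinP.
- by apply: ae01S uv => x _ ->.
Qed.

Lemma in_L1_restrict u : in_L1 u -> m.-integrable [set: measurableTypeR R] (EFin \o (u \_ I01)).
Proof. by move=> u1; rewrite -restrict_EFin; apply/(integrable_mkcond _ mI). Qed.

Lemma in_L1_setT u : m.-integrable [set: measurableTypeR R] (EFin \o u) -> in_L1 u.
Proof. by move=> iu; apply: integrableS iu => //; exact: mI. Qed.

Lemma int01_setT u : (forall x, ~ I01 x -> u x = 0) -> EE u = \int[m]_x u x.
Proof.
move=> u0; rewrite Rintegral_mkcond; congr (Rintegral m _ _); apply/funext => x.
by rewrite patchE; case: ifPn => //; rewrite notin_setE => /u0.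
Qed.

Lemma in_Linfty_bmf h : bmf (I01 : set (measurableTypeR R)) h -> in_Linfty h.
Proof. by move=> [mh [B hB]]; split => //; exists B; exact: ae01W. Qed.

Lemma in_L1_Mbmf u h : in_L1 u -> bmf (I01 : set (measurableTypeR R)) h -> in_L1 (fun x => u x * h x).
Proof. by move=> u1 [mh [B hB]]; exact: (integrable_bounded_mul mI u1 mh hB). Qed.

Lemma ae01_comp T (P : R -> Prop) : ae01 P -> ae01 (fun x => P (T x)).
Proof.
move=> [N [mN N0 subN]]; have [N' [mN' N'0 subN']] := pexp_nonsingular T mN N0.
exists N'; split => // x /= /not_implyP[Ix Px]; apply: subN'; split => //=.
by apply: subN => /= /(_ (pexp_stable T Ix)).
Qed.

Lemma measurable_pexp_comp T h : measurable_fun (I01 : set R) h ->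
  measurable_fun (I01 : set R) (fun x => h (T x)).
Proof.
move=> mh; have sub : [set (T : R -> R) x | x in I01] `<=` I01 by move=> _ [x Ix <-]; exact: pexp_stable.
exact: (@measurable_comp _ _ _ (measurableTypeR R) (measurableTypeR R) (measurableTypeR R)
  I01 h I01 T mI sub mh (pexp_measurable T)).
Qed.

(** Test functions in L^infinity are bounded only almost everywhere on [I01], whereas the
    pushforward is tested against functions bounded on the whole line. *)
Lemma in_Linfty_bounded h : in_Linfty h -> exists (h' : R -> R) (B : R),
  [/\ measurable_fun setT h', forall x, `|h' x| <= B, forall x, ~ I01 x -> h' x = 0 &
      ae01 (fun x => h' x = h x)].
Proof.
move=> [mh [B hB]].
pose S := I01 `&` (fun x => `|h x|) @^-1` `]-oo, B].
have mS : measurable (S : set (measurableTypeR R)).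
  have mnh : measurable_fun (I01 : set R) (fun x => `|h x|) by apply: measurableT_comp.
  exact: (mnh mI _ (measurable_itv _)).
exists (h \_ S), `|B|; split.
- apply/(measurable_restrictT _ mS); apply: measurable_funS mh; first exact: mI.
  by move=> x [].
- move=> x; rewrite patchE; case: ifPn; last by rewrite normr0.
  by rewrite inE => -[_]; rewrite /= in_itv/= => /le_trans -> //; rewrite ler_norm.
- by move=> x nIx; rewrite patchE; case: ifPn => //; rewrite inE => -[].
- apply: ae01S hB => x Ix hB; rewrite patchE; case: ifPn => //; rewrite notin_setE => nS.
  by exfalso; apply: nS; split => //=; rewrite in_itv.
Qed.

Lemma is_transfer_of_bounded T f g : in_L1 f -> m.-integrable [set: measurableTypeR R] (EFin \o g) ->
  (forall h (B : R), measurable_fun setT h -> (forall x, `|h x| <= B) -> (forall x, ~ I01 x -> h x = 0) ->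
     \int[m]_x (g x * h x) = EE (fun x => f x * h (T x))) -> is_transfer T f g.
Proof.
move=> f1 ig gh; have g1 := in_L1_setT ig; split => // h hinf.
have [mh _] := hinf.
have [h' [B [mh' hB h0 hh]]] := in_Linfty_bounded hinf.
have mh'I : measurable_fun (I01 : set R) h' by exact: measurable_funTS mh'.
have mf := in_L1_measurable f1; have mg := in_L1_measurable g1.
transitivity (EE (fun x => g x * h' x)).
  apply: int01_ae_eq; [exact: measurable_funM|exact: measurable_funM|].
  by apply: ae01S hh => x _ ->.
rewrite int01_setT; last by move=> x nI; rewrite h0// mulr0.
rewrite (gh h' B)//; apply: int01_ae_eq.
- by apply: measurable_funM => //; exact: measurable_pexp_comp.
- by apply: measurable_funM => //; exact: measurable_pexp_comp.
- by apply: ae01S (ae01_comp T hh) => x _ ->.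
Qed.

(** The positive and negative parts of [f], [part 1] and [part (-1)], are pushed forward separately;
    the difference of the two image densities represents P_T f. *)
Lemma exists_transfer T f : in_L1 f -> exists g, is_transfer T f g.
Proof.
move=> f1.
pose phi : measurableTypeR R -> measurableTypeR R := (T : R -> R) \_ I01.
have mphi : measurable_fun setT phi.
  by apply/(measurable_restrictT _ mI); exact: pexp_measurable.
pose part (s : R) (x : R) := Num.max (s * f x) 0.
have part0 s x : 0 <= (part s \_ I01) x.
  by rewrite patchE; case: ifPn => // _; rewrite /part le_max lexx orbT.
have ipart s : in_L1 (part s).
  have mp : measurable_fun (I01 : set R) (part s).
    by apply: measurable_maxr => //; apply: measurable_funM => //; exact: in_L1_measurable.
  have [] // := in_L1_ae_le mp (in_L1_norm (in_L1_Z s f1)).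
  apply: ae01W => x _; rewrite /part; case: (leP (s * f x) 0) => h; first by rewrite normr0.
  by rewrite lexx.
have ns s A : measurable (A : set (measurableTypeR R)) -> m A = 0%E ->
    m.-negligible (phi @^-1` A `&` [set x | (part s \_ I01) x != 0]).
  move=> mA A0; apply: negligibleS (pexp_nonsingular T mA A0) => x /= [].
  by rewrite /phi !patchE; case: ifPn => [/set_mem //|]; rewrite eqxx.
have [qp [iqp qpE]] := density_pushforward_nneg mphi (part0 1) (in_L1_restrict (ipart 1)) (ns 1).
have [qn [iqn qnE]] := density_pushforward_nneg mphi (part0 (-1)) (in_L1_restrict (ipart (-1))) (ns (-1)).
exists (fun x => qp x - qn x); apply: is_transfer_of_bounded => //.
  exact: (integrableB measurableT iqp iqn).
move=> h B mh hB h0.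
have iM u : m.-integrable [set: measurableTypeR R] (EFin \o u) ->
    m.-integrable [set: measurableTypeR R] (EFin \o (fun x => u x * h x)).
  by move=> iu; exact: (integrable_bounded_mul measurableT iu mh (fun x _ => hB x)).
have -> : \int[m]_x ((qp x - qn x) * h x) = \int[m]_x (qp x * h x - qn x * h x).
  by congr (Rintegral m _ _); apply/funext => x; rewrite mulrBl.
rewrite (RintegralB measurableT (iM _ iqp) (iM _ iqn)).
rewrite (qpE h B)// (qnE h B)//.
have rI s : \int[m]_x ((part s \_ I01) x * h (phi x)) = EE (fun x => part s x * h (T x)).
  rewrite [RHS]Rintegral_mkcond; congr (Rintegral m _ _); apply/funext => x.
  by rewrite /phi !patchE; case: ifPn => // _; rewrite mul0r.
have bhT : bmf (I01 : set (measurableTypeR R)) (fun x => h (T x)).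
  split; last by exists B.
  by apply: measurable_pexp_comp; exact: measurable_funTS mh.
rewrite !rI -int01B; [|exact: in_L1_Mbmf|exact: in_L1_Mbmf].
congr (Rintegral m _ _); apply/funext => x.
rewrite -mulrBl; congr (_ * _); rewrite /part mul1r mulN1r.
by case: (leP (f x) 0); case: (leP (- f x) 0); lra.
Qed.

Lemma transferP T f : in_L1 f -> is_transfer T f (transfer T f).
Proof. by move=> f1; rewrite /transfer; apply: xgetPex; exact: exists_transfer. Qed.

Lemma transfer_L1 T f : in_L1 f -> in_L1 (transfer T f).
Proof. by move=> /(transferP T)[]. Qed.

Lemma transfer_dual T f h : in_L1 f -> in_Linfty h ->
  EE (fun x => transfer T f x * h x) = EE (fun x => f x * h (T x)).
Proof. by move=> /(transferP T)[_]; apply. Qed.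

(** Duality against the sign of P_T f, which has absolute value 1. *)
Lemma transfer_norm_le T f : in_L1 f -> EE (fun x => `|transfer T f x|) <= EE (fun x => `|f x|).
Proof.
move=> f1; have g1 := transfer_L1 T f1; set g := transfer T f in g1 *.
have mg := in_L1_measurable g1.
pose S := I01 `&` g @^-1` `[0, +oo[.
have mS : measurable (S : set (measurableTypeR R)) by exact: (mg mI _ (measurable_itv _)).
pose h : R -> R := fun x => 2 * \1_S x - 1.
have h1 x : `|h x| <= 1.
  by rewrite /h indicE; case: (x \in S) => /=; rewrite ?mulr1 ?mulr0 ?sub0r ?normrN ?normr1// -[2]/(1 + 1) addrK normr1.
have mh : measurable_fun (I01 : set R) h.
  by apply: measurable_funB => //; apply: measurable_funM.
have bh : bmf (I01 : set (measurableTypeR R)) h by split => //; exists 1.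
have bhT : bmf (I01 : set (measurableTypeR R)) (fun x => h (T x)).
  by split; [exact: measurable_pexp_comp|exists 1].
have -> : EE (fun x => `|g x|) = EE (fun x => g x * h x).
  apply: eq_Rintegral => x; rewrite inE => Ix; rewrite /h indicE.
  have [gx|gx] := leP 0 (g x).
    rewrite mem_set; last by split => //=; rewrite in_itv/= gx.
    by rewrite ger0_norm//=; lra.
  rewrite memNset; last by move=> [_]; rewrite /= in_itv/= andbT leNgt gx.
  by rewrite ltr0_norm//=; lra.
rewrite transfer_dual//; last exact: in_Linfty_bmf.
have fh := in_L1_Mbmf f1 bhT.
apply: le_trans (ler_norm _) _; apply: le_trans (le_normr_Rintegral mI fh) _.
apply: le_Rintegral => //.
- exact: in_L1_norm.
- exact: in_L1_norm.
- by move=> x _; rewrite normrM ler_piMr.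
Qed.

End Transfer.

(** * Decorrelation *)

Section IteratedTransfer.
Context {R : realType}.
Local Notation m := (@lebesgue_measure R).
Local Notation mI := measurable_I01.
Local Notation EE f := (\int[m]_(x in I01) f x).
Local Notation bmf01 := (@bmf _ (measurableTypeR R) R I01).
Implicit Types (f g h u v : R -> R) (T : nat -> pexp_map R).

Definition shift_maps T k : nat -> pexp_map R := fun i => T (k + i)%N.

Lemma iter_mapsD T k j x : iter_maps T (k + j) x = iter_maps (shift_maps T k) j (iter_maps T k x).
Proof. by elim: j => [|j IH]; rewrite ?addn0// addnS /= IH /shift_maps addnS. Qed.

Lemma iter_transferD T k j f :
  iter_transfer T (k + j) f = iter_transfer (shift_maps T k) j (iter_transfer T k f).
Proof. by elim: j => [|j IH]; rewrite ?addn0// addnS /= IH /shift_maps addnS. Qed.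

Lemma iter_maps_stable T k x : I01 x -> I01 (iter_maps T k x).
Proof. by move=> Ix; elim: k => // k IH; exact: pexp_stable. Qed.

Lemma bmf_pexp (S : pexp_map R) h : bmf01 h -> bmf01 (fun x => h (S x)).
Proof.
move=> [mh [B hB]]; split; first exact: measurable_pexp_comp.
by exists B => x Ix; apply: hB; exact: pexp_stable.
Qed.

Lemma bmf_iter_maps T k h : bmf01 h -> bmf01 (fun x => h (iter_maps T k x)).
Proof. by elim: k h => // k IH h bh; exact: (IH _ (bmf_pexp (T k.+1) bh)). Qed.

Lemma iter_transfer_L1 T k f : in_L1 f -> in_L1 (iter_transfer T k f).
Proof. by move=> f1; elim: k => // k IH; exact: transfer_L1. Qed.

Lemma iter_transfer_dual T k f h : in_L1 f -> bmf01 h ->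
  EE (fun x => iter_transfer T k f x * h x) = EE (fun x => f x * h (iter_maps T k x)).
Proof.
move=> f1; elim: k h => // k IH h bh /=.
rewrite transfer_dual; [|exact: iter_transfer_L1|exact: in_Linfty_bmf].
exact: (IH _ (bmf_pexp (T k.+1) bh)).
Qed.

Lemma iter_transfer_norm_le T k f : in_L1 f ->
  EE (fun x => `|iter_transfer T k f x|) <= EE (fun x => `|f x|).
Proof.
move=> f1; elim: k => // k IH /=.
by apply: le_trans (transfer_norm_le _ _) IH; exact: iter_transfer_L1.
Qed.

Lemma bmf1 : bmf01 (fun=> 1). Proof. exact: bmf_cst. Qed.

Lemma iter_transfer_int T k f : in_L1 f -> EE (iter_transfer T k f) = EE f.
Proof.
move=> f1; have := iter_transfer_dual T k f1 bmf1.
by under eq_Rintegral => x _ do rewrite mulr1; under [in RHS]eq_Rintegral => x _ do rewrite mulr1.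
Qed.

Lemma BVle_int f b : BVle f b -> EE (fun x => `|f x|) <= b.
Proof. by move=> /BVle_rep[g [V [_ _ Vb V0 _]]]; apply: le_trans Vb; rewrite lerDr. Qed.

Lemma int01_mul_le f h b w : BVle f b -> bmf01 h -> (forall x, I01 x -> `|h x| <= w) ->
  `|EE (fun x => f x * h x)| <= b * w.
Proof.
move=> fb bh hw; have [f1 _] := fb; have fh := in_L1_Mbmf f1 bh.
have w0 : 0 <= w by apply: le_trans (normr_ge0 _) (hw 0 _); rewrite /= in_itv/= lexx ler01.
apply: le_trans (le_normr_Rintegral mI fh) _.
apply: (@le_trans _ _ (EE (fun x => w * `|f x|))).
  apply: le_Rintegral => //.
  - exact: in_L1_norm.
  - by apply: in_L1_Z; exact: in_L1_norm.
  - by move=> x Ix; rewrite normrM mulrC ler_wpM2r// hw//.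
rewrite int01Z; last exact: in_L1_norm.
by rewrite mulrC ler_wpM2r//; exact: BVle_int.
Qed.

End IteratedTransfer.

(** * Uniform BV bounds along sequences of the class *)

Section ClassOfMaps.
Context {R : realType}.
Local Notation m := (@lebesgue_measure R).
Local Notation EE f := (\int[m]_(x in I01) f x).
Variable C : set (pexp_map R).
Implicit Types (f g h u v : R -> R) (T : nat -> pexp_map R).

Definition maps_in T := forall n, (1 <= n)%N -> C (T n).

Lemma maps_in_shift T k : maps_in T -> maps_in (shift_maps T k).
Proof. by move=> CT n n1; apply: CT; rewrite (leq_trans n1)// leq_addl. Qed.

(* The summand 1 leaves room for the infimum over representatives, which need not
   be attained. *)
Lemma cond_D_step r : cond_D C r -> exists rho M0 Cr : R, [/\ 0 < rho < 1, 0 < M0, 0 < Cr,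
  forall (S : pexp_map R) f b, C S -> BVle f b -> BVle (transfer S f) (M0 * b + 1) &
  forall T f b, maps_in T -> BVle f b ->
    BVle (iter_transfer T r f) (rho * b + Cr * EE (fun x => `|f x|) + 1)].
Proof.
move=> [rho [M0 [Cr [r01 M00 Cr0 h1 hr]]]]; exists rho, M0, Cr; split => //.
- move=> S f b CS fb; have [fBV fn] := BVle_normBV fb; have [f1 _] := fb.
  apply: (@normBV_BVle _ _ (M0 * b)); [exact: transfer_L1| |by rewrite ltrDl].
  apply: le_trans (h1 S f CS fBV) _.
  by rewrite EFinM lee_wpmul2l// lee_fin ltW.
- move=> T f b CT fb; have [fBV fn] := BVle_normBV fb; have [f1 _] := fb.
  apply: (@normBV_BVle _ _ (rho * b + Cr * EE (fun x => `|f x|))).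
  + exact: iter_transfer_L1.
  + apply: le_trans (hr T f _ fBV) _; first by move=> i /andP[i0 _]; exact: CT.
    rewrite Lnorm01_1E// EFinD !EFinM leeD2r// lee_wpmul2l// lee_fin ltW//.
    by case/andP: r01.
  + by rewrite ltrDl.
Qed.

(** Since L^1 norms do not increase, a block of r maps sends a bound b to at most rho b + Cr + 1,
    and [b0] is chosen so that this map does not exceed it. The fewer than r remaining maps are
    handled by the one-step bound, at a cost that depends on r only. *)
Lemma iter_transfer1_BV r : (0 < r)%N -> cond_D C r ->
  exists2 b : R, 0 < b & forall T k, maps_in T -> BVle (iter_transfer T k (fun=> 1)) b.
Proof.
move=> r0 /cond_D_step[rho [M0 [Cr [/andP[rho0 rho1] M00 Cr0 h1 hr]]]].
have rho1' : 0 < 1 - rho by rewrite subr_gt0.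
pose b0 := 1 + (Cr + 1) / (1 - rho).
have b01 : 1 <= b0 by rewrite lerDl divr_ge0// ltW// addr_gt0.
have b0E : rho * b0 + Cr + 1 <= b0.
  rewrite -subr_ge0 (_ : _ - _ = 1 - rho); first exact: ltW.
  by rewrite /b0; field; rewrite gt_eqF.
have one1 : @in_L1 R (fun=> 1) by case: (BVle_cst (1 : R)).
have blocks q T : maps_in T -> BVle (iter_transfer T (q * r) (fun=> 1)) b0.
  move=> CT; elim: q => [|q IH].
    by apply: BVle_le (BVle_cst 1) _; rewrite normr1.
  rewrite mulSn addnC iter_transferD.
  apply: BVle_le (hr _ _ _ (maps_in_shift _ CT) IH) _.
  apply: le_trans b0E; rewrite lerD2r lerD2l; apply: ler_piMr; first exact: ltW.
  apply: le_trans (iter_transfer_norm_le _ _ one1) _.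
  by rewrite (int01_cst `|1|) normr1.
have tails s : exists2 b : R, 0 < b & forall j T f, (j <= s)%N -> maps_in T -> BVle f b0 ->
    BVle (iter_transfer T j f) b.
  elim: s => [|s [b b_gt0 IH]].
    by exists b0; [exact: lt_le_trans b01|move=> j T f; rewrite leqn0 => /eqP ->].
  exists (b + (M0 * b + 1)); first by rewrite !addr_gt0// mulr_gt0.
  move=> j T f; rewrite leq_eqVlt => /predU1P[->|js] CT fb.
    apply: (@BVle_le _ _ (M0 * b + 1)); last by rewrite lerDr ltW.
    by apply: h1; [exact: CT|exact: IH].
  by apply: BVle_le (IH j T f js CT fb) _; rewrite lerDl addr_ge0// mulr_ge0// ltW.
have [b b_gt0 Hb] := tails r; exists b => // T k CT.
rewrite (divn_eq k r) iter_transferD; apply: Hb.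
- by rewrite ltnW// ltn_mod.
- exact: maps_in_shift.
- exact: blocks.
Qed.

(** The constant [2 * K0 + 1] is at least 1, which settles l = 0, and strictly above [K0], which
    leaves room to choose a representative; with the same aim b is taken positive. *)
Lemma cond_Dec_BV : cond_Dec C -> exists theta K1 : R, [/\ 0 < theta < 1, 0 < K1 &
  forall T l f b, maps_in T -> 0 < b -> BVle f b -> EE f = 0 ->
    BVle (iter_transfer T l f) (K1 * theta ^+ l * b)].
Proof.
move=> [theta [K0 [th01 K00 hdec]]]; have /andP[th0 th1] := th01.
exists theta, (2 * K0 + 1); split => //; first by rewrite addr_gt0// mulr_gt0.
move=> T [|l] f b CT b0 fb f0.
  rewrite /= expr0 mulr1; apply: BVle_le fb _; apply: ler_peMl; first exact: ltW.
  by rewrite lerDr mulr_ge0// ltW.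
have [fBV fn] := BVle_normBV fb; have [f1 _] := fb.
have t0 : 0 < theta ^+ l.+1 by rewrite exprn_gt0.
apply: (@normBV_BVle _ _ (K0 * theta ^+ l.+1 * b)); first exact: iter_transfer_L1.
  apply: le_trans (hdec l.+1 T f isT _ fBV f0) _; first by move=> i /andP[i0 _]; exact: CT.
  by rewrite [in leRHS]EFinM lee_wpmul2l// lee_fin mulr_ge0// ltW.
rewrite ltr_pM2r// ltr_pM2r//; lra.
Qed.

End ClassOfMaps.

(** * Decorrelation estimates for Birkhoff observables *)

Section BirkhoffMixing.
Context {R : realType}.
Local Notation m := (@lebesgue_measure R).
Local Notation mI := measurable_I01.
Local Notation EE f := (\int[m]_(x in I01) f x).
Local Notation bmf01 := (@bmf _ (measurableTypeR R) R I01).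
Variables (C : set (pexp_map R)) (T : nat -> pexp_map R) (CT : maps_in C T).
Implicit Types (f g h u v W G : R -> R).

Variables (br K1 theta : R) (br0 : 0 < br) (th01 : 0 < theta < 1) (K10 : 0 < K1).
Hypothesis rho_BV : forall T' k, maps_in C T' -> BVle (iter_transfer T' k (fun=> 1)) br.
Hypothesis dec_BV : forall T' l f b, maps_in C T' -> 0 < b -> BVle f b -> EE f = 0 ->
  BVle (iter_transfer T' l f) (K1 * theta ^+ l * b).

Variables (f : R -> R) (A bf : R) (A0 : 0 <= A) (bf0 : 0 < bf).
Hypothesis fk_BV : forall c : R, `|c| <= A -> BVle (fun y => f y - c) bf.
Hypothesis f_bmf : bmf01 f.
Hypothesis f_le : forall x, I01 x -> `|f x| <= A.

Definition birkhoff_mean k : R := EE (fun y => f (iter_maps T k y)).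
Definition birkhoff_obs k (x : R) : R := f (iter_maps T k x) - birkhoff_mean k.

Local Notation X := birkhoff_obs.
Let ff k (y : R) := f y - birkhoff_mean k.
Let rho k := iter_transfer T k (fun=> 1).
Let u k (x : R) := rho k x * ff k x.
Let th0 : 0 < theta. Proof. by case/andP: th01. Qed.
Let one1 : @in_L1 R (fun=> 1). Proof. by case: (BVle_cst (1 : R)). Qed.

Let mean_le k : `|birkhoff_mean k| <= A.
Proof.
apply: (EE_norm mI lebesgue_I01); first exact: bmf_iter_maps.
by move=> x Ix; apply: f_le; exact: iter_maps_stable.
Qed.

Let ff_bmf k : bmf01 (ff k).
Proof. by apply: bmfB => //; exact: bmf_cst. Qed.

Let ff_le k x : I01 x -> `|ff k x| <= 2 * A.
Proof.
move=> Ix; apply: le_trans (ler_normB _ _) _.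
by rewrite (_ : 2 * A = A + A) ?lerD ?f_le// mulr_natl mulr2n.
Qed.

Let rho_L1 k : in_L1 (rho k). Proof. by case: (rho_BV k CT). Qed.

Let rho_dual k h : bmf01 h -> EE (fun x => rho k x * h x) = EE (fun x => h (iter_maps T k x)).
Proof.
move=> bh; rewrite /rho iter_transfer_dual//.
by under eq_Rintegral => x _ do rewrite mul1r.
Qed.

Let X_mean k : EE (X k) = 0.
Proof.
rewrite /X (EEB mI lebesgue_I01); [|exact: bmf_iter_maps|exact: bmf_cst].
by rewrite int01_cst subrr.
Qed.

Let bu := 2 * (br * bf).
Let bu0 : 0 < bu. Proof. by rewrite !mulr_gt0. Qed.

Let u_BV k : BVle (u k) bu.
Proof. by apply: BVle_mul; [exact: rho_BV|exact: fk_BV]. Qed.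

Let u_L1 k : in_L1 (u k). Proof. by case: (u_BV k). Qed.

Let u_mean k : EE (u k) = 0.
Proof. by rewrite /u rho_dual//; exact: X_mean. Qed.

(* The density at time [j] of the signed measure of density [X k]. *)
Let g k j := iter_transfer (shift_maps T k) (j - k) (u k).

Let g_BV k j : BVle (g k j) (K1 * theta ^+ (j - k) * bu).
Proof. by apply: dec_BV => //; exact: maps_in_shift. Qed.

Let g_dual k j h : (k <= j)%N -> bmf01 h ->
  EE (fun x => X k x * h (iter_maps T j x)) = EE (fun x => g k j x * h x).
Proof.
move=> kj bh; rewrite /g iter_transfer_dual//.
transitivity (EE (fun x => rho k x * (ff k x * h (iter_maps (shift_maps T k) (j - k) x)))).
  rewrite rho_dual; last by apply: bmfM => //; exact: bmf_iter_maps.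
  by apply: eq_Rintegral => x _; rewrite /X -iter_mapsD subnKC.
by apply: eq_Rintegral => x _; rewrite /u mulrA.
Qed.

Definition birkhoff_fut i W := exists2 G, bmf01 G & forall x, I01 x -> W x = G (iter_maps T i x).
Local Notation Fut := birkhoff_fut.

(** A bound on [W] controls [G] only on the image of the i-th iterate; truncating [G] at height w
    makes the bound valid on all of [I01] without changing [W]. *)
Let fut_clip i W w : Fut i W -> (forall x, I01 x -> `|W x| <= w) ->
  exists G, [/\ bmf01 G, forall x, I01 x -> W x = G (iter_maps T i x) & forall x, I01 x -> `|G x| <= w].
Proof.
move=> [G [mG _] WG] Ww.
have w0 : 0 <= w by apply: le_trans (normr_ge0 _) (Ww 0 _); rewrite /= in_itv/= lexx ler01.
pose G' x := Num.max (- w) (Num.min w (G x)).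
have G'w x : `|G' x| <= w.
  rewrite ler_norml /G' le_max lexx/= ge_max ge_min lexx/= andbT.
  by rewrite ge0_cp.
exists G'; split => //.
- split; last by exists w.
  by apply: measurable_maxr => //; exact: measurable_minr.
- move=> x Ix; have := Ww x Ix; rewrite WG// ler_norml => /andP[h1 h2].
  by rewrite /G' (min_idPr h2) (max_idPr h1).
Qed.

Let X_cov2 k i W w : (k <= i)%N -> Fut i W -> (forall x, I01 x -> `|W x| <= w) ->
  `|EE (fun x => X k x * W x)| <= K1 * bu * theta ^+ (i - k) * w.
Proof.
move=> ki FW Ww; have [G [bG WG Gw]] := fut_clip FW Ww.
have -> : EE (fun x => X k x * W x) = EE (fun x => X k x * G (iter_maps T i x)).
  by apply: eq_Rintegral => x; rewrite inE => Ix; rewrite WG.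
rewrite g_dual//; apply: le_trans (int01_mul_le (g_BV k i) bG Gw) _.
by rewrite [K1 * bu * _]mulrAC.
Qed.

(** The term 2 bf comes from the BV norm of the product with the centered observable, the term 2 A
    br from subtracting the multiple of the density at time j that restores mean zero. *)
Let bv := K1 * bu * (2 * bf + 2 * A * br).
Let bv0 : 0 < bv.
Proof. by rewrite mulr_gt0 ?mulr_gt0// ltr_pwDl ?mulr_gt0// !mulr_ge0// ltW. Qed.

Let X_cov3 k j i W w : (k <= j <= i)%N -> Fut i W -> (forall x, I01 x -> `|W x| <= w) ->
  `|EE (fun x => X k x * X j x * W x) - EE (fun x => X k x * X j x) * EE W|
     <= K1 * bv * theta ^+ (i - k) * w.
Proof.
move=> /andP[kj ji] FW Ww; have [G [bG WG Gw]] := fut_clip FW Ww.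
pose Q x := G (iter_maps (shift_maps T j) (i - j) x).
have bQ : bmf01 Q by exact: bmf_iter_maps.
have WQ x : I01 x -> W x = Q (iter_maps T j x).
  by move=> Ix; rewrite WG// /Q -iter_mapsD subnKC.
pose c := EE (fun x => X k x * X j x).
have cE : c = EE (fun x => g k j x * ff j x) by rewrite -g_dual.
have c_le : `|c| <= K1 * theta ^+ (j - k) * bu * (2 * A).
  by rewrite cE; apply: int01_mul_le (g_BV k j) (ff_bmf j) (@ff_le j).
have gf_BV := BVle_mul (g_BV k j) (fk_BV (mean_le j)).
pose v x := g k j x * ff j x - c * rho j x.
have v_BV : BVle v (theta ^+ (j - k) * bv).
  apply: BVle_le (BVle_sub c gf_BV (rho_BV j CT)) _.
  apply: (@le_trans _ _ (2 * (K1 * theta ^+ (j - k) * bu * bf) + K1 * theta ^+ (j - k) * bu * (2 * A) * br)).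
    by rewrite lerD2l ler_wpM2r// ltW.
  by rewrite /bv le_eqVlt; apply/orP; left; apply/eqP; ring.
have [gf_L1 _] := gf_BV.
have v_mean : EE v = 0.
  rewrite /v int01B//; last exact: in_L1_Z.
  by rewrite int01Z// -cE iter_transfer_int// int01_cst mulr1 subrr.
have [v_L1 _] := v_BV.
have -> : EE (fun x => X k x * X j x * W x) - c * EE W = EE (fun x => v x * Q x).
  have -> : EE (fun x => X k x * X j x * W x) = EE (fun x => g k j x * (ff j x * Q x)).
    rewrite -g_dual//; last exact: bmfM.
    by apply: eq_Rintegral => x; rewrite inE => Ix; rewrite WQ// mulrA.
  have -> : EE W = EE (fun x => rho j x * Q x).
    by rewrite rho_dual//; apply: eq_Rintegral => x; rewrite inE => Ix; rewrite WQ.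
  have rQ := in_L1_Mbmf (rho_L1 j) bQ.
  rewrite -int01Z// -int01B.
  - by apply: eq_Rintegral => x _; rewrite /v; ring.
  - by apply: in_L1_Mbmf; [case: (g_BV k j)|exact: bmfM].
  - exact: in_L1_Z.
rewrite /Q -iter_transfer_dual//.
have tb0 : 0 < theta ^+ (j - k) * bv by rewrite mulr_gt0// exprn_gt0.
have P_BV := dec_BV (i - j) (maps_in_shift j CT) tb0 v_BV v_mean.
apply: le_trans (int01_mul_le P_BV bG Gw) _.
(* The decay accumulates in two stages: from k to j inside the BV bound of [v], then from j to i by
   decay of zero-mean functions. *)
rewrite (_ : (i - k = (i - j) + (j - k))%N); last by rewrite addnBA// subnK.
by rewrite exprD le_eqVlt; apply/orP; left; apply/eqP; ring.
Qed.

Theorem birkhoff_mixing :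
  @mixing_seq _ (measurableTypeR R) R m I01 X Fut (2 * A) (K1 * bu + K1 * bv) theta.
Proof.
have Kbu0 : 0 <= K1 * bu by rewrite mulr_ge0// ltW.
have Kbv0 : 0 <= K1 * bv by rewrite mulr_ge0// ltW.
have w_ge0 (W : R -> R) w : (forall x, I01 x -> `|W x| <= w) -> 0 <= w.
  by move=> Ww; apply: le_trans (normr_ge0 _) (Ww 0 _); rewrite /= in_itv/= lexx ler01.
split => //.
- by rewrite mulr_ge0.
- by rewrite addr_ge0.
- move=> i W [G bG WG]; have [mGT [B GB]] := bmf_iter_maps T i bG; split.
    by apply: eq_measurable_fun mGT => x; rewrite inE => Ix; rewrite WG.
  by exists B => x Ix; rewrite WG// GB.
- by move=> i r; exists (fun=> r) => //; exact: bmf_cst.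
- by move=> i W W' [G bG WG] [G' bG' WG']; exists (fun x => G x + G' x);
    [exact: bmfD|move=> x Ix; rewrite WG// WG'].
- by move=> i W W' [G bG WG] [G' bG' WG']; exists (fun x => G x * G' x);
    [exact: bmfM|move=> x Ix; rewrite WG// WG'].
- by move=> i W [G bG WG]; exists (fun x => cos (G x)); [exact: bmf_cos|move=> x Ix; rewrite WG].
- by move=> i W [G bG WG]; exists (fun x => G (T i.+1 x)); [exact: bmf_pexp|move=> x Ix; rewrite WG].
- by move=> i; exists (ff i).
- by move=> i x Ix; apply: ff_le; exact: iter_maps_stable.
- move=> k i W w ki FW Ww; apply: le_trans (X_cov2 ki FW Ww) _.
  apply: ler_wpM2r; first exact: (w_ge0 W).
  by apply: ler_wpM2r; [rewrite exprn_ge0// ltW|rewrite lerDl].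
- move=> k j i W w kji FW Ww; apply: le_trans (X_cov3 kji FW Ww) _.
  apply: ler_wpM2r; first exact: (w_ge0 W).
  by apply: ler_wpM2r; [rewrite exprn_ge0// ltW|rewrite lerDr].
Qed.

End BirkhoffMixing.

(** * The theorem *)

Section LogAverageMeasure.
Context {R : realType}.
Implicit Types (y : nat -> R) (phi : R -> R).

Lemma ge0_integral_log_average y n phi : measurable_fun setT phi -> (forall x, 0 <= phi x) ->
  (\int[log_average y n]_x (phi x)%:E = (log_avg (fun k => phi (y k)) n)%:E)%E.
Proof.
move=> mphi phi0.
have mphi' : measurable_fun (setT : set (measurableTypeR R)) (EFin \o phi) by exact/measurable_EFinP.
have phi0' (x : measurableTypeR R) : setT x -> (0 <= (EFin \o phi) x)%E by rewrite lee_fin.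
rewrite /log_average ge0_integral_mscale// ge0_integral_measure_sum//.
rewrite /log_avg EFinM big_add1/= big_mkord -sumEFin; congr (_ * _)%E.
apply: eq_bigr => k _.
by rewrite ge0_integral_mscale//= integral_dirac// diracT mul1e.
Qed.

Lemma integral_log_average y n phi : measurable_fun setT phi ->
  \int[log_average y n]_x phi x = log_avg (fun k => phi (y k)) n.
Proof.
move=> mphi.
pose part (s x : R) := Num.max (s * phi x) 0.
have part0 s x : 0 <= part s x by rewrite /part le_max lexx orbT.
have mpart s : measurable_fun setT (part s).
  by apply: measurable_maxr => //; exact: measurable_funM.
rewrite /Rintegral integralE.
have -> : ((fun x => (phi x)%:E)^\+ = (fun x => (part 1 x)%:E))%E.
  by apply/funext => x; rewrite funeposE EFin_max /part mul1r.
have -> : ((fun x => (phi x)%:E)^\- = (fun x => (part (-1) x)%:E))%E.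
  by apply/funext => x; rewrite funenegE EFin_max /part mulN1r EFinN.
rewrite !ge0_integral_log_average// -EFinB /= /log_avg -mulrBr -sumrB; congr (_ * _).
apply: eq_bigr => k _; rewrite -mulrBr; congr (_ * _); rewrite /part mul1r mulN1r.
by case: (leP (phi (y k)) 0); case: (leP (- phi (y k)) 0); lra.
Qed.

End LogAverageMeasure.

Section LipschitzObservables.
Context {R : realType}.
Local Notation m := (@lebesgue_measure R).

Lemma norm2_sqr (f : R -> R) : @bmf _ (measurableTypeR R) R I01 f ->
  norm2 f ^+ 2 = \int[m]_(x in I01) (f x ^+ 2).
Proof.
move=> bf; have ia := in_L1_bmf (bmfX 2 bf).
rewrite /norm2 /Lnorm01 unlock.
have -> : (\int[m]_x (`|((EFin \o f) \_ I01) x| `^ 2) = (\int[m]_(x in I01) (f x ^+ 2))%:E)%E.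
  rewrite fineK; last exact: (integrable_fin_num measurable_I01 ia).
  rewrite [RHS]integral_mkcond; apply: eq_integral => x _.
  rewrite !patchE; case: ifPn => _; last by rewrite /= normr0 powR0 ?pnatr_eq0.
  by rewrite /= powR_mulrn// real_normK ?num_real.
have a0 : 0 <= \int[m]_(x in I01) (f x ^+ 2) by apply: Rintegral_ge0 => x _; exact: sqr_ge0.
by rewrite poweR_EFin /= powR12_sqrt// sqr_sqrtr.
Qed.

Lemma lipschitz_I01_bound (f : R -> R) : [lipschitz f x | x in I01] -> exists2 L : R, 0 <= L &
  forall x y, I01 x -> I01 y -> `|f x - f y| <= L * `|x - y|.
Proof.
(* The Lipschitz estimate is available for every constant strictly above M. *)
move=> [M [_ lipM]]; exists (Num.max 0 M + 1).
  by rewrite addr_ge0// le_max lexx.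
have MM : M < Num.max 0 M + 1 by rewrite ltr_pwDr// le_max lexx orbT.
move=> x y Ix Iy; exact: (lipM _ MM (x, y) (conj Ix Iy)).
Qed.

(** Composing with the projection of the line onto [I01] gives a function continuous everywhere that
    agrees with [f] on [I01]. *)
Lemma lipschitz_measurable (f : R -> R) (L : R) : 0 <= L ->
  (forall x y, I01 x -> I01 y -> `|f x - f y| <= L * `|x - y|) -> measurable_fun (I01 : set R) f.
Proof.
move=> L0 fL; pose clamp (x : R) : R := Num.max 0 (Num.min 1 x).
have clampI x : I01 (clamp x).
  by rewrite /= in_itv/= /clamp le_max lexx/= ge_max ler01 ge_min lexx.
have clampE x : I01 x -> clamp x = x.
  by rewrite /= in_itv/= => /andP[x0 x1]; rewrite /clamp (min_idPr x1) (max_idPr x0).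
have clamp_le x y : `|clamp x - clamp y| <= `|x - y|.
  have h1 := ler_norm (x - y); have h2 := ler_norm (y - x); rewrite (distrC y) in h2.
  rewrite ler_norml /clamp; apply/andP; split;
    case: (leP 0 (Num.min 1 x)); case: (leP 0 (Num.min 1 y));
    case: (leP 1 x); case: (leP 1 y) => ? ? ? ?; lra.
have cF : continuous (fun x => f (clamp x)).
  move=> x; apply/cvgrPdist_le => e e0; near=> y.
  apply: le_trans (fL _ _ (clampI x) (clampI y)) _.
  apply: (@le_trans _ _ ((L + 1) * `|x - y|)).
    by apply: ler_pM => //; rewrite lerDl.
  rewrite mulrC -ler_pdivlMr; last by rewrite ltr_wpDl.
  near: y; have /cvgrPdist_le := @cvg_id _ (nbhs x); apply.
  by rewrite divr_gt0// ltr_wpDl.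
have mF : measurable_fun (I01 : set R) (fun x => f (clamp x)).
  by apply: measurable_funTS; exact: continuous_measurable_fun.
by apply: eq_measurable_fun mF => x; rewrite inE => /clampE ->.
Unshelve. all: by end_near.
Qed.

End LipschitzObservables.

Section BirkhoffSums.
Context {R : realType}.
Local Notation m := (@lebesgue_measure R).

Lemma birkhoff_mixing_exists (C : set (pexp_map R)) (T : nat -> pexp_map R) (f : R -> R) :
  (exists2 r : nat, (1 <= r)%N & cond_D C r) -> cond_Dec C -> maps_in C T ->
  [lipschitz f x | x in I01] ->
  exists B K theta, @mixing_seq _ (measurableTypeR R) R m I01 (birkhoff_obs T f)
    (birkhoff_fut T) B K theta.
Proof.
move=> [r r1 HD] HDec CT /lipschitz_I01_bound[L L0 fL].
have [br br0 rhoBV] := iter_transfer1_BV r1 HD.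
have [theta [K1 [th01 K10 decBV]]] := cond_Dec_BV HDec.
have mf := lipschitz_measurable L0 fL.
have I0 : I01 (0 : R) by rewrite /= in_itv/= lexx ler01.
pose A := `|f 0| + L.
have A0 : 0 <= A by rewrite addr_ge0.
have fA x : I01 x -> `|f x| <= A.
  move=> Ix; rewrite /A -lerBlDl; apply: le_trans (_ : `|f x - f 0| <= _).
    by apply: le_trans (ler_dist_dist _ _); exact: ler_norm.
  apply: le_trans (fL x 0 Ix I0) _; rewrite subr0 ler_piMr//.
  by move: Ix; rewrite /= in_itv/= => /andP[x0 x1]; rewrite ger0_norm.
(* The added 1 makes the bound positive even for f = 0, as the decay estimate requires. *)
have fkBV c : `|c| <= A -> BVle (fun y => f y - c) (L + 2 * A + 1).
  move=> cA; apply: (@BVle_le _ _ (L + 2 * A)); last by rewrite lerDl.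
  apply: BVle_lipschitz => //.
  - exact: measurable_funB.
  - by move=> x y Ix Iy; rewrite opprB addrA subrK; exact: fL.
  - move=> x Ix; apply: le_trans (ler_normB _ _) _.
    by rewrite (_ : 2 * A = A + A) ?lerD ?fA// mulr_natl mulr2n.
have bf0 : 0 < L + 2 * A + 1 by rewrite ltr_wpDl// addr_ge0// mulr_ge0.
eexists; eexists; exists theta.
apply: (birkhoff_mixing CT br0 th01 K10 rhoBV decBV A0 bf0 fkBV) => //.
by split => //; exists A.
Qed.

End BirkhoffSums.

Theorem proposition12 (R : realType) (C : set (pexp_map R))
  (HD : exists2 r : nat, (1 <= r)%N & cond_D C r)
  (HDec : cond_Dec C)
  (Hbounds : exists lambda M : R, [/\ 1 < lambda, 1 <= M &
     forall T, C T ->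
       (lambda%:E <= inf_abs_deriv T)%E /\ (sup_abs_deriv2 T <= M%:E)%E])
  (Hcard : exists2 N : nat, (1 <= N)%N & forall T, C T -> (pexp_part T #<= `I_N)%card)
  (T : nat -> pexp_map R) (HT : forall n, (1 <= n)%N -> C (T n))
  (HMin : cond_Min T)
  (f : R -> R) (Hf : [lipschitz f x | x in I01])
  (HS : exists2 c : R, 0 < c &
     forall n, (1 <= n)%N -> c * Num.sqrt n%:R <= norm2 (centered_birkhoff_sum f T n)) :
  ae01 (fun x : R =>
    weak_cvg
      (log_average (fun k => centered_birkhoff_sum f T k x / norm2 (centered_birkhoff_sum f T k)))
      (normal_prob (0 : R) 1)).
Proof.
have [B [K [theta mix]]] := birkhoff_mixing_exists HD HDec HT Hf.
have [c c0 HS'] := HS.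
have sgE k : (1 <= k)%N -> norm2 (centered_birkhoff_sum f T k) ^+ 2 =
    \int[lebesgue_measure]_(x in I01) (\sum_(0 <= j < k) birkhoff_obs T f j x) ^+ 2.
  move=> k1; rewrite norm2_sqr//.
  by apply: (@bmf_sum _ (measurableTypeR R)) => j; exact: (fut_bmf mix (fut_X mix j)).
(* The centered Birkhoff sums are by conversion the sums of the mixing sequence, and [norm2] of
   these sums is the normalization, with [HS'] its lower bound. *)
apply: ae01S (ae_clt_log_avg measurable_I01 lebesgue_I01 mix c0 HS' sgE) => x Ix lim.
move=> phi cphi bphi; have := lim phi cphi bphi.
rewrite (_ : (fun n => _) = (fun n => \int[log_average (fun k => centered_birkhoff_sum f T k x / norm2 (centered_birkhoff_sum f T k)) n]_z phi z))//.
by apply/funext => n; rewrite integral_log_average//; exact: continuous_measurable_fun.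
Qed.
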